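(* Let $v$ and $W_\eta$ satisfy the assumptions in the context. Let $\rho,\sigma$ be two weak entropy solutions (for the same noise realization $\epsilon(\cdot,\omega)$) to $$\partial_t\rho+\partial_x\Bigl(\rho\,\bigl(W_\eta*v_\epsilon(\rho,t)\bigr)\Bigr)=0$$ with initial data $\rho_0,\sigma_0\in(L^1\cap\mathrm{BV})(\mathbb{R};[0,\rho^{max}])$ respectively. Then, for any $T>0$, $$\lVert(\rho(t,\cdot)-\sigma(t,\cdot))(\omega)\rVert_{L^1(\mathbb{R})}\le\exp(K_\epsilon(\omega)T)\,\lVert\rho_0-\sigma_0\rVert_{L^1(\mathbb{R})}\qquad\forall t\in[0,T],\ \forall\omega\in\Omega,$$ with $0\le K_\epsilon(\omega)\le K$ for all $\omega\in\Omega$, where $$K_\epsilon=\lVert v_\epsilon'\rVert\Bigl(W_\eta(0)\bigl(\sup_{t\in[0,T]}\lVert\rho(t,\cdot)\rVert_{\mathrm{BV}(\mathbb{R})}+2\sup_{t\in[0,T]}\lVert\rho(t,\cdot)\rVert_{L^1(\mathbb{R})}\bigr)+\lVert W_\eta'\rVert\sup_{t\in[0,T]}\lVert\rho(t,\cdot)\rVert_{L^1(\mathbb{R})}\Bigr)$$ and $K$ is the same expression with $\lVert v_\epsilon'\rVert$ replaced by $\lVert v'\rVert$.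
   Context: Kernel: $\eta>0$, $W_\eta\in C^1([0,\eta];\mathbb{R}^+)$ (values $\ge 0$) with $W_\eta'\le 0$, $\int_0^\eta W_\eta(x)\,dx=1$, and, as a family in $\eta$, $\lim_{\eta\to\infty}W_\eta(0)=0$. Velocity: $\rho^{max}>0$, $v\in C^2([0,\rho^{max}];\mathbb{R}^+)$ (values $\ge0$) with $v'\le 0$ and $v(0)=v^{max}>0$. Noise: on a probability space $(\Omega,\mathcal{A},\mathbb{P})$, with $0\le\tau<v^{max}$, $\delta_R>0$, $s_k=k\delta_R$, $R_T=\lfloor T/\delta_R\rfloor$, set $\epsilon(t,\omega)=\sum_{k=1}^{R_T}U_k(\omega)\chi_{[s_k,s_{k+1})}(t)$ for $t\in[0,T]$, where $U_1,\dots,U_{R_T}$ are i.i.d. uniformly distributed on $[-\tau,\tau]$, with $|U_k(\omega)|\le\tau$ for all $\omega$. In particular $\epsilon(0)=0$. Random velocity: $v_\epsilon(\rho,t)=\max\{0,v(\rho)+\epsilon(t)\}$ and $v_\epsilon'(\rho,t):=v'(\rho)\,\chi_{(0,\infty)}(v(\rho)+\epsilon(t))$, for $\rho\in[0,\rho^{max}]$ (dependence on $\omega$ suppressed). Norms: $\lVert v_\epsilon'\rVert(\omega)=\sup_{t\in[0,T]}\sup_{\rho\in[0,\rho^{max}]}|v_\epsilon'(\rho,t)(\omega)|$; $\lVert v'\rVert$ and $\lVert W_\eta'\rVert$ are supremum norms on $[0,\rho^{max}]$ and $[0,\eta]$. Here $\lVert\rho(t,\cdot)\rVert_{\mathrm{BV}(\mathbb{R})}:=\mathrm{TV}(\rho(t,\cdot);\mathbb{R})$.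 Convolution: $V_\epsilon(t,x)=\bigl(W_\eta*v_\epsilon(\rho,\cdot)\bigr)(t,x):=\int_x^{x+\eta}W_\eta(y-x)\,v_\epsilon(\rho(t,y),t)\,dy$. Put $f_\epsilon(t,x,\rho)=\rho V_\epsilon(t,x)$; for a given density $\rho=\rho(t,x)$ and a constant $c$, $f_\epsilon(t,x,c)=c\,V_\epsilon(t,x)$, where $V_\epsilon$ is formed with the density $\rho$. Weak entropy solution with initial datum $\rho_0$ (for fixed $\omega$): a function $\rho\in C([0,T];L^1(\mathbb{R}))$ with $\rho(t,\cdot)\in\mathrm{BV}(\mathbb{R};\mathbb{R})$ (values in $[0,\rho^{max}]$, the domain of $v$) such that for all $\phi\in C_0^1([0,T)\times\mathbb{R};\mathbb{R}^+)$ and all $c\in\mathbb{R}$ $$\int_0^T\!\!\int_{\mathbb{R}}|\rho-c|\,\partial_t\phi+\mathrm{sign}(\rho-c)\bigl(f_\epsilon(t,x,\rho)-f_\epsilon(t,x,c)\bigr)\partial_x\phi-\mathrm{sign}(\rho-c)\,\partial_xf_\epsilon(t,x,c)\,\phi\,dx\,dt+\int_{\mathbb{R}}|\rho_0(x)-c|\,\phi(0,x)\,dx\ge0.$$ *)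

(* Defs.v *)
From HB Require Import structures.
From mathcomp Require Import all_boot all_order all_algebra.
From mathcomp Require Import all_classical all_reals all_analysis.

Set Implicit Arguments.
Unset Strict Implicit.
Unset Printing Implicit Defensive.

Import Order.TTheory GRing.Theory Num.Theory.
Import numFieldNormedType.Exports.

Local Open Scope classical_set_scope.
Local Open Scope ring_scope.

Section Regularity.
Context {R : realType}.
Implicit Types (A : set R) (f : R -> R) (x : R).

(* Derivative relative to [A]: one-sided at an endpoint of an interval. *)
Definition quotient_within A f x :=
  (f y - f x) / (y - x) @[y --> within A x^'].

Definition derivable_within A f x := cvg (quotient_within A f x).

Definition derive_within A f x : R := lim (quotient_within A f x).

Definition C1_on A f :=
  (forall x, A x -> derivable_within A f x) /\
  {within A, continuous (derive_within A f)}.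

Definition C2_on A f := C1_on A f /\ C1_on A (derive_within A f).

Definition sup_norm A f : \bar R := ereal_sup [set `|f x|%:E | x in A].

End Regularity.

Section L1BV.
Context {R : realType}.
Implicit Types (f g : R -> R).

Notation mu := (@lebesgue_measure R).

Definition L1norm f : \bar R := 'N[mu]_1[EFin \o f]%E.

Definition in_L1 f := mu.-integrable setT (EFin \o f).

Definition pointwise_TV f : \bar R :=
  ereal_sup [set total_variation I.1 I.2 f | I in [set I : R * R | I.1 <= I.2]].

(* Elements of L^1 are classes modulo null sets, so the total variation on the
   real line is the essential one: the infimum over all representatives. *)
Definition TV f : \bar R :=
  ereal_inf [set pointwise_TV g | g in [set g | {ae mu, forall x, f x = g x}]].

Definition in_BV f := (TV f < +oo)%E.

Definition initial_datum (rmax : R) f :=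
  [/\ in_L1 f, in_BV f & forall x, 0 <= f x <= rmax].

Definition in_CL1 (T : R) (rho : R -> R -> R) :=
  (forall t, t \in `[0, T] -> in_L1 (rho t)) /\
  (forall t0, t0 \in `[0, T] ->
    L1norm (rho t \- rho t0) @[t --> within `[0, T] (nbhs t0)] --> 0%E).

End L1BV.

Section Data.
Context {R : realType}.

Definition kernel_family (W : R -> R -> R) :=
  (forall eta, 0 < eta ->
    [/\ C1_on `[0, eta] (W eta),
        forall x, x \in `[0, eta] -> 0 <= W eta x,
        forall x, x \in `[0, eta] -> derive_within `[0, eta] (W eta) x <= 0 &
        (\int[lebesgue_measure]_(x in `[0%R, eta]) (W eta x)%:E = 1)%E]) /\
  W eta 0 @[eta --> +oo] --> (0 : R).

Definition velocity (rmax vmax : R) (v : R -> R) :=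
  [/\ C2_on `[0, rmax] v,
      forall r, r \in `[0, rmax] -> 0 <= v r,
      forall r, r \in `[0, rmax] -> derive_within `[0, rmax] v r <= 0,
      v 0 = vmax &
      0 < vmax].

Definition noise_steps (deltaR T : R) : nat := Num.truncn (T / deltaR).

Definition noise (Omega : Type) (deltaR T : R) (U : nat -> Omega -> R)
    (omega : Omega) (t : R) : R :=
  \sum_(1 <= k < (noise_steps deltaR T).+1)
    U k omega * \1_(`[k%:R * deltaR, k.+1%:R * deltaR[ : set R) t.

End Data.

Section Probability.
Context {R : realType} {d : measure_display} {Omega : measurableType d}.
Variable P : probability Omega R.

(* The case tau = 0 is allowed; the uniform law on [0, 0] is the Dirac mass. *)
Definition uniformly_distributed (tau : R) (X : {RV P >-> R}) :=
  (forall (lt_tau : - tau < tau) (B : set R), measurable B ->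
    distribution P X B = uniform_prob lt_tau B) /\
  (tau = 0 -> forall B : set R, measurable B -> distribution P X B = \d_(0 : R) B).

Definition mutually_independent (n : nat) (U : nat -> {RV P >-> R}) :=
  forall J : seq nat, uniq J -> (forall k, k \in J -> (1 <= k <= n)%N) ->
  forall B : nat -> set R, (forall k, measurable (B k)) ->
  P (\bigcap_(k in [set` J]) (U k @^-1` B k)) =
    (\prod_(k <- J) P (U k @^-1` B k))%E.

Definition noise_assumptions (vmax tau deltaR T : R) (U : nat -> {RV P >-> R}) :=
  let n := noise_steps deltaR T in
  [/\ 0 <= tau < vmax,
      0 < deltaR,
      mutually_independent n U,
      forall k, (1 <= k <= n)%N -> uniformly_distributed tau (U k) &
      forall k omega, (1 <= k <= n)%N -> `|U k omega| <= tau].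

End Probability.

Section Equation.
Context {R : realType}.
Variables (W_eta : R -> R) (eta rmax : R) (v : R -> R) (eps : R -> R) (T : R).

Notation mu := (@lebesgue_measure R).

Definition v_eps (r t : R) : R := Num.max 0 (v r + eps t).

Definition dv_eps (r t : R) : R :=
  derive_within `[0, rmax] v r * \1_(`]0, +oo[ : set R) (v r + eps t).

Definition norm_dv : \bar R := sup_norm `[0, rmax] (derive_within `[0, rmax] v).

Definition norm_dv_eps : \bar R :=
  ereal_sup [set sup_norm `[0, rmax] (dv_eps ^~ t) | t in `[0, T]].

Definition V_eps (rho : R -> R -> R) (t x : R) : R :=
  \int[mu]_(y in `[x, x + eta]) (W_eta (y - x) * v_eps (rho t y) t).

Definition f_eps (rho : R -> R -> R) (t x r : R) : R := r * V_eps rho t x.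

Definition strip : set (R * R) := [set p | 0 <= p.1 < T].

Definition dt (phi : R -> R -> R) (t x : R) : R :=
  derive_within `[0, T[ (phi ^~ x) t.

Definition dx (phi : R -> R -> R) (t x : R) : R := derive1 (phi t) x.

(* Nonnegative C^1 functions with compact support in [0, T[ x R; the support may
   meet {t = 0}, where the time derivative is one-sided. *)
Definition test_function (phi : R -> R -> R) :=
  [/\ forall t x, t \in `[0, T[ ->
        derivable_within `[0, T[ (phi ^~ x) t /\ derivable (phi t) x 1,
      {within strip, continuous (fun p => phi p.1 p.2)},
      {within strip, continuous (fun p => dt phi p.1 p.2)} /\
      {within strip, continuous (fun p => dx phi p.1 p.2)},
      forall t x, t \in `[0, T[ -> 0 <= phi t x &
      exists K : set (R * R), [/\ compact K, K `<=` strip &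
        forall p, strip p -> ~ K p -> phi p.1 p.2 = 0]].

(* The integral over ]0, T[ x R is iterated, so that it depends only on the
   classes of the rho(t, .). V_eps is Lipschitz in x, so its x-derivative
   exists almost everywhere. *)
Definition entropy_inequality (rho : R -> R -> R) (rho0 : R -> R) :=
  forall (phi : R -> R -> R) (c : R), test_function phi ->
  0 <= \int[mu]_(t in `[0, T[) \int[mu]_(x in setT)
         (`|rho t x - c| * dt phi t x
          + Num.sg (rho t x - c)
            * (f_eps rho t x (rho t x) - f_eps rho t x c) * dx phi t x
          - Num.sg (rho t x - c)
            * derive1 (fun y => f_eps rho t y c) x * phi t x)
       + \int[mu]_(x in setT) (`|rho0 x - c| * phi 0 x).

Definition weak_entropy_solution (rho0 : R -> R) (rho : R -> R -> R) :=
  [/\ in_CL1 T rho,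
      forall t, t \in `[0, T] -> in_BV (rho t),
      forall t x, t \in `[0, T] -> 0 <= rho t x <= rmax &
      entropy_inequality rho rho0].

(* The constant of the stability estimate as a function of the norm [N] of the
   derivative of the velocity, extended-real because the suprema over time may
   a priori be infinite. *)
Definition stability_constant (N : \bar R) (rho : R -> R -> R) : \bar R :=
  let supTV := ereal_sup [set TV (rho t) | t in `[0, T]] in
  let supL1 := ereal_sup [set L1norm (rho t) | t in `[0, T]] in
  let norm_dW := sup_norm `[0, eta] (derive_within `[0, eta] W_eta) in
  (N * ((W_eta 0)%:E * (supTV + 2%:E * supL1) + norm_dW * supL1))%E.

Definition K_eps (rho : R -> R -> R) := stability_constant norm_dv_eps rho.

Definition K_det (rho : R -> R -> R) := stability_constant norm_dv rho.

End Equation.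

(* Main.v *)
(* The two solutions are compared by duality with the backward transport equation
   rather than by doubling of variables.  The entropy inequalities for c = 0 and
   c = rmax + 1 reduce to the weak formulation: during each noise step, for every
   test function psi, the derivative of the integral of rho psi is the integral of
   rho V_rho psi'.  Transporting psi backwards along the Lipschitz velocity V_sigma
   (by Euler steps psi o (id + h V_sigma), which preserve 0 <= psi <= 1) gives
     ||rho - sigma||(t) <= ||rho - sigma||(s) + 2 (t - s) beta,
   where beta bounds the integrals of rho (V_rho - V_sigma) psi' on [s, t].  Since the
   nonincreasing kernel is a mixture of indicators of intervals [0, s], one may take
   beta = W(0)/2 * sup TV(rho) * ||v_eps'|| * sup ||rho - sigma||, and Gronwall's
   lemma yields the exponent ||v_eps'|| W(0) sup TV(rho) <= K_eps.

   If sup TV(rho) is infinite, K_eps is infinite unless ||v_eps'|| W(0) = 0; this and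
   the case rho0 = sigma0 still require some finite bound of TV(rho(t)) on [0, T].  The
   same duality argument applied to rho(t, . + z) - rho(t, .), forwards and backwards in
   time, shows that TV(rho(s)) and TV(rho(t)) are comparable when TV(rho) is bounded
   on [s, t], and a Baire category argument then gives boundedness on [0, T]. *)
From HB Require Import structures.
Require Import Defs.
From mathcomp Require Import all_boot all_order all_algebra.
From mathcomp Require Import all_classical all_reals all_analysis.
From mathcomp Require Import measurable_realfun ring lra.
Set Implicit Arguments.
Unset Strict Implicit.
Unset Printing Implicit Defensive.
Import Order.TTheory GRing.Theory Num.Theory.
Import numFieldNormedType.Exports.
Local Open Scope classical_set_scope.
Local Open Scope ring_scope.

(** * Integrals on the real line *)

(** Duality works because the equation is conservative: [w = rho - sigma] solves a linear continuity
    equation with the Lipschitz velocity V_sigma and the source [- (rho (V_rho - V_sigma))_x]. A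
    test function transported along V_sigma sees only the source. As its values stay in [0, 1], it
    bounds the positive part of [w]; running the argument for [w] and [- w] gives a factor 2, which
    cancels the 1/2 gained by centring the test function.

    Total variation is used only as the L^1 modulus of translations. This modulus ignores null sets,
    is lower semicontinuous in L^1, and lets a translation pass from one factor of an integral to
    the other, so differences replace integration by parts against the derivative of a BV function.

    The main obstacle is that TV(rho(t)) is finite for each t but not assumed bounded in t.
    Gronwall's lemma needs a growth bound linear in TV, whereas the estimate used for stability
    becomes quadratic when it is applied to a translate; hence the second estimate
    [int_test_conv_le_sup]. Even that one needs some bound of TV on the interval beforehand, which
    only the category argument supplies. *)

Section IntegralTools.
Context {R : realType}.
Implicit Types (f g h : R -> R).
Local Notation mu := (@lebesgue_measure R).

Lemma in_L1_measurable f : in_L1 f -> measurable_fun setT f.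
Proof. by move=> /measurable_int /measurable_EFinP. Qed.

Lemma in_L1D f g : in_L1 f -> in_L1 g -> in_L1 (fun x => f x + g x).
Proof.
move=> hf hg; rewrite /in_L1 (_ : EFin \o _ = (EFin \o f) \+ (EFin \o g))%E.
  exact: integrableD.
by apply/funext => x.
Qed.

Lemma in_L1N f : in_L1 f -> in_L1 (fun x => - f x).
Proof.
move=> hf; rewrite /in_L1 (_ : EFin \o _ = (-%E \o (EFin \o f)))%E.
  exact: integrableN.
by apply/funext => x.
Qed.

Lemma in_L1B f g : in_L1 f -> in_L1 g -> in_L1 (fun x => f x - g x).
Proof. by move=> hf hg; apply: in_L1D => //; exact: in_L1N. Qed.

Lemma in_L1Mr f g (C : R) : in_L1 f -> measurable_fun setT g ->
  (forall x, `|g x| <= C) -> in_L1 (fun x => f x * g x).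
Proof.
move=> hf mg gC; rewrite /in_L1.
rewrite (_ : EFin \o _ = (EFin \o f) \* (EFin \o g))%E; last by apply/funext.
apply: integrableMl => //.
exists C; split; first exact: num_real.
by move=> y Cy x _; apply: le_trans (gC x) _; exact: ltW.
Qed.

Lemma in_L1Ml f g (C : R) : in_L1 f -> measurable_fun setT g ->
  (forall x, `|g x| <= C) -> in_L1 (fun x => g x * f x).
Proof.
move=> hf mg gC; rewrite (_ : (fun x => _) = (fun x => f x * g x)).
  exact: in_L1Mr gC.
by apply/funext => x; rewrite mulrC.
Qed.

Lemma in_L1Zl f (k : R) : in_L1 f -> in_L1 (fun x => k * f x).
Proof. by move=> hf; apply: (in_L1Ml (C := `|k|)) => //; exact: measurable_cst. Qed.

Lemma in_L1_norm f : in_L1 f -> in_L1 (fun x => `|f x|).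
Proof. by move=> hf; apply: integrable_norm. Qed.

Lemma le_in_L1 f g : measurable_fun setT f -> (forall x, `|f x| <= g x) ->
  in_L1 g -> in_L1 f.
Proof.
move=> mf fg hg; apply: le_integrable hg => //; first exact/measurable_EFinP.
by move=> x _ /=; rewrite lee_fin (le_trans (fg x))// ler_norm.
Qed.

Lemma intD f g : in_L1 f -> in_L1 g ->
  \int[mu]_x (f x + g x) = \int[mu]_x f x + \int[mu]_x g x.
Proof. by move=> hf hg; rewrite RintegralD. Qed.

Lemma intB f g : in_L1 f -> in_L1 g ->
  \int[mu]_x (f x - g x) = \int[mu]_x f x - \int[mu]_x g x.
Proof. by move=> hf hg; rewrite RintegralB. Qed.

Lemma intZl f (k : R) : in_L1 f -> \int[mu]_x (k * f x) = k * \int[mu]_x f x.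
Proof. by move=> hf; rewrite RintegralZl. Qed.

Lemma intN f : in_L1 f -> \int[mu]_x (- f x) = - \int[mu]_x f x.
Proof.
move=> hf; rewrite -mulN1r -intZl//; congr fine; apply: eq_integral => x _.
by rewrite mulN1r.
Qed.

Lemma le_int f g : in_L1 f -> in_L1 g -> (forall x, f x <= g x) ->
  \int[mu]_x f x <= \int[mu]_x g x.
Proof. by move=> hf hg fg; apply: le_Rintegral. Qed.

Lemma eq_int f g : f =1 g -> \int[mu]_x f x = \int[mu]_x g x.
Proof. by move=> fg; apply: eq_Rintegral => x _; exact: fg. Qed.

Definition n1 f : R := \int[mu]_x `|f x|.

Lemma n1_ge0 f : 0 <= n1 f.
Proof. by apply: Rintegral_ge0. Qed.

Lemma ler_int_n1 f : in_L1 f -> `|\int[mu]_x f x| <= n1 f.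
Proof. by move=> hf; apply: le_normr_Rintegral. Qed.

Lemma le_n1 f g : in_L1 f -> in_L1 g -> (forall x, `|f x| <= g x) ->
  n1 f <= \int[mu]_x g x.
Proof. by move=> hf hg fg; apply: le_int => //; exact: in_L1_norm. Qed.

Lemma ler_int_bound f g : measurable_fun setT f -> in_L1 g ->
  (forall x, `|f x| <= g x) -> `|\int[mu]_x f x| <= \int[mu]_x g x.
Proof.
move=> mf hg fg; have hf : in_L1 f by exact: le_in_L1 hg.
exact: le_trans (ler_int_n1 hf) (le_n1 hf hg fg).
Qed.

Lemma ler_intMb f g (C : R) : in_L1 f -> measurable_fun setT g ->
  (forall x, `|g x| <= C) -> `|\int[mu]_x (f x * g x)| <= C * n1 f.
Proof.
move=> hf mg gC; rewrite /n1 -intZl; last exact: in_L1_norm.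
apply: ler_int_bound.
- by apply: measurable_funM => //; exact: in_L1_measurable.
- by apply: in_L1Zl; exact: in_L1_norm.
- by move=> x; rewrite normrM mulrC ler_wpM2r.
Qed.

Lemma n1D f g : in_L1 f -> in_L1 g -> n1 (fun x => f x + g x) <= n1 f + n1 g.
Proof.
move=> hf hg; rewrite /n1 -intD; try exact: in_L1_norm.
apply: le_int => [||x]; last exact: ler_normD.
- by apply: in_L1_norm; exact: in_L1D.
- by apply: in_L1D; exact: in_L1_norm.
Qed.

Lemma n1N f : n1 (fun x => - f x) = n1 f.
Proof. by apply: eq_int => x; rewrite normrN. Qed.

Lemma n1_sub f g h : in_L1 f -> in_L1 g -> in_L1 h ->
  n1 (fun x => f x - h x) <= n1 (fun x => f x - g x) + n1 (fun x => g x - h x).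
Proof.
move=> hf hg hh; rewrite (_ : (fun x => f x - h x) =
  (fun x => (f x - g x) + (g x - h x))); last by apply/funext => x; lra.
by apply: n1D; exact: in_L1B.
Qed.

Lemma n1_dist f g : in_L1 f -> in_L1 g -> `|n1 f - n1 g| <= n1 (fun x => f x - g x).
Proof.
move=> hf hg; have := n1D (in_L1B hf hg) hg; have := n1D (in_L1B hg hf) hf.
have -> : n1 (fun x => g x - f x) = n1 (fun x => f x - g x).
  by apply: eq_int => x; rewrite distrC.
have -> : (fun x => g x - f x + f x) = g by apply/funext => x; lra.
have -> : (fun x => f x - g x + g x) = f by apply/funext => x; lra.
by move=> h1 h2; rewrite ler_norml; apply/andP; split; lra.
Qed.

(** Translation invariance by uniqueness: a measure that gives every half-open interval its length
    is Lebesgue measure. *)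
Lemma pushforward_shift (a : R) (A : set (measurableTypeR R)) : measurable A ->
  pushforward mu (fun x : measurableTypeR R => (x + a : measurableTypeR R)) A = mu A.
Proof.
move=> mA; have mphi : measurable_fun setT
    (fun x : measurableTypeR R => (x + a : measurableTypeR R)).
  by apply: measurable_funD => //; exact: measurable_id.
pose phi_mixin := isMeasurableFun.Build _ _ _ _ _ mphi.
pose phi : {mfun _ >-> _} :=
  HB.pack (fun x : measurableTypeR R => (x + a : measurableTypeR R)) phi_mixin.
have /(_ mphi _ A mA) <- // := @lebesgue_measure_unique R (pushforward mu phi).
move=> X [[u v] /= uv <-].
rewrite /pushforward /= (_ : _ @^-1` _ = `]u - a, v - a]%classic).
  by rewrite !lebesgue_measure_itv /= !lte_fin ltrD2r; case: ifP => // _; rewrite -!EFinD; congr (_%:E); lra.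
by apply/seteqP; split => x /=; rewrite !in_itv /= => /andP[h1 h2]; apply/andP; split; lra.
Qed.

Lemma measurable_shift f (a : R) : measurable_fun setT f ->
  measurable_fun setT (fun x : R => f (x + a)).
Proof.
move=> mf; apply: (measurableT_comp mf).
by apply: measurable_funD => //; exact: measurable_cst.
Qed.

Lemma ge0_integral_shift (f : R -> \bar R) (a : R) : measurable_fun setT f ->
  (forall x, 0 <= f x)%E -> (\int[mu]_x (f \o +%R^~ a) x = \int[mu]_x f x)%E.
Proof.
move=> mf f0; pose sh (x : measurableTypeR R) : measurableTypeR R := x + a.
have msh : measurable_fun setT sh by apply: measurable_funD => //; exact: measurable_id.
transitivity (\int[pushforward mu sh]_x f x)%E.
  by rewrite ge0_integral_pushforward.
by apply: eq_measure_integral => A mA _; have := pushforward_shift a mA.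
Qed.

Lemma in_L1_shift f (a : R) : in_L1 f -> in_L1 (fun x => f (x + a)).
Proof.
move=> hf; have mf := in_L1_measurable hf.
apply/integrableP; split; first by apply/measurable_EFinP; exact: measurable_shift.
have -> : (\int[mu]_x `|(EFin \o (fun x : R => f (x + a)%R)) x| = \int[mu]_x `|(f x)%:E|)%E.
  rewrite -(@ge0_integral_shift (fun x => `|(f x)%:E|%E) a) //.
  by apply: measurableT_comp => //; exact/measurable_EFinP.
by case/integrableP : hf.
Qed.

Lemma int_shift f (a : R) : in_L1 f -> \int[mu]_x f (x + a) = \int[mu]_x f x.
Proof.
move=> hf; have mf : measurable_fun setT (EFin \o f) by apply/measurable_EFinP; exact: in_L1_measurable.
rewrite /Rintegral; congr fine; rewrite [LHS]integralE [RHS]integralE.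
have mp : measurable_fun setT ((EFin \o f)^\+)%E by exact: measurable_funepos.
have mn : measurable_fun setT ((EFin \o f)^\-)%E by exact: measurable_funeneg.
rewrite -(ge0_integral_shift a mp) // -(ge0_integral_shift a mn) //.
by congr (_ - _)%E; apply: eq_integral => x _; rewrite /= ?funeposE ?funenegE.
Qed.

Lemma n1_shift f (a : R) : in_L1 f -> n1 (fun x => f (x + a)) = n1 f.
Proof. by move=> hf; rewrite /n1 (@int_shift (fun x => `|f x|)) //; exact: in_L1_norm. Qed.

Lemma in_L1_indic (a b : R) : in_L1 (\1_(`[a, b] : set R) : R -> R).
Proof. exact: integrable_indic_itv. Qed.

Lemma int_indic (a b : R) : a <= b -> \int[mu]_x (\1_(`[a, b] : set R) x) = b - a.
Proof.
move=> ab; rewrite /Rintegral integral_indic //= setIT lebesgue_measure_itv /=.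
rewrite lte_fin; case: ltP => // ba; have -> : b = a by apply/eqP; rewrite eq_le ab ba.
by rewrite subrr.
Qed.

Lemma fubini_swap (a b : R -> R) (k : R * R -> R) (C : R) :
  in_L1 a -> in_L1 b -> measurable_fun setT k -> (forall p, `|k p| <= C) ->
  \int[mu]_x (a x * \int[mu]_y (b y * k (x, y))) =
  \int[mu]_y (b y * \int[mu]_x (a x * k (x, y))).
Proof.
move=> ha hb mk kC.
have ma := in_L1_measurable ha; have mb := in_L1_measurable hb.
pose F (p : R * R) : \bar R := (a p.1 * (b p.2 * k p))%:E.
have mF : measurable_fun setT F.
  apply/measurable_EFinP; apply: measurable_funM; first exact: measurableT_comp.
  by apply: measurable_funM => //; exact: measurableT_comp.
have mk1 y : measurable_fun setT (fun x => k (x, y)) by exact: measurable_fun_pair1.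
have mk2 x : measurable_fun setT (fun y => k (x, y)) by exact: measurable_fun_pair2.
have hbk x : in_L1 (fun y => b y * k (x, y)) by exact: in_L1Mr hb _ _.
have hak y : in_L1 (fun x => a x * k (x, y)) by exact: in_L1Mr ha _ _.
have iF : (mu \x mu)%E.-integrable setT F.
  apply/integrable12ltyP => //.
  have Fle x : (\int[mu]_y `|F (x, y)| <= (`|a x| * (C * n1 b))%R%:E)%E.
    have i0 : in_L1 (fun y => a x * (b y * k (x, y))) by exact: in_L1Zl.
    have := integrable_fin_num measurableT (in_L1_norm i0).
    rewrite /F /= => /fineK <-; rewrite lee_fin.
    have -> : fine (\int[mu]_y (EFin \o (fun y => `|a x * (b y * k (x, y))|%R)) y) =
      `|a x| * \int[mu]_y `|b y * k (x, y)|.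
      rewrite -intZl; last exact: in_L1_norm.
      by congr fine; apply: eq_integral => y _ /=; rewrite normrM.
    rewrite ler_wpM2l//.
    rewrite /n1 -intZl; last exact: in_L1_norm.
    apply: le_int => [||y]; [exact: in_L1_norm|by apply: in_L1Zl; exact: in_L1_norm|].
    by rewrite normrM mulrC ler_wpM2r.
  have iC : in_L1 (fun x => `|a x| * (C * n1 b)).
    apply: (in_L1Mr (C := `|C * n1 b|)) => //; first exact: in_L1_norm.
  case/integrableP : iC => mC; apply: le_lt_trans.
  apply: ge0_le_integral => //.
  - by move=> x _; apply: integral_ge0.
  - apply: (@measurable_fun_fubini_tonelli_F _ _ _ _ _ mu (fun p => `|F p|%E)) => //.
    exact: measurableT_comp.
  - exact: measurableT_comp.
  - by move=> x _; apply: le_trans (Fle x) _; rewrite /= lee_fin ler_norm.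
have E := Fubini iF.
have eL x : (\int[mu]_y F (x, y) = (a x * \int[mu]_y (b y * k (x, y)))%R%:E)%E.
  have i0 : in_L1 (fun y => a x * (b y * k (x, y))) by exact: in_L1Zl.
  by rewrite -intZl // /Rintegral fineK //; exact: integrable_fin_num.
have eR y : (\int[mu]_x F (x, y) = (b y * \int[mu]_x (a x * k (x, y)))%R%:E)%E.
  have i0 : in_L1 (fun x => b y * (a x * k (x, y))) by exact: in_L1Zl.
  rewrite -intZl // /Rintegral fineK //; last exact: integrable_fin_num.
  by apply: eq_integral => x _; rewrite /F /=; congr (_%:E); ring.
rewrite /Rintegral; congr fine.
transitivity (\int[mu]_x \int[mu]_y F (x, y))%E.
  by apply: eq_integral => x _; rewrite eL.
by rewrite E; apply: eq_integral => y _; rewrite eR.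
Qed.

(** Only [g] is assumed measurable: [f] will contain a [derive1] that is known merely almost
    everywhere. The integral of a nonnegative function is a supremum over simple functions below it,
    hence monotone without measurability, so [f] can be squeezed between two measurable
    modifications of [g] on [N]. *)
Lemma Rintegral_eq_off_null (f g : R -> R) (D N : set R) :
  measurable D -> measurable N -> mu N = 0%E -> measurable_fun D g ->
  (forall x, D x -> ~ N x -> f x = g x) ->
  \int[mu]_(x in D) f x = \int[mu]_(x in D) g x.
Proof.
move=> mD mN N0 mg fg; rewrite /Rintegral; congr fine.
have ge0_case (p q : R -> \bar R) : (forall x, 0 <= p x)%E -> (forall x, 0 <= q x)%E ->
    measurable_fun setT q -> (forall x, ~ N x -> p x = q x) ->
    (\int[mu]_x p x = \int[mu]_x q x)%E.
  move=> p0 q0 mq pq.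
  have le_nn (u w : R -> \bar R) : (forall x, 0 <= u x)%E -> (forall x, 0 <= w x)%E ->
      (forall x, u x <= w x)%E -> (\int[mu]_x u x <= \int[mu]_x w x)%E.
    move=> u0 w0 uw; rewrite !ge0_integralTE //; apply: le_ereal_sup.
    by move=> _ [h hu <-]; exists h => // x; exact: le_trans (hu x) (uw x).
  have mNb : measurable_fun setT (fun x : R => x \in N).
    apply: (measurable_fun_bool true); rewrite setTI.
    rewrite (_ : _ @^-1` _ = N) //.
    by apply/seteqP; split => x /=; [move/set_mem|move/mem_set].
  (* [lo] and [up] are [q] changed to 0 and to [+oo] on [N]; both have the integral of [q], and they
     enclose [p]. *)
  pose lo x := if x \in N then 0%E else q x; pose up x := if x \in N then +oo%E else q x.
  have mlo : measurable_fun setT lo.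
    exact: measurable_fun_ifT.
  have mup : measurable_fun setT up.
    exact: measurable_fun_ifT.
  have same (r : R -> \bar R) : (forall x, 0 <= r x)%E -> measurable_fun setT r ->
      (forall x, ~ N x -> r x = q x) -> (\int[mu]_x r x = \int[mu]_x q x)%E.
    move=> r0 mr rq; transitivity (\int[mu]_(x in setT `\` N) r x)%E.
      exact: ge0_negligible_integral.
    transitivity (\int[mu]_(x in setT `\` N) q x)%E.
      by apply: eq_integral => x; rewrite inE => -[_ /rq].
    by apply/esym; exact: ge0_negligible_integral.
  have lo0 x : (0 <= lo x)%E by rewrite /lo; case: ifP.
  have up0 x : (0 <= up x)%E by rewrite /up; case: ifP.
  apply/eqP; rewrite eq_le; apply/andP; split.
    rewrite -(same up) //; last by move=> x Nx; rewrite /up memNset.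
    apply: le_nn => // x; rewrite /up; case: ifPn => [_|]; first exact: leey.
    by move=> /negP xN; rewrite pq // => /mem_set.
  rewrite -(same lo) //; last by move=> x Nx; rewrite /lo memNset.
  apply: le_nn => // x; rewrite /lo; case: ifPn => [_ //|].
  by move=> /negP xN; rewrite pq // => /mem_set.
rewrite integral_mkcond [RHS]integral_mkcond [LHS]integralE [RHS]integralE.
have fgD x : ~ N x -> ((EFin \o f) \_ D) x = ((EFin \o g) \_ D) x.
  by move=> Nx; rewrite /patch; case: ifPn => // /set_mem Dx /=; rewrite fg.
have mgD : measurable_fun setT ((EFin \o g) \_ D).
  have mg' : measurable_fun D (EFin \o g) by apply/measurable_EFinP.
  exact: (measurable_restrictT _ mD).1 mg'.
congr (_ - _)%E; apply: ge0_case => //.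
- exact: measurable_funepos.
- by move=> x Nx; rewrite !funeposE fgD.
- exact: measurable_funeneg.
- by move=> x Nx; rewrite !funenegE fgD.
Qed.

End IntegralTools.

(** * Total variation through translations *)

Section TranslationBound.
Context {R : realType}.
Implicit Types (f g h : R -> R).
Local Notation mu := (@lebesgue_measure R).

(* The total variation enters only through the L^1 modulus of translations, which
   depends on the class of f alone. *)
Definition tvb f (M : R) := forall z, 0 < z -> n1 (fun x => f (x + z) - f x) <= z * M.

Lemma sum_le_total_variation g (x z : R) (k : nat) : 0 < z ->
  ((\sum_(j < k) `|g (x + j%:R * z + z) - g (x + j%:R * z)|)%:E <=
    total_variation x (x + k%:R * z) g)%E.
Proof.
move=> z0; elim: k => [|k ih].
  by rewrite big_ord0 mul0r addr0 total_variationxx.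
have k0 : 0 <= k%:R * z by rewrite mulr_ge0 // ltW.
have e : x + k.+1%:R * z = x + k%:R * z + z by rewrite -natr1; ring.
rewrite big_ord_recr /= EFinD (@total_variationD _ x (x + k.+1%:R * z) (x + k%:R * z)) ?e; [|lra|lra].
by apply: leeD => //; apply: total_variation_ge; lra.
Qed.

Lemma negligible_shift (N : set R) (a : R) : measurable N -> mu N = 0%E ->
  mu.-negligible [set x | N (x + a)].
Proof.
move=> mN N0; exists [set x | N (x + a)]; split => //.
  have := measurable_shift a (@measurable_id _ R setT) measurableT mN.
  by rewrite setTI.
by have := pushforward_shift a mN; rewrite /pushforward => ->.
Qed.

Lemma int_indicM (D : set R) f :
  \int[mu]_(x in D) f x = \int[mu]_x (\1_D x * f x).
Proof.
rewrite Rintegral_mkcond; apply: eq_int => x; rewrite /patch indicE.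
by case: ifP => _; rewrite ?mul1r ?mul0r.
Qed.

Lemma in_L1_indicM (D : set R) f : measurable D -> in_L1 f -> in_L1 (fun x => \1_D x * f x).
Proof.
move=> mD hf; apply: (in_L1Ml (C := 1)) => // x.
by rewrite indicE; case: (_ \in _); rewrite ?normr1 ?normr0 ?ler01.
Qed.

(** Monotone convergence along intervals whose lengths are multiples of [z], so that each can be cut
    into cells of length [z]. *)
Lemma int_le_exhaust f (z B : R) : 0 < z -> in_L1 f -> (forall x, 0 <= f x) ->
  (forall n : nat, \int[mu]_(x in `[- (n%:R * z), n%:R * z[) f x <= B) ->
  \int[mu]_x f x <= B.
Proof.
move=> z0 hf f0 hB.
pose F (n : nat) : set R := `[- (n%:R * z), n%:R * z[%classic.
have ndF : {homo F : n m / (n <= m)%N >-> (n <= m)%O}.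
  move=> n m nm; apply/subsetPset => x; rewrite /F /= !in_itv /= => /andP[h1 h2].
  have : n%:R * z <= m%:R * z by apply: ler_wpM2r; [exact: ltW|rewrite ler_nat].
  by move=> h; apply/andP; split; lra.
have mF i : measurable (F i) by exact: measurable_itv.
have FT : \bigcup_i F i = [set: R].
  apply/seteqP; split => // x _; exists (Num.truncn (`|x| / z)).+1 => //.
  have : `|x| / z < (Num.truncn (`|x| / z)).+1%:R by exact: truncnS_gt.
  rewrite ltr_pdivrMr // ltr_norml => /andP[h1 h2].
  by rewrite /F /= in_itv /=; apply/andP; split => //; exact: ltW.
have mf : measurable_fun setT (EFin \o f).
  by apply/measurable_EFinP; exact: in_L1_measurable.
have cv : (\int[mu]_(x in F i) (EFin \o f) x)%E @[i --> \oo] -->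
    (\int[mu]_(x in \bigcup_i F i) (EFin \o f) x)%E.
  apply: ge0_nondecreasing_set_cvg_integral => // [i|i x _].
    exact: measurable_funS mf.
  by rewrite lee_fin.
rewrite FT in cv.
rewrite -lee_fin fineK; last exact: integrable_fin_num.
rewrite -(cvg_lim _ cv) //; apply: lime_le; first by apply/cvg_ex; eexists; exact: cv.
apply: nearW => n; have := hB n; rewrite -lee_fin /Rintegral fineK //.
by apply: integrable_fin_num => //; apply: integrableS hf.
Qed.

(** Folding: every cell of length [z] is translated back onto the first one. *)
Lemma int_cut_translates f (a z : R) (k : nat) : 0 < z -> in_L1 f ->
  \int[mu]_(x in `[a, a + k%:R * z[) f x =
  \int[mu]_(x in `[a, a + z[) (\sum_(j < k) f (x + j%:R * z)).
Proof.
move=> z0 hf.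
have hfs (j : nat) : in_L1 (fun x => f (x + j%:R * z)) by exact: in_L1_shift.
have hsum (m : nat) : in_L1 (fun x => \sum_(j < m) f (x + j%:R * z)).
  elim: m => [|m ihm].
    by under [X in in_L1 X]eq_fun do rewrite big_ord0; exact: integrable0.
  under [X in in_L1 X]eq_fun do rewrite big_ord_recr /=.
  exact: in_L1D.
elim: k => [|k ih].
  rewrite mul0r addr0 set_itvco0 Rintegral_set0.
  by under eq_Rintegral do rewrite big_ord0; rewrite Rintegral_cst ?mul0r.
have -> : a + k.+1%:R * z = a + k%:R * z + z by rewrite -natr1; ring.
have k0 : 0 <= k%:R * z by rewrite mulr_ge0 // ltW.
rewrite (@itv_bndbnd_setU _ _ _ (BLeft (a + k%:R * z))); last 2 first.
  by rewrite bnd_simp; lra.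
  by rewrite bnd_simp; lra.
rewrite Rintegral_setU //; last 2 first.
  by apply: integrableS hf => //; exact: measurableU.
  by apply/disj_setPLR => x /=; rewrite !in_itv /= => /andP[_ h1] /andP[h2 _]; lra.
rewrite ih [X in _ + X]int_indicM.
rewrite -(int_shift (k%:R * z)); last by apply: in_L1_indicM.
rewrite [X in X + _]int_indicM [RHS]int_indicM -intD; last 2 first.
- exact: in_L1_indicM.
- apply: (@in_L1_shift _ (fun x =>
      \1_(`[(a + k%:R * z), (a + k%:R * z + z)[ : set R) x * f x)).
  exact: in_L1_indicM.
apply: eq_int => x; rewrite big_ord_recr /= mulrDr; congr (_ + _ * _).
rewrite !indicE; congr (nat_of_bool _)%:R; apply/idP/idP.
  by rewrite !inE /= !in_itv /= => /andP[h1 h2]; apply/andP; split; lra.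
by rewrite !inE /= !in_itv /= => /andP[h1 h2]; apply/andP; split; lra.
Qed.

(** After folding, the integrand over one cell of length [z] is the sum of the increments of a
    representative along the grid [x + j z]. This is at most the pointwise variation of the
    representative, and the cell contributes the factor [z]. *)
Lemma TV_tvb f (M : R) : in_L1 f -> (TV f <= M%:E)%E -> tvb f M.
Proof.
move=> hf fM z z0; apply/ler_addgt0Pr => e e0.
have [e1 e10 e1E] : exists2 e1, 0 < e1 & z * (M + e1) = z * M + e.
  by exists (e / z); [rewrite divr_gt0|field; rewrite gt_eqF].
rewrite -e1E.
have : (TV f < (M + e1)%:E)%E by apply: le_lt_trans fM _; rewrite lte_fin ltrDl.
case/ereal_inf_lt => _ [g [N [mN N0 fgN]] <-] gM.
have fg x : ~ N x -> f x = g x.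
  by move=> Nx; apply: contrapT => fgx; apply: Nx; exact: fgN.
pose F x := `|f (x + z) - f x|.
have hF : in_L1 F by apply: in_L1_norm; apply: in_L1B => //; exact: in_L1_shift.
apply: (int_le_exhaust z0) => // n.
set a := - (n%:R * z).
have -> : n%:R * z = a + (2 * n)%:R * z by rewrite /a natrM; ring.
rewrite int_cut_translates //.
(* Off the null set [B] no grid point [x + j z] meets the exceptional set [N], so increments of [f]
   are increments of [g]. *)
have [B [mB B0 NB]] : mu.-negligible (\bigcup_j [set x | N (x + j%:R * z)]).
  by apply: negligible_bigcup => j; exact: negligible_shift.
have mFs (m : nat) : measurable_fun setT (fun x : R => \sum_(j < m) F (x + j%:R * z)).
  by apply: measurable_sum => j; apply: measurable_shift; exact: in_L1_measurable.
have mBb : measurable_fun setT (fun x : R => x \in B).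
  apply: (measurable_fun_bool true); rewrite setTI.
  by rewrite (_ : _ @^-1` _ = B) //; apply/seteqP; split => x /=; [move/set_mem|move/mem_set].
pose G (x : R) := if x \in B then 0 else \sum_(j < 2 * n) F (x + j%:R * z).
have mG : measurable_fun setT G by apply: measurable_fun_ifT.
have -> : \int[mu]_(x in `[a, a + z[) (\sum_(j < 2 * n) F (x + j%:R * z)) =
    \int[mu]_(x in `[a, a + z[) G x.
  apply: (Rintegral_eq_off_null _ mB B0) => //; first exact: measurable_funTS.
  by move=> x _ Bx; rewrite /G memNset.
have tv0 x y : x <= y -> (total_variation x y g <= pointwise_TV g)%E.
  by move=> xy; apply: ereal_sup_ubound; exists (x, y).
have TV0 : (0 <= pointwise_TV g)%E.
  by apply: le_trans (tv0 0 0 _) => //; exact: total_variation_ge0.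
have Me0 : 0 <= M + e1 by rewrite -lee_fin (le_trans TV0) // ltW.
have G0 x : 0 <= G x by rewrite /G; case: ifP => // _; apply: sumr_ge0 => j _; exact: normr_ge0.
have GM x : G x <= M + e1.
  rewrite /G; case: ifPn => [//|/negP Bx].
  have NF (j : nat) : F (x + j%:R * z) = `|g (x + j%:R * z + z) - g (x + j%:R * z)|.
    have Nj i : ~ N (x + i%:R * z).
      by move=> Nx; apply: Bx; apply/mem_set; apply: NB; exists i.
    rewrite /F !fg //.
    by have := Nj j.+1; rewrite -natr1 mulrDl mul1r addrA.
  rewrite -lee_fin; under eq_bigr do rewrite NF.
  apply: le_trans (ltW gM).
  apply: le_trans (sum_le_total_variation _ _ _ z0) _; apply: tv0.
  by rewrite lerDl mulr_ge0 // ltW.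
rewrite int_indicM.
have -> : z * (M + e1) = \int[mu]_x (\1_(`[a, a + z] : set R) x * (M + e1)).
  rewrite RintegralZr //; last exact: in_L1_indic.
  by rewrite int_indic ?lerDl ?ltW // [a + z]addrC addrK.
apply: le_int => [||x].
- apply: (in_L1Mr (C := M + e1)) => // [|x]; last by rewrite ger0_norm.
  exact: integrable_indic_itv.
- by apply: (in_L1Mr (C := `|M + e1|)) => //; exact: in_L1_indic.
- apply: ler_pM => //; rewrite !indicE ?ler0n // ler_nat.
  case: (boolP (x \in `[a, a + z[%classic)) => // /set_mem xI.
  by rewrite mem_set //=; move: xI; rewrite /= !in_itv /= => /andP[-> /ltW].
Qed.

End TranslationBound.

(** * Primitives of bounded measurable functions *)

Section Primitive.
Context {R : realType}.
Implicit Types (f g h a : R -> R).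
Local Notation mu := (@lebesgue_measure R).


Lemma in_L1_indic_bounded h (C x y : R) : measurable_fun setT h ->
  (forall z, `|h z| <= C) -> in_L1 (fun z => \1_(`[x, y] : set R) z * h z).
Proof. by move=> mh hC; apply: (in_L1Mr (C := C)) => //; exact: in_L1_indic. Qed.

Lemma bounded_integrable_itv h (C x y : R) : measurable_fun setT h ->
  (forall z, `|h z| <= C) -> mu.-integrable `[x, y] (EFin \o h).
Proof.
move=> mh hC; apply/integrable_mkcond => //.
have := in_L1_indic_bounded x y mh hC; rewrite /in_L1.
congr (is_true (integrable _ _ _)); apply/funext => z.
by rewrite /= /patch indicE; case: ifP => _; rewrite ?mul1r ?mul0r.
Qed.

Lemma bounded_locally_integrable h (C : R) : measurable_fun setT h ->
  (forall z, `|h z| <= C) -> locally_integrable [set: R] h.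
Proof.
move=> mh hC; split; [exact: mh|exact: openT|move=> K _ cK].
have [A [Ar KA]] := compact_bounded cK.
have KA1 x : K x -> `|x| <= A + 1 by move=> Kx; apply: (KA (A + 1)) => //; rewrite ltrDl.
have /integrableP[mE] := bounded_integrable_itv (- (A + 1)) (A + 1) mh hC.
apply: le_lt_trans; apply: ge0_subset_integral => //.
- exact: compact_measurable.
- by do 2 apply: measurableT_comp => //; apply: measurable_funS mh.
- by move=> x Kx; rewrite /= in_itv /=; rewrite -ler_norml; exact: KA1.
Qed.

(** The antiderivative that vanishes at 0. For either sign of [x] one of the two intervals is empty
    or a point, so the difference is a signed integral. *)
Definition prim h (x : R) : R := \int[mu]_(z in `[0, x]) h z - \int[mu]_(z in `[x, 0]) h z.

Lemma int_cat h (C x y z : R) : measurable_fun setT h -> (forall u, `|h u| <= C) ->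
  x <= y -> y <= z ->
  \int[mu]_(u in `[x, z]) h u = \int[mu]_(u in `[x, y]) h u + \int[mu]_(u in `[y, z]) h u.
Proof.
move=> mh hC xy yz.
have i1 := bounded_integrable_itv x z mh hC.
have i2 := bounded_integrable_itv y z mh hC.
have := @Rintegral_itvB _ h (BLeft x) (BRight z) y i1.
rewrite !bnd_simp => /(_ xy yz); rewrite Rintegral_itv_obnd_cbnd.
  by move=> <-; rewrite addrC subrK.
by apply: integrableS i2 => //; apply: subset_itvr; rewrite bnd_simp.
Qed.

Lemma int_gt_itv h (x y : R) : y < x -> \int[mu]_(u in `[x, y]) h u = 0.
Proof. by move=> yx; rewrite set_itv_ge ?Rintegral_set0 // bnd_simp -ltNge. Qed.

Lemma int_itv1 h (x : R) : \int[mu]_(u in `[x, x]) h u = 0.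
Proof. by rewrite set_itv1 Rintegral_set1. Qed.

Section BoundedMeasurable.
Variables (h : R -> R) (C : R).
Hypotheses (mh : measurable_fun setT h) (hC : forall z, `|h z| <= C).

Lemma prim_sub (x y : R) : x <= y -> prim h y - prim h x = \int[mu]_(u in `[x, y]) h u.
Proof.
move=> xy; rewrite /prim.
have i00 := int_itv1 h 0.
have [x0|x0] := leP 0 x.
  rewrite (int_cat mh hC x0 xy).
  have -> : \int[mu]_(u in `[x, 0]) h u = 0.
    by move: x0; rewrite le_eqVlt => /predU1P[<-//|/(int_gt_itv h)].
  have -> : \int[mu]_(u in `[y, 0]) h u = 0.
    have : 0 <= y by exact: le_trans xy.
    by rewrite le_eqVlt => /predU1P[<-//|/(int_gt_itv h)].
  lra.
rewrite (int_gt_itv h x0).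
have [y0|y0] := leP 0 y.
  rewrite (int_cat mh hC (ltW x0) y0).
  have -> : \int[mu]_(u in `[y, 0]) h u = 0.
    by move: y0; rewrite le_eqVlt => /predU1P[<-//|/(int_gt_itv h)].
  lra.
rewrite (int_gt_itv h y0) (int_cat mh hC xy (ltW y0)); lra.
Qed.

Lemma prim_sub_indic (x s : R) : 0 <= s ->
  prim h (x + s) - prim h x = \int[mu]_z (\1_(`[0, s] : set R) z * h (x + z)).
Proof.
move=> s0; rewrite prim_sub ?lerDl // int_indicM.
rewrite -(int_shift x); last exact: in_L1_indic_bounded.
apply: eq_int => z; rewrite [x + z]addrC; congr (_ * _).
rewrite !indicE; congr (nat_of_bool _)%:R; apply/idP/idP.
  by rewrite !inE /= !in_itv /= => /andP[h1 h2]; apply/andP; split; lra.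
by rewrite !inE /= !in_itv /= => /andP[h1 h2]; apply/andP; split; lra.
Qed.

Lemma prim_sub_le (x y b : R) : x <= y -> (forall z, h z <= b) ->
  prim h y - prim h x <= b * (y - x).
Proof.
move=> xy hb; rewrite prim_sub // int_indicM.
have -> : b * (y - x) = \int[mu]_z (\1_(`[x, y] : set R) z * b).
  by rewrite RintegralZr ?int_indic 1?mulrC //; exact: in_L1_indic.
apply: le_int => [||z].
- exact: in_L1_indic_bounded.
- by apply: (in_L1Mr (C := `|b|)) => //; exact: in_L1_indic.
- by rewrite ler_wpM2l // indicE.
Qed.

End BoundedMeasurable.

Lemma primN h (x : R) : (forall u v, mu.-integrable `[u, v] (EFin \o h)) ->
  prim (fun z => - h z) x = - prim h x.
Proof.
move=> ih; rewrite /prim.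
have N u v : \int[mu]_(z in `[u, v]) (- h z) = - \int[mu]_(z in `[u, v]) h z.
  by rewrite -[RHS]mulN1r -RintegralZl //; under eq_Rintegral do rewrite -mulN1r.
by rewrite !N; ring.
Qed.

Section BoundedMeasurable2.
Variables (h : R -> R) (C : R).
Hypotheses (mh : measurable_fun setT h) (hC : forall z, `|h z| <= C).

Lemma prim_sub_ge (x y b : R) : x <= y -> (forall z, b <= h z) ->
  b * (y - x) <= prim h y - prim h x.
Proof.
move=> xy hb.
have ih u v := bounded_integrable_itv u v mh hC.
have mN : measurable_fun setT (fun z => - h z) by exact: measurableT_comp.
have NC z : `|- h z| <= C by rewrite normrN.
have := @prim_sub_le _ _ mN NC x y (- b) xy (fun z => ltac:(by rewrite lerN2)).
rewrite !primN //; lra.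
Qed.

Lemma prim_lip (x y : R) : `|prim h y - prim h x| <= C * `|y - x|.
Proof.
wlog xy : x y / x <= y.
  have [xy|/ltW yx] := leP x y; first exact.
  by move=> /(_ y x yx); rewrite distrC [`|x - y|]distrC.
have h1 z : h z <= C by apply: le_trans (hC z); exact: ler_norm.
have h2 z : - C <= h z by have := hC z; rewrite ler_norml => /andP[].
rewrite (ger0_norm (_ : 0 <= y - x)) ?subr_ge0 //.
have := prim_sub_le mh hC xy h1; have := prim_sub_ge xy h2.
by rewrite ler_norml => u1 u2; apply/andP; split; lra.
Qed.

Lemma prim_continuous : continuous (prim h).
Proof.
move=> x; apply/cvgrPdist_le => e e0.
have C0 : 0 <= C by apply: le_trans (hC 0).
near=> y; apply: le_trans (prim_lip y x) _.
have : `|x - y| <= e / (C + 1).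
  by near: y; apply: cvgr_dist_le; [exact: cvg_id|rewrite divr_gt0 // ltr_wpDl].
rewrite ler_pdivlMr ?ltr_wpDl // => H; apply: le_trans H.
by rewrite mulrC ler_wpM2l // lerDl.
Unshelve. all: by end_near. Qed.

Lemma prim_measurable : measurable_fun setT (prim h).
Proof. by apply: continuous_measurable_fun; exact: prim_continuous. Qed.

End BoundedMeasurable2.

End Primitive.

Section Primitive2.
Context {R : realType}.
Implicit Types (f g h a : R -> R).
Local Notation mu := (@lebesgue_measure R).

Lemma measurable_int_param a (k : R * R -> R) (C : R) : in_L1 a ->
  measurable_fun setT k -> (forall p, `|k p| <= C) ->
  measurable_fun setT (fun y : R => \int[mu]_x (a x * k (x, y))).
Proof.
move=> ia mk kC.
pose F (p : R * R) : \bar R := (a p.1 * k p)%:E.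
have mF : measurable_fun setT F.
  apply/measurable_EFinP; apply: measurable_funM => //.
  by apply: measurableT_comp => //; exact: in_L1_measurable.
have mp := @measurable_fun_fubini_tonelli_G _ _ _ _ R mu _ (measurable_funepos mF) (funepos_ge0 F).
have mn := @measurable_fun_fubini_tonelli_G _ _ _ _ R mu _ (measurable_funeneg mF) (funeneg_ge0 F).
have := emeasurable_funB mp mn.
move/(measurableT_comp (@fine_measurable R setT measurableT)).
apply: eq_measurable_fun => y _ /=; rewrite /Rintegral integralE.
by congr fine; congr (_ - _)%E; rewrite /fubini_G; apply: eq_integral => x _;
  rewrite ?funeposE ?funenegE.
Qed.

Section BoundedMeasurable3.
Variables (h : R -> R) (C : R).
Hypotheses (mh : measurable_fun setT h) (hC : forall z, `|h z| <= C).

Lemma prim_near_int (b x : R) : b < x ->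
  \near x, \int[mu]_(u in `[b, x]) h u + prim h b = prim h x.
Proof.
move=> bx; near=> y; rewrite -(prim_sub mh hC) ?subrK //.
by apply: ltW; near: y; exact: lt_nbhsr.
Unshelve. all: by end_near. Qed.

Lemma is_derive_prim_of_int (b x l : R) : b < x ->
  (let F y := \int[mu]_(u in `[b, y]) h u in derivable F x 1 /\ derive1 F x = l) ->
  is_derive x 1 (prim h) l.
Proof.
move=> bx /= [dF Fl].
apply: near_eq_is_derive (prim_near_int bx) _.
rewrite -[l]addr0; apply: is_deriveD.
by apply: (DeriveDef dF); rewrite -derive1E.
Qed.

Lemma is_derive_prim (x : R) : {for x, continuous h} -> is_derive x 1 (prim h) (h x).
Proof.
move=> cx; apply: (@is_derive_prim_of_int (x - 1)); first by rewrite ltrBlDr ltrDl.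
apply: (@continuous_FTC1_closed _ _ _ _ (x + 1)) => //.
- by rewrite ltrDl.
- exact: bounded_integrable_itv hC.
- by rewrite ltrBlDr ltrDl.
Qed.

(** Lebesgue's differentiation theorem for the integral from [b], which agrees with [prim h] up to a
    constant on [b < x]; hence the half-line. *)
Lemma ae_is_derive_prim (b : R) :
  {ae mu, forall x, b < x -> is_derive x 1 (prim h) (h x)}.
Proof.
have := @FTC1 _ h (BLeft b) (fun y => bounded_integrable_itv b y mh hC)
  (bounded_locally_integrable mh hC).
apply: filterS; first exact: (ae_filter_ringOfSetsType mu).
by move=> x H bx; apply: (is_derive_prim_of_int bx); apply: H.
Qed.

Lemma prim_shift (z x y : R) : x <= y ->
  prim (fun u => h (u + z)) y - prim (fun u => h (u + z)) x =
  prim h (y + z) - prim h (x + z).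
Proof.
move=> xy; have [s s0 ->] : exists2 s, 0 <= s & y = x + s.
  by exists (y - x); rewrite ?subr_ge0 // addrC subrK.
have -> : x + s + z = x + z + s by ring.
have mhz := measurable_shift z mh.
rewrite (prim_sub_indic mh hC) // (prim_sub_indic mhz (fun u => hC _)) //.
by apply: eq_int => u; congr (_ * h _); ring.
Qed.

Lemma prim_sub_L1 (x y : R) : in_L1 h -> `|prim h y - prim h x| <= n1 h.
Proof.
move=> ih; wlog xy : x y / x <= y.
  have [xy|/ltW yx] := leP x y; first exact.
  by move=> /(_ y x yx); rewrite distrC.
rewrite (prim_sub mh hC xy) int_indicM.
under eq_int do rewrite mulrC.
have := @ler_intMb _ h (\1_(`[x, y])) 1 ih; rewrite mul1r; apply.
  by apply: measurable_indic.
by move=> z; rewrite indicE; case: (_ \in _); rewrite ?normr1 ?normr0 ?ler01.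
Qed.

Lemma int_prim_sub a (s : R) : in_L1 a -> 0 <= s ->
  \int[mu]_x (a x * (prim h (x + s) - prim h x)) =
  \int[mu]_z (\1_(`[0, s] : set R) z * \int[mu]_x (a x * h (x + z))).
Proof.
move=> ia s0.
rewrite -(@fubini_swap R a (\1_(`[0, s])) (fun p => h (p.1 + p.2)) C) //.
- by apply: eq_int => x; rewrite (prim_sub_indic mh hC).
- exact: in_L1_indic.
- by apply: (measurableT_comp mh); exact: measurable_funD.
Qed.

Lemma measurable_int_shift a : in_L1 a ->
  measurable_fun setT (fun z : R => \int[mu]_x (a x * h (x + z))).
Proof.
move=> ia; apply: (@measurable_int_param a (fun p => h (p.1 + p.2)) C) => //.
by apply: (measurableT_comp mh); exact: measurable_funD.
Qed.

(** By Fubini, the pairing with an increment of the primitive is an integral over [z] of pairings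
    with translates of [h], so it suffices to compare each of these with [J]. *)
Lemma int_prim_sub_approx a (s J B : R) : in_L1 a -> 0 <= s ->
  (forall z, 0 <= z <= s -> `|\int[mu]_x (a x * h (x + z)) - J| <= B) ->
  `|\int[mu]_x (a x * (prim h (x + s) - prim h x)) - s * J| <= s * B.
Proof.
move=> ia s0 HB; rewrite int_prim_sub //.
have mI := measurable_int_shift ia.
have ind r : in_L1 (fun z : R => \1_(`[0, s] : set R) z * r).
  by apply: (in_L1Mr (C := `|r|)) => //; exact: in_L1_indic.
have sE r : s * r = \int[mu]_z (\1_(`[0, s] : set R) z * r).
  by rewrite RintegralZr ?int_indic ?subr0 //; exact: in_L1_indic.
have n01 z : `|\int[mu]_x (a x * h (x + z))| <= C * n1 a.
  by apply: ler_intMb => //; exact: measurable_shift.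
rewrite (sE J) -intB //; last by apply: (in_L1Mr _ mI n01); exact: in_L1_indic.
rewrite (sE B); apply: ler_int_bound => //.
- by apply: measurable_funB; [apply: measurable_funM => //; exact: measurable_indic|
    exact: in_L1_measurable].
- move=> z; rewrite -mulrBr indicE; case: (boolP (_ \in _)) => [/set_mem|_].
    by rewrite /= in_itv /= !mul1r => /HB.
  by rewrite !mul0r normr0.
Qed.

End BoundedMeasurable3.

Lemma prim_sub_fun f g (C : R) (x y : R) :
  measurable_fun setT f -> measurable_fun setT g ->
  (forall z, `|f z| <= C) -> (forall z, `|g z| <= C) -> x <= y ->
  prim (fun z => f z - g z) y - prim (fun z => f z - g z) x =
  (prim f y - prim f x) - (prim g y - prim g x).
Proof.
move=> mf mg fC gC xy.
have mfg : measurable_fun setT (fun z => f z - g z) by exact: measurable_funB.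
have fgC z : `|f z - g z| <= C + C.
  by apply: le_trans (ler_normB _ _) _; exact: lerD.
rewrite (prim_sub mfg fgC xy) (prim_sub mf fC xy) (prim_sub mg gC xy).
by rewrite RintegralB //; exact: bounded_integrable_itv.
Qed.

End Primitive2.

(** * Test functions *)

Section TestFunctions.
Context {R : realType}.
Implicit Types (f g h w psi : R -> R).
Local Notation mu := (@lebesgue_measure R).

(** A change of variable moves the translation onto [w]: a summation by parts that costs the
    translation modulus of [w] and the bound of [g], whatever the regularity of [g]. *)
Lemma tvb_int_shift w g (M C z : R) : in_L1 w -> tvb w M ->
  measurable_fun setT g -> (forall x, `|g x| <= C) -> 0 <= z ->
  `|\int[mu]_x (w x * g (x + z)) - \int[mu]_x (w x * g x)| <= C * (z * M).
Proof.
move=> iw wM mg gC; rewrite le_eqVlt => /predU1P[<-|z0].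
  have C0 : 0 <= C by apply: le_trans (gC 0).
  under eq_int do rewrite addr0; rewrite subrr normr0 mul0r mulr0 //.
have igz : in_L1 (fun x => w x * g (x + z)).
  by apply: (in_L1Mr (C := C)) => //; exact: measurable_shift.
have -> : \int[mu]_x (w x * g x) = \int[mu]_x (w (x + z) * g (x + z)).
  by rewrite (@int_shift _ (fun x => w x * g x) z) //; exact: in_L1Mr gC.
have iwz := in_L1_shift z iw.
rewrite -intB //; last by apply: (in_L1Mr (C := C)) => //; exact: measurable_shift.
rewrite (eq_int (g := fun x => (w x - w (x + z)) * g (x + z))); last first.
  by move=> x; rewrite mulrBl.
apply: (@le_trans _ _ (C * n1 (fun x => w x - w (x + z)))).
  apply: ler_intMb => //; first exact: in_L1B.
  exact: measurable_shift.
rewrite ler_wpM2l //; first by apply: le_trans (gC 0).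
by rewrite -n1N; under [X in n1 X]eq_fun do rewrite opprB; exact: wM.
Qed.

(** Test functions of class C^{1,1}: this regularity gives a second-order Taylor bound and survives
    composition with a smoothed flow step. The constants are parameters because the Euler scheme has
    to follow their growth. *)
Record test_fun (L1 L2 r : R) (psi dpsi : R -> R) : Prop := TestFun {
  test_der : forall x : R, is_derive x 1 psi (dpsi x);
  test_dbound : forall x, `|dpsi x| <= L1;
  test_dlip : forall x y, `|dpsi x - dpsi y| <= L2 * `|x - y|;
  test_01 : forall x, 0 <= psi x <= 1;
  test_supp : forall x, r <= `|x| -> psi x = 0;
  test_dsupp : forall x, r <= `|x| -> dpsi x = 0 }.

Lemma lip_continuous f (L : R) : (forall x y, `|f x - f y| <= L * `|x - y|) -> continuous f.
Proof.
move=> fL x; apply/cvgrPdist_le => e e0.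
have L1 : 0 < `|L| + 1 by rewrite ltr_wpDl.
near=> y; apply: le_trans (fL x y) _.
have : `|x - y| <= e / (`|L| + 1).
  by near: y; apply: cvgr_dist_le; [exact: cvg_id|rewrite divr_gt0].
rewrite ler_pdivlMr // => H; apply: le_trans H.
by rewrite mulrC ler_wpM2l // (le_trans (ler_norm L)) // lerDl.
Unshelve. all: by end_near. Qed.

Section OneTestFunction.
Variables (L1 L2 r : R) (psi dpsi : R -> R).
Hypothesis tp : test_fun L1 L2 r psi dpsi.

Lemma test_L1_ge0 : 0 <= L1.
Proof. by apply: le_trans (test_dbound tp 0). Qed.

Lemma test_L2_ge0 : 0 <= L2.
Proof.
have := test_dlip tp 1 0; rewrite subr0 normr1 mulr1; exact: le_trans.
Qed.

Lemma test_mvt (x y : R) : exists2 c, `|c - x| <= `|y - x| & psi y - psi x = dpsi c * (y - x).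
Proof.
have cont a b : {within `[a, b], continuous psi}.
  apply: continuous_subspaceT => z; apply: differentiable_continuous.
  by apply/derivable1_diffP; case: (test_der tp z).
have [xy|/ltW yx] := leP x y.
  have [c] := MVT_segment xy (fun z _ => test_der tp z) (cont _ _).
  rewrite in_itv /= => /andP[c1 c2] ->; exists c => //.
  by rewrite !ger0_norm ?subr_ge0 // lerD2r.
have [c] := MVT_segment yx (fun z _ => test_der tp z) (cont _ _).
rewrite in_itv /= => /andP[c1 c2] E; exists c.
  by rewrite !ler0_norm ?subr_le0 // lerN2 lerD2r.
by rewrite -opprB E; ring.
Qed.

Lemma test_lip (x y : R) : `|psi x - psi y| <= L1 * `|x - y|.
Proof.
by have [c _ ->] := test_mvt y x; rewrite normrM ler_wpM2r // (test_dbound tp).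
Qed.

Lemma test_taylor (x a : R) : `|psi (x + a) - psi x - a * dpsi x| <= L2 * a ^+ 2.
Proof.
have [c] := test_mvt x (x + a); rewrite addrAC subrr add0r => ca ->.
have -> : dpsi c * a - a * dpsi x = a * (dpsi c - dpsi x) by ring.
rewrite normrM -real_normK ?num_real // expr2 mulrCA ler_wpM2l //.
by apply: le_trans (test_dlip tp _ _) _; rewrite ler_wpM2l // test_L2_ge0.
Qed.

Lemma test_continuous : continuous psi.
Proof. exact: lip_continuous test_lip. Qed.

Lemma test_dcontinuous : continuous dpsi.
Proof. exact: lip_continuous (test_dlip tp). Qed.

Lemma test_measurable : measurable_fun setT psi.
Proof. by apply: continuous_measurable_fun; exact: test_continuous. Qed.

Lemma test_dmeasurable : measurable_fun setT dpsi.
Proof. by apply: continuous_measurable_fun; exact: test_dcontinuous. Qed.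

Lemma test_norm1 (x : R) : `|psi x| <= 1.
Proof. by have /andP[p0 p1] := test_01 tp x; rewrite ger0_norm. Qed.

Lemma supp_in_L1 f (C : R) : measurable_fun setT f -> (forall x, `|f x| <= C) ->
  (forall x, r <= `|x| -> f x = 0) -> in_L1 f.
Proof.
move=> mf fC f0; have := in_L1_indic_bounded (- `|r|) `|r| mf fC.
congr in_L1; apply/funext => x; rewrite indicE.
case: (boolP (_ \in _)) => [_|]; first by rewrite mul1r.
rewrite mul0r => /negP xr; apply/esym/f0; rewrite leNgt; apply/negP => xr'.
apply: xr; apply/mem_set; rewrite /= in_itv /= -ler_norml.
by apply: le_trans (ltW xr') _; exact: ler_norm.
Qed.

Lemma test_in_L1 : in_L1 psi.
Proof. exact: supp_in_L1 test_measurable test_norm1 (test_supp tp). Qed.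

Lemma test_din_L1 : in_L1 dpsi.
Proof. exact: supp_in_L1 test_dmeasurable (test_dbound tp) (test_dsupp tp). Qed.

Lemma test_shift (z : R) :
  test_fun L1 L2 (r + `|z|) (fun x => psi (x + z)) (fun x => dpsi (x + z)).
Proof.
have far x : r + `|z| <= `|x| -> r <= `|x + z|.
  move=> h; have := ler_normB (x + z) z; rewrite addrK; lra.
split => [x|x|x y|x|x /far|x /far].
- rewrite -[dpsi _]mulr1; apply: (@is_derive1_comp _ psi (fun x => x + z)).
  + exact: (test_der tp).
  + by rewrite -[X in is_derive _ _ _ X]addr0; apply: is_deriveD.
- exact: (test_dbound tp).
- by apply: le_trans (test_dlip tp _ _) _; rewrite (_ : x + z - (y + z) = x - y) //; ring.
- exact: (test_01 tp).
- exact: (test_supp tp).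
- exact: (test_dsupp tp).
Qed.

End OneTestFunction.

End TestFunctions.

(** * Moving averages and approximation of the positive part by test functions *)

Section BoxAverage.
Context {R : realType}.
Implicit Types (f g h w psi : R -> R).
Local Notation mu := (@lebesgue_measure R).

(** Steklov average over [x, x + k]. One application makes a bounded measurable function Lipschitz,
    a second one makes it C^{1,1}; both preserve the bounds 0 and 1. *)
Definition box (k : R) h (x : R) : R := k^-1 * (prim h (x + k) - prim h x).

Section Box.
Variables (h : R -> R) (C k : R).
Hypotheses (mh : measurable_fun setT h) (hC : forall z, `|h z| <= C) (k0 : 0 < k).

Lemma box_le (b : R) : (forall z, h z <= b) -> forall x, box k h x <= b.
Proof.
move=> hb x; rewrite /box mulrC ler_pdivrMr //.
have := @prim_sub_le _ _ _ mh hC x (x + k) b.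
by rewrite lerDl (_ : x + k - x = k); [apply => //; exact: ltW|ring].
Qed.

Lemma box_ge (b : R) : (forall z, b <= h z) -> forall x, b <= box k h x.
Proof.
move=> hb x; rewrite /box mulrC ler_pdivlMr //.
have := @prim_sub_ge _ _ _ mh hC x (x + k) b.
by rewrite lerDl (_ : x + k - x = k); [apply => //; exact: ltW|ring].
Qed.

Lemma box_bound (x : R) : `|box k h x| <= C.
Proof.
rewrite ler_norml; apply/andP; split.
  by apply: box_ge => z; have := hC z; rewrite ler_norml => /andP[].
by apply: box_le => z; have := hC z; rewrite ler_norml => /andP[].
Qed.

Lemma box_lip (x y : R) : `|box k h x - box k h y| <= (k^-1 * (2 * C)) * `|x - y|.
Proof.
rewrite /box -mulrBr normrM gtr0_norm ?invr_gt0 // -mulrA ler_pM2l ?invr_gt0 //.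
have := prim_lip mh hC y x; have := prim_lip mh hC (y + k) (x + k).
rewrite (_ : x + k - (y + k) = x - y); last by ring.
have -> : prim h (x + k) - prim h x - (prim h (y + k) - prim h y) =
  (prim h (x + k) - prim h (y + k)) - (prim h x - prim h y) by ring.
by move=> h1 h2; apply: le_trans (ler_normB _ _) _; lra.
Qed.

Lemma box_continuous : continuous (box k h).
Proof. exact: lip_continuous box_lip. Qed.

Lemma box_measurable : measurable_fun setT (box k h).
Proof. by apply: continuous_measurable_fun; exact: box_continuous. Qed.

Lemma is_derive_box (x : R) : continuous h ->
  is_derive x 1 (box k h) (k^-1 * (h (x + k) - h x)).
Proof.
move=> ch; apply: is_deriveZ; apply: is_deriveB; last first.
  by apply: (is_derive_prim mh hC); exact: ch.
rewrite -[h (x + k)]mulr1.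
apply: (@is_derive1_comp _ (prim h) (fun x => x + k)).
  by apply: (is_derive_prim mh hC); exact: ch.
by rewrite -[X in is_derive _ _ _ X]addr0; apply: is_deriveD.
Qed.

Lemma box_approx (L x : R) : 0 <= L -> (forall y z, `|h y - h z| <= L * `|y - z|) ->
  `|box k h x - h x| <= L * k.
Proof.
move=> L0 hL; have ch := lip_continuous hL.
have xk : x <= x + k by rewrite lerDl ltW.
have cp : {within `[x, x + k], continuous (prim h)}.
  by apply: continuous_subspaceT => z; exact: (prim_continuous mh hC).
have [c] := MVT_segment xk (fun z _ => is_derive_prim mh hC (ch z)) cp.
rewrite in_itv /= => /andP[c1 c2] E.
have {}E : prim h (x + k) - prim h x = h c * k by rewrite E; ring.
rewrite /box E mulrC mulfK ?gt_eqF //.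
apply: le_trans (hL _ _) _; rewrite ler_wpM2l // ger0_norm ?subr_ge0 //; lra.
Qed.

Lemma box_supp (r x : R) : (forall z, r <= `|z| -> h z = 0) -> r + k <= `|x| ->
  box k h x = 0.
Proof.
move=> h0 xr; rewrite /box (prim_sub_indic mh hC x (ltW k0)).
rewrite (eq_int (g := fun _ => 0)) ?Rintegral_cst ?mul0r ?mulr0 // => z.
rewrite indicE; case: (boolP (_ \in _)) => [/set_mem|_]; last by rewrite mul0r.
rewrite /= in_itv /= => /andP[z0 zk]; rewrite h0 ?mulr0 //.
have := ler_normB (x + z) z; rewrite addrK (ger0_norm z0); lra.
Qed.

(** [h] may be discontinuous; the averaging error is charged to the translation modulus of [w]. *)
Lemma int_box w (M : R) : in_L1 w -> tvb w M ->
  `|\int[mu]_x (w x * box k h x) - \int[mu]_x (w x * h x)| <= C * (k * M).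
Proof.
move=> iw wM.
have C0 : 0 <= C by apply: le_trans (hC 0).
have M0 : 0 <= M.
  by have := wM _ ltr01; rewrite mul1r; apply: le_trans; exact: n1_ge0.
have := @int_prim_sub_approx _ _ _ mh hC w k (\int[mu]_x (w x * h x)) (C * (k * M)) iw (ltW k0).
have -> : \int[mu]_x (w x * (prim h (x + k) - prim h x)) =
    k * \int[mu]_x (w x * box k h x).
  rewrite -intZl; last exact: in_L1Mr iw box_measurable box_bound.
  by apply: eq_int => x; rewrite /box; field; rewrite gt_eqF.
rewrite -mulrBr normrM (gtr0_norm k0) ler_pM2l //; apply => z /andP[z0 zk].
apply: le_trans (tvb_int_shift iw wM mh hC z0) _.
by rewrite ler_wpM2l // ler_wpM2r.
Qed.

End Box.

Definition pospart w : R := \int[mu]_x Num.max 0 (w x).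

Lemma in_L1_max0 w : in_L1 w -> in_L1 (fun x => Num.max 0 (w x)).
Proof.
move=> iw; apply: (le_in_L1 (g := fun x => `|w x|)); last exact: in_L1_norm.
  by apply: measurable_maxr => //; exact: in_L1_measurable.
by move=> x; rewrite ger0_norm ?le_max ?lexx // ge_max normr_ge0 ler_norm.
Qed.

Lemma n1_pospart w : in_L1 w -> n1 w = pospart w + pospart (fun x => - w x).
Proof.
move=> iw; rewrite /pospart -intD; try exact: in_L1_max0.
  apply: eq_int => x; have [h|h] := leP 0 (w x).
    by rewrite ger0_norm // max_l ?addr0 // oppr_le0.
  by rewrite ltr0_norm // max_r ?add0r // oppr_ge0 ltW.
by apply: in_L1_max0; exact: in_L1N.
Qed.

Lemma int_test_le_pospart w (L1 L2 r : R) psi dpsi : in_L1 w ->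
  test_fun L1 L2 r psi dpsi -> \int[mu]_x (w x * psi x) <= pospart w.
Proof.
move=> iw tp; apply: le_int => [||x].
- exact: in_L1Mr iw (test_measurable tp) (test_norm1 tp).
- exact: in_L1_max0.
- have /andP[p0 p1] := test_01 tp x; have [h|h] := leP 0 (w x).
    apply: le_trans (_ : w x * 1 <= _); last by rewrite mulr1.
    by rewrite ler_wpM2l.
  by rewrite mulr_le0_ge0 // ltW.
Qed.

Lemma in_L1_tail w (e : R) : in_L1 w -> 0 < e ->
  exists n : nat, \int[mu]_x `|w x| - e < \int[mu]_(x in `[- (n%:R * 1), n%:R * 1[) `|w x|.
Proof.
move=> iw e0; apply: contrapT => H.
have : \int[mu]_x `|w x| <= \int[mu]_x `|w x| - e.
  apply: (@int_le_exhaust _ (fun x => `|w x|) 1) => //; first exact: in_L1_norm.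
  by move=> n; rewrite leNgt; apply/negP => h; apply: H; exists n.
by rewrite lerBrDr gerDl leNgt e0.
Qed.

(** The ideal test function is the indicator of [0 < w]. It is cut off to a large interval and
    averaged twice, and [tvb] bounds the loss in each average. *)
Lemma pospart_dense w (M e : R) : in_L1 w -> tvb w M -> 0 < e ->
  exists L1 L2 r psi dpsi, test_fun L1 L2 r psi dpsi /\
    pospart w - e <= \int[mu]_x (w x * psi x).
Proof.
move=> iw wM e0.
have e20 : 0 < e / 2 by rewrite divr_gt0.
have M0 : 0 <= M.
  by have := wM _ ltr01; rewrite mul1r; apply: le_trans; exact: n1_ge0.
have [n Hn] := in_L1_tail iw e20; rewrite mulr1 in Hn.
pose A : set R := `[- n%:R, n%:R[%classic.
have mA : measurable A by exact: measurable_itv.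
pose pos : set R := [set x | 0 < w x].
have mpos : measurable pos.
  rewrite (_ : pos = w @^-1` `]0, +oo[).
    by rewrite -[X in measurable X]setTI; apply: in_L1_measurable.
  by apply/seteqP; split => x; rewrite /pos /= in_itv /= andbT.
pose f : R -> R := \1_(A `&` pos).
have mf : measurable_fun setT f by apply: measurable_indic; exact: measurableI.
have f01 x : 0 <= f x <= 1 by rewrite /f indicE; case: (_ \in _); rewrite ?lexx ler01.
have f1 x : `|f x| <= 1 by have /andP[p0 p1] := f01 x; rewrite ger0_norm.
have f_ge z : 0 <= f z by case/andP: (f01 z).
have f_le z : f z <= 1 by case/andP: (f01 z).
(* The half-open interval [A] contains [- n], whose modulus is [n]; vanishing is therefore claimed
   only from [n + 1] on. *)
have f_supp x : n%:R <= `|x| -> f x = 0 \/ x = - n%:R.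
  rewrite /f indicE; case: (boolP (_ \in _)) => [/set_mem [+ _]|_]; last by left.
  rewrite /A /= in_itv /= => /andP[h1 h2] h3; right; apply/eqP; rewrite eq_le h1 andbT.
  by move: h3; rewrite ler_normr => /orP[|]; lra.
have f_supp1 x : n%:R + 1 <= `|x| -> f x = 0.
  move=> h; have [|//|xn] := f_supp x; first lra.
  by move: h; rewrite xn normrN ger0_norm ?ler0n //; lra.
(* Each of the two averages costs at most [k * M], together at most [e / 2]; the cut-off costs the
   other [e / 2]. *)
pose k := Num.min 1 (e / 2 / (2 * (M + 1))).
have k0 : 0 < k.
  rewrite /k lt_min ltr01 divr_gt0 // mulr_gt0 // ltr_wpDl //.
have kM : 2 * (k * M) <= e / 2.
  have : k <= e / 2 / (2 * (M + 1)) by rewrite /k ge_min lexx orbT.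
  rewrite ler_pdivlMr ?mulr_gt0 // ?ltr_wpDl // => h.
  by apply: le_trans h; rewrite mulrCA ler_pM2l // ler_pM2l // lerDl.
pose g := box k f.
have g1 := box_bound mf f1 k0; have g_ge := box_ge mf f1 k0 f_ge.
have g_le := box_le mf f1 k0 f_le.
have mg : measurable_fun setT g := box_measurable mf f1 k0.
have cg : continuous g := box_continuous mf f1 k0.
have g_lip := box_lip mf f1 k0.
have g_supp x : n%:R + 1 + k <= `|x| -> g x = 0 by exact: box_supp f_supp1.
pose psi := box k g; pose dpsi x := k^-1 * (g (x + k) - g x).
exists (k^-1 * 2), (k^-1 * (2 * (k^-1 * 2))), (n%:R + 1 + k + k), psi, dpsi; split.
  split => [x|x|x y|x|x hx|x hx].
  - exact: (is_derive_box k mg g1 x cg).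
  - rewrite normrM gtr0_norm ?invr_gt0 // ler_pM2l ?invr_gt0 //.
    apply: le_trans (ler_normB _ _) _.
    have := g1 (x + k); have := g1 x; rewrite -/g; lra.
  - rewrite -mulrBr normrM gtr0_norm ?invr_gt0 // -mulrA ler_pM2l ?invr_gt0 //.
    have := g_lip (x + k) (y + k); have := g_lip x y; rewrite -/g mulr1.
    rewrite (_ : x + k - (y + k) = x - y); last by ring.
    rewrite (_ : g (x + k) - g x - _ = g (x + k) - g (y + k) - (g x - g y)); last by ring.
    by move=> h1 h2; apply: le_trans (ler_normB _ _) _; lra.
  - by rewrite (box_ge mg g1 k0 g_ge) (box_le mg g1 k0 g_le).
  - exact: (box_supp mg g1 k0 g_supp hx).
  - have far : n%:R + 1 + k <= `|x + k|.
      have := ler_normB (x + k) k; rewrite addrK (gtr0_norm k0); lra.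
    by rewrite /dpsi (g_supp _ far) g_supp ?subrr ?mulr0 //; lra.
have h1 := int_box mf f1 k0 iw wM; have h2 := int_box mg g1 k0 iw wM.
rewrite mul1r ler_norml in h1; rewrite mul1r ler_norml in h2.
case/andP: h1 => h1 _; case/andP: h2 => h2 _.
have h3 : pospart w - e / 2 <= \int[mu]_x (w x * f x).
  have iwf : in_L1 (fun x => w x * f x) by exact: in_L1Mr iw mf f1.
  have ia : in_L1 (fun x => `|w x|) by exact: in_L1_norm.
  have iA : in_L1 (fun x => \1_A x * `|w x|) by exact: in_L1_indicM.
  have : pospart w <= \int[mu]_x (w x * f x + (`|w x| - \1_A x * `|w x|)).
    apply: le_int => [||x]; first exact: in_L1_max0.
      by apply: in_L1D => //; exact: in_L1B.
    rewrite /f !indicE in_setI.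
    have -> : (x \in pos) = (0 < w x).
      by apply/idP/idP => [/set_mem //|h]; apply/mem_set.
    have n0 := ler_norm (w x); have n0' := normr_ge0 (w x).
    have [h|h] := ltP 0 (w x); case: (x \in A) => /=; rewrite ?mulr1 ?mulr0 ?mul1r ?mul0r;
      clear - h n0 n0'; lra.
  rewrite intD //; last exact: in_L1B.
  rewrite intB // -int_indicM; clear - Hn; lra.
rewrite -/g -/psi in h1 h2 *; clear - h1 h2 h3 kM; lra.
Qed.

End BoxAverage.

(** * Averages over a mixture of intervals *)

Section KernelAverage.
Context {R : realType}.
Implicit Types (a f g h k : R -> R).
Local Notation mu := (@lebesgue_measure R).

(** The limit of [d] to 0: arguments by difference quotients work at a fixed step [d] with an error
    linear in [d], and end here. *)
Lemma ler_small (x B K : R) : (forall d, 0 < d -> d <= 1 -> x <= B + K * d) -> x <= B.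
Proof.
move=> H; apply/ler_addgt0Pr => e e0.
have K1 : 0 < `|K| + 1 by rewrite ltr_wpDl.
pose d := Num.min 1 (e / (`|K| + 1)).
have d0 : 0 < d by rewrite lt_min ltr01 divr_gt0.
have d1 : d <= 1 by rewrite ge_min lexx.
apply: le_trans (H d d0 d1) _; rewrite lerD2l.
apply: (@le_trans _ _ (`|K| * d)); first by rewrite ler_wpM2r ?ler_norm // ltW.
apply: (@le_trans _ _ ((`|K| + 1) * d)); first by rewrite ler_wpM2r ?lerDl // ltW.
by rewrite mulrC -ler_pdivlMr // ge_min lexx orbT.
Qed.

(* A nonincreasing kernel on [0, eta] is a mixture of the indicators of the
   intervals [0, s]; [alpha] is minus its derivative and [We] its value at [eta]. *)
Record mixture (eta We : R) (alpha : R -> R) : Prop := Mixture {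
  mix_eta : 0 <= eta;
  mix_We : 0 <= We;
  mix_ge0 : forall s, 0 <= alpha s;
  mix_L1 : in_L1 alpha }.

(** Clamping keeps the argument in [0, eta] for every real [s], so bounds over that interval control
    an integral over the whole line. *)
Definition clp (eta s : R) : R := Num.max 0 (Num.min s eta).

(** The integral of [k] against a measure with density [alpha], clamped to [0, eta], and an atom
    [We] at [eta]. Its total mass is [mass], which [mass_kernel] identifies with [W 0]. *)
Definition kavg (eta We : R) (alpha k : R -> R) : R :=
  We * k eta + \int[mu]_s (alpha s * k (clp eta s)).

Section Average.
Variables (eta We : R) (alpha : R -> R).
Hypothesis ma : mixture eta We alpha.

Local Notation K := (kavg eta We alpha).
Definition mass (eta We : R) (alpha : R -> R) : R := We + \int[mu]_s alpha s.
Local Notation W0 := (mass eta We alpha).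

Lemma clp_itv (s : R) : 0 <= clp eta s <= eta.
Proof.
by rewrite /clp le_max lexx /= ge_max (mix_eta ma) /= ge_min lexx orbT.
Qed.

Lemma clp_id (s : R) : 0 <= s <= eta -> clp eta s = s.
Proof. by case/andP => s0 s1; rewrite /clp min_l // max_r. Qed.

Lemma measurable_clp : measurable_fun setT (clp eta).
Proof.
by apply: measurable_maxr; [exact: measurable_cst|apply: measurable_minr => //; exact: measurable_cst].
Qed.

Lemma mass_ge0 : 0 <= W0.
Proof.
by apply: addr_ge0; [exact: (mix_We ma)|apply: Rintegral_ge0 => s _; exact: (mix_ge0 ma)].
Qed.

Lemma eq_kavg k1 k2 : (forall s, 0 <= s <= eta -> k1 s = k2 s) -> K k1 = K k2.
Proof.
move=> E; rewrite /kavg E ?(mix_eta ma) ?lexx //; congr (_ + _).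
by apply: eq_int => s; rewrite E // clp_itv.
Qed.

Lemma in_L1_mix k (B : R) : measurable_fun setT k ->
  (forall s, 0 <= s <= eta -> `|k s| <= B) -> in_L1 (fun s => alpha s * k (clp eta s)).
Proof.
move=> mk kB; apply: (in_L1Mr (C := B)) => [||s]; first exact: (mix_L1 ma).
  by apply: (measurableT_comp mk); exact: measurable_clp.
by apply: kB; exact: clp_itv.
Qed.

Lemma kavg_le k (B : R) : measurable_fun setT k ->
  (forall s, 0 <= s <= eta -> `|k s| <= B) -> `|K k| <= W0 * B.
Proof.
move=> mk kB; apply: le_trans (ler_normD _ _) _; rewrite /mass mulrDl; apply: lerD.
  by rewrite normrM ger0_norm ?(mix_We ma) // ler_wpM2l ?(mix_We ma) // kB // (mix_eta ma) lexx.
rewrite -RintegralZr //; last exact: (mix_L1 ma).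
apply: ler_int_bound => [||s].
- by apply: in_L1_measurable; exact: in_L1_mix kB.
- by apply: (in_L1Mr (C := `|B|)) => //; exact: (mix_L1 ma).
- rewrite normrM ger0_norm ?(mix_ge0 ma) // ler_wpM2l ?(mix_ge0 ma) //.
  by apply: kB; exact: clp_itv.
Qed.

Lemma kavgB k1 k2 (B : R) : measurable_fun setT k1 -> measurable_fun setT k2 ->
  (forall s, 0 <= s <= eta -> `|k1 s| <= B) -> (forall s, 0 <= s <= eta -> `|k2 s| <= B) ->
  K (fun s => k1 s - k2 s) = K k1 - K k2.
Proof.
move=> m1 m2 b1 b2; rewrite /kavg.
rewrite (eq_int (g := fun s => alpha s * k1 (clp eta s) - alpha s * k2 (clp eta s))).
  rewrite intB; [|exact: in_L1_mix b1|exact: in_L1_mix b2].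
  ring.
by move=> s; rewrite mulrBr.
Qed.

Lemma measurable_kavg (k : R * R -> R) (C : R) : measurable_fun setT k ->
  (forall p, `|k p| <= C) -> measurable_fun setT (fun x : R => K (fun s => k (x, s))).
Proof.
move=> mk kC; apply: measurable_funD.
  by apply: measurable_funM; [exact: measurable_cst|exact: measurable_fun_pair1].
apply: (@measurable_int_param _ alpha (fun p => k (p.2, clp eta p.1)) C) => //.
  exact: (mix_L1 ma).
apply: (measurableT_comp mk); apply: measurable_fun_pair => //.
by apply: (measurableT_comp measurable_clp).
Qed.

Lemma int_kavg a (k : R * R -> R) (C : R) : in_L1 a -> measurable_fun setT k ->
  (forall p, `|k p| <= C) ->
  \int[mu]_x (a x * K (fun s => k (x, s))) = K (fun s => \int[mu]_x (a x * k (x, s))).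
Proof.
move=> ia mk kC.
have mk' : measurable_fun setT (fun p : R * R => k (p.1, clp eta p.2)).
  apply: (measurableT_comp mk); apply: measurable_fun_pair => //.
  by apply: (measurableT_comp measurable_clp).
have iL1 := mix_L1 ma.
rewrite /kavg -(@fubini_swap _ a alpha (fun p => k (p.1, clp eta p.2)) C ia iL1 mk') //.
have i1 : in_L1 (fun x => a x * k (x, eta)).
  by apply: (in_L1Mr (C := C)) => //; exact: measurable_fun_pair1.
rewrite -intZl // -intD; last 2 first.
- exact: in_L1Zl.
- apply: (in_L1Mr (C := C * n1 alpha)) => //.
    apply: (@measurable_int_param _ alpha (fun p => k (p.2, clp eta p.1)) C) => //.
    apply: (measurableT_comp mk); apply: measurable_fun_pair => //.
    by apply: (measurableT_comp measurable_clp).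
  by move=> x; apply: ler_intMb => //; exact: (measurable_fun_pair2 x mk').
by apply: eq_int => x; rewrite /=; ring.
Qed.

(** Reduces an estimate for the kernel to the indicators of the windows [0, s], at the price of the
    factor [mass]. *)
Lemma int_kavg_le a (k : R * R -> R) (C B : R) : in_L1 a -> measurable_fun setT k ->
  (forall p, `|k p| <= C) ->
  (forall s, 0 <= s <= eta -> `|\int[mu]_x (a x * k (x, s))| <= B) ->
  `|\int[mu]_x (a x * K (fun s => k (x, s)))| <= W0 * B.
Proof.
move=> ia mk kC kB; rewrite (int_kavg ia mk kC); apply: kavg_le => //.
exact: (@measurable_int_param _ a k C).
Qed.

End Average.

Definition conv (eta We : R) (alpha h : R -> R) (x : R) : R :=
  kavg eta We alpha (fun s => prim h (x + s) - prim h x).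

End KernelAverage.

(** * Convolution with a mixture and its derivative *)

Section Conv.
Context {R : realType}.
Implicit Types (a f g h k : R -> R).
Local Notation mu := (@lebesgue_measure R).
Variables (eta We : R) (alpha : R -> R).
Hypothesis ma : mixture eta We alpha.
Local Notation W0 := (mass eta We alpha).
Local Notation cv := (conv eta We alpha).

Section OneFunction.
Variables (h : R -> R) (C : R).
Hypotheses (mh : measurable_fun setT h) (hC : forall z, `|h z| <= C).

Lemma C_ge0 : 0 <= C. Proof. exact: le_trans (hC 0). Qed.

Lemma measurable_prim_diff (x : R) : measurable_fun setT (fun s : R => prim h (x + s) - prim h x).
Proof.
apply: measurable_funB; last exact: measurable_cst.
apply: (measurableT_comp (prim_measurable mh hC)).
by apply: measurable_funD => //; exact: measurable_cst.
Qed.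

Lemma conv_bound (x : R) : `|cv h x| <= W0 * (C * eta).
Proof.
apply: (kavg_le ma (measurable_prim_diff x)) => s /andP[s0 s1].
apply: le_trans (prim_lip mh hC _ _) _; rewrite ler_wpM2l ?C_ge0 //.
by rewrite (_ : x + s - x = s); [rewrite ger0_norm|ring].
Qed.

Lemma conv_n1 (x : R) : in_L1 h -> `|cv h x| <= W0 * n1 h.
Proof.
move=> ih; apply: (kavg_le ma (measurable_prim_diff x)) => s _.
exact: (prim_sub_L1 mh hC).
Qed.

Lemma conv_shift (z x : R) : cv (fun u => h (u + z)) x = cv h (x + z).
Proof.
apply: (eq_kavg ma) => s /andP[s0 _].
rewrite (prim_shift mh hC) ?lerDl //; congr (prim h _ - _); ring.
Qed.

(** The almost everywhere derivative of [conv]: each window integral over [x, x + s] is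
    differentiated at its two ends. *)
Definition dconv (x : R) : R := kavg eta We alpha (fun s => h (x + clp eta s) - h x).

Lemma measurable_incr : measurable_fun setT (fun p : R * R => h (p.1 + clp eta p.2) - h p.1).
Proof.
apply: measurable_funB; last by apply: (measurableT_comp mh).
apply: (measurableT_comp mh); apply: measurable_funD => //.
by apply: (measurableT_comp (measurable_clp _)).
Qed.

Lemma incr_bound (p : R * R) : `|h (p.1 + clp eta p.2) - h p.1| <= 2 * C.
Proof.
apply: le_trans (ler_normB _ _) _.
have := hC (p.1 + clp eta p.2); have := hC p.1; lra.
Qed.

Lemma dconv_measurable : measurable_fun setT dconv.
Proof. exact: (measurable_kavg ma measurable_incr incr_bound). Qed.

Lemma dconv_bound (x : R) : `|dconv x| <= W0 * (2 * C).
Proof.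
apply: (kavg_le ma) => [|s _]; last exact: (incr_bound (x, s)).
exact: (measurable_fun_pair2 x measurable_incr).
Qed.

(** For one width [s] the increment is the integral of [h (u + s) - h u] over [x, y]; Fubini
    averages this over [s]. Being a primitive, [conv] is Lipschitz and almost everywhere
    differentiable even for a merely bounded [h]. *)
Lemma conv_sub_int (x y : R) : x <= y -> cv h y - cv h x = prim dconv y - prim dconv x.
Proof.
move=> xy; rewrite (prim_sub dconv_measurable dconv_bound xy) int_indicM.
rewrite (int_kavg ma _ measurable_incr incr_bound); last exact: in_L1_indic.
rewrite -(kavgB (B := C * eta) ma) //; try exact: measurable_prim_diff.
- apply: (eq_kavg ma) => s s0; have sE : clp eta s = s by exact: clp_id.
  rewrite /= sE; case/andP: s0 => s0 _.
  under eq_int do rewrite mulrBr.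
  have mhs := measurable_shift s mh.
  have hCs z : `|h (z + s)| <= C by [].
  rewrite intB; last 2 first.
  + exact: (in_L1_indic_bounded x y mhs hCs).
  + exact: (in_L1_indic_bounded x y mh hC).
  rewrite -!int_indicM -(prim_sub mh hC xy) -(prim_sub mhs hCs xy).
  by rewrite (prim_shift mh hC) //; ring.
- move=> s /andP[s0 s1]; apply: le_trans (prim_lip mh hC _ _) _.
  by rewrite ler_wpM2l ?C_ge0 // (_ : y + s - y = s); [rewrite ger0_norm|ring].
- move=> s /andP[s0 s1]; apply: le_trans (prim_lip mh hC _ _) _.
  by rewrite ler_wpM2l ?C_ge0 // (_ : x + s - x = s); [rewrite ger0_norm|ring].
Qed.

Lemma conv_lip (x y : R) : `|cv h x - cv h y| <= W0 * (2 * C) * `|x - y|.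
Proof.
have key u v : v <= u -> `|cv h u - cv h v| <= W0 * (2 * C) * `|u - v|.
  move=> vu; rewrite conv_sub_int //; exact: (prim_lip dconv_measurable dconv_bound).
have [yx|/ltW xy] := leP y x; first exact: key.
by rewrite -(opprB (cv h y)) normrN -(opprB y) normrN; exact: key.
Qed.

Lemma conv_continuous : continuous (cv h).
Proof. exact: lip_continuous conv_lip. Qed.

Lemma conv_measurable : measurable_fun setT (cv h).
Proof. by apply: continuous_measurable_fun; exact: conv_continuous. Qed.

Lemma ae_is_derive_conv (b : R) :
  {ae mu, forall x, b < x -> is_derive x 1 (cv h) (dconv x)}.
Proof.
have := ae_is_derive_prim dconv_measurable dconv_bound b.
apply: filterS; first exact: (ae_filter_ringOfSetsType mu).
move=> x dx bx; have {}dx := dx bx.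
apply: (@near_eq_is_derive _ _ _ (fun y => prim dconv y + (cv h b - prim dconv b))).
  near=> y; have /conv_sub_int E : b <= y by apply: ltW; near: y; exact: lt_nbhsr.
  by rewrite addrCA -E addrC subrK.
by rewrite -[dconv x]addr0; apply: is_deriveD.
Unshelve. all: by end_near. Qed.

End OneFunction.

Lemma convB f g (C x : R) : measurable_fun setT f -> measurable_fun setT g ->
  (forall z, `|f z| <= C) -> (forall z, `|g z| <= C) ->
  cv f x - cv g x = cv (fun z => f z - g z) x.
Proof.
move=> mf mg fC gC; have C0 := C_ge0 fC.
rewrite -(kavgB (B := C * eta) ma).
- apply: (eq_kavg ma) => s /andP[s0 _].
  by rewrite (prim_sub_fun mf mg fC gC) ?lerDl.
- exact: (measurable_prim_diff mf fC).
- exact: (measurable_prim_diff mg gC).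
- move=> s /andP[s0 s1]; apply: le_trans (prim_lip mf fC _ _) _.
  by rewrite ler_wpM2l // (_ : x + s - x = s); [rewrite ger0_norm|ring].
- move=> s /andP[s0 s1]; apply: le_trans (prim_lip mg gC _ _) _.
  by rewrite ler_wpM2l // (_ : x + s - x = s); [rewrite ger0_norm|ring].
Qed.

(* The total variation of rho 1_[u, v] does not exceed that of rho; the factor
   1/2 comes from the oscillation of psi being at most 1. *)
Lemma int_test_itv_le (rho : R -> R) (L1 L2 r rm M u v : R) (psi dpsi : R -> R) :
  test_fun L1 L2 r psi dpsi -> in_L1 rho -> (forall x, `|rho x| <= rm) -> tvb rho M ->
  u <= v -> `|\int[mu]_x (rho x * dpsi x * \1_(`[u, v] : set R) x)| <= M / 2.
Proof.
move=> tp irho rrm rM uv.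
have mrho := in_L1_measurable irho.
have rm0 : 0 <= rm by apply: le_trans (rrm 0).
have L10 := test_L1_ge0 tp; have L20 := test_L2_ge0 tp.
pose c (x : R) := Num.max u (Num.min x v).
(* [psi] frozen outside [u, v] and centred. As [psi] lies in [0, 1], [zeta] is bounded by 1/2, and
   its difference quotient approximates [dpsi] on [u, v] and 0 elsewhere. *)
pose zeta x := psi (c x) - 2^-1.
have mc : measurable_fun setT c.
  apply: measurable_maxr; first exact: measurable_cst.
  by apply: measurable_minr => //; exact: measurable_cst.
have mz : measurable_fun setT zeta.
  apply: measurable_funB; last exact: measurable_cst.
  by apply: (measurableT_comp (test_measurable tp)).
have z12 x : `|zeta x| <= 2^-1.
  have /andP[p0 p1] := test_01 tp (c x).
  by rewrite /zeta ler_norml; apply/andP; split; lra.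
pose J := \int[mu]_x (rho x * dpsi x * \1_(`[u, v] : set R) x).
pose K := rm * (L2 * (v - u) + 4 * L1).
apply: (@ler_small _ _ _ K) => d d0 d1.
rewrite -(ler_pM2l d0).
have mI x y : measurable_fun setT (\1_(`[x, y] : set R) : R -> R) by exact: measurable_indic.
(* Error of the increment of [zeta]: a Taylor remainder inside [u, v], and order [d] on the two
   layers of width [d] to the left of [u] and [v]. The integral of [E] is of order [d ^+ 2]. *)
pose E x : R := L2 * d ^+ 2 * \1_(`[u, v] : set R) x +
  (L1 * 2 * d) * (\1_(`[u - d, u] : set R) x + \1_(`[v - d, v] : set R) x).
have iE : in_L1 E.
  apply: in_L1D; apply: in_L1Zl; first exact: in_L1_indic.
  by apply: in_L1D; exact: in_L1_indic.
have intE : \int[mu]_x E x = L2 * d ^+ 2 * (v - u) + (L1 * 2 * d) * (d + d).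
  rewrite intD; last 2 first.
  - by apply: in_L1Zl; exact: in_L1_indic.
  - by apply: in_L1Zl; apply: in_L1D; exact: in_L1_indic.
  rewrite !intZl; try exact: in_L1_indic; last by apply: in_L1D; exact: in_L1_indic.
  rewrite intD; try exact: in_L1_indic.
  by rewrite !int_indic //; [ring|lra|lra].
have ind01 (A : set R) x : 0 <= (\1_A x : R) by rewrite indicE.
have indin x y z : x <= z -> z <= y -> (\1_(`[x, y] : set R) z : R) = 1.
  by move=> h1 h2; rewrite indicE mem_set //= in_itv /= h1 h2.
have indout x y z : z < x \/ y < z -> (\1_(`[x, y] : set R) z : R) = 0.
  move=> h; rewrite indicE memNset //= in_itv /= => /andP[h1 h2].
  by case: h; rewrite ltNge ?h1 ?h2.
have cin x : u <= x -> x <= v -> c x = x by move=> h1 h2; rewrite /c min_l // max_r.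
have cl x : x <= u -> c x = u.
  by move=> h1; rewrite /c min_l ?max_l // (le_trans h1).
have cr x : v <= x -> c x = v by move=> h1; rewrite /c min_r // max_r.
have pt x : `|zeta (x + d) - zeta x - d * (dpsi x * \1_(`[u, v] : set R) x)| <= E x.
  have zE : zeta (x + d) - zeta x = psi (c (x + d)) - psi (c x) by rewrite /zeta; ring.
  rewrite zE.
  have e1 : 0 <= L2 * d ^+ 2 * \1_(`[u, v] : set R) x.
    by rewrite mulr_ge0 // mulr_ge0 // sqr_ge0.
  have e2 : 0 <= L1 * 2 * d by rewrite mulr_ge0 ?(ltW d0) // mulr_ge0.
  have e3 : 0 <= L1 * 2 * d * \1_(`[u - d, u] : set R) x by rewrite mulr_ge0.
  have e4 : 0 <= L1 * 2 * d * \1_(`[v - d, v] : set R) x by rewrite mulr_ge0.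
  have [xv|vx] := leP x v; last first.
    rewrite !cr; [|by apply: ltW|by apply: le_trans (ltW vx) _; rewrite lerDl ltW].
    rewrite (indout u v) ?mulr0 ?subrr ?normr0; last by right.
    by rewrite /E mulrDr addr_ge0 // ?addr_ge0.
  have [ux|xu] := leP u x.
    rewrite (indin u v) // mulr1 (cin x) //.
    have [h|h] := leP (x + d) v.
      rewrite (cin (x + d)) //; last by apply: le_trans ux _; rewrite lerDl ltW.
      apply: le_trans (test_taylor tp _ _) _.
      by rewrite /E (indin u v) // mulr1 mulrDr lerDl addr_ge0.
    rewrite (cr (x + d)) ?(ltW h) //.
    have vd : \1_(`[v - d, v] : set R) x = 1 :> R.
      by apply: indin => //; clear - h; lra.
    have h1 : `|psi v - psi x| <= L1 * d.
      apply: le_trans (test_lip tp _ _) _; rewrite ler_wpM2l // ger0_norm; clear - h xv; lra.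
    have h2 : `|d * dpsi x| <= L1 * d.
      by rewrite normrM gtr0_norm // mulrC ler_wpM2r ?(ltW d0) // (test_dbound tp).
    apply: le_trans (ler_normB _ _) _; rewrite /E mulrDr vd mulr1.
    clear - h1 h2 e1 e3; lra.
  rewrite (indout u v) ?mulr0 ?subr0; last by left.
  rewrite (cl x) ?(ltW xu) //.
  have [h|h] := leP (x + d) u.
    by rewrite cl // subrr normr0 /E mulrDr addr_ge0 // ?addr_ge0.
  have ud : \1_(`[u - d, u] : set R) x = 1 :> R.
    by apply: indin; [clear - h; lra|exact: ltW].
  have cd : `|c (x + d) - u| <= d.
    have c1 : u <= c (x + d) by rewrite /c le_max lexx.
    have c2 : c (x + d) <= x + d by rewrite /c ge_max ge_min lexx (ltW h).
    rewrite ger0_norm; clear - c1 c2 xu; lra.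
  have h1 : `|psi (c (x + d)) - psi u| <= L1 * d.
    by apply: le_trans (test_lip tp _ _) _; rewrite ler_wpM2l.
  rewrite /E mulrDr ud mulr1; apply: le_trans h1 _.
  have d2 : 0 <= L1 * d by rewrite mulr_ge0 // ltW.
  clear - d2 e1 e4; lra.
have izd : in_L1 (fun x => rho x * zeta (x + d)).
  by apply: (in_L1Mr (C := 2^-1)) => //; exact: measurable_shift.
have iz : in_L1 (fun x => rho x * zeta x) by exact: in_L1Mr z12.
have mdI : measurable_fun setT (fun x : R => dpsi x * \1_(`[u, v] : set R) x).
  by apply: measurable_funM => //; exact: (test_dmeasurable tp).
have dIb x : `|dpsi x * \1_(`[u, v] : set R) x| <= L1.
  rewrite normrM -[leRHS]mulr1; apply: ler_pM => //; first exact: (test_dbound tp).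
  by rewrite indicE; case: (_ \in _); rewrite ?normr1 ?normr0 ?ler01.
have iJ : in_L1 (fun x => rho x * (dpsi x * \1_(`[u, v] : set R) x)) by exact: in_L1Mr dIb.
have JE : J = \int[mu]_x (rho x * (dpsi x * \1_(`[u, v] : set R) x)).
  by apply: eq_int => x; rewrite mulrA.
rewrite -/J; have -> : d * `|J| = `|d * J| by rewrite normrM (gtr0_norm d0).
have H1 := tvb_int_shift irho rM mz z12 (ltW d0).
have H2 : `|\int[mu]_x (rho x * zeta (x + d)) - \int[mu]_x (rho x * zeta x) - d * J| <=
    rm * \int[mu]_x E x.
  rewrite JE -(intZl d) // -intB // -intB //; try exact: in_L1Zl; try exact: in_L1B.
  rewrite -intZl //; apply: ler_int_bound => [||x].
  - by apply: in_L1_measurable; apply: in_L1B; [exact: in_L1B|exact: in_L1Zl].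
  - exact: in_L1Zl.
  - rewrite (_ : _ - _ = rho x * (zeta (x + d) - zeta x - d * (dpsi x * \1_(`[u, v] : set R) x))); last by ring.
    by rewrite normrM; apply: ler_pM.
have H3 : rm * \int[mu]_x E x = d * (K * d) by rewrite intE /K expr2; ring.
rewrite H3 in H2.
set X := _ - _ - _ in H2; set Y := _ - _ in H1.
have -> : d * J = Y - X by rewrite /X /Y; ring.
apply: le_trans (ler_normB _ _) _; rewrite mulrDr; apply: lerD => //.
by move: H1; rewrite (_ : 2^-1 * (d * M) = d * (M / 2)) //; ring.
Qed.

End Conv.

(** * Pairings with the velocity increment *)

Section ConvBounds.
Context {R : realType}.
Implicit Types (a f g h k : R -> R).
Local Notation mu := (@lebesgue_measure R).
Variables (eta We : R) (alpha : R -> R).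
Hypothesis ma : mixture eta We alpha.
Local Notation W0 := (mass eta We alpha).
Local Notation cv := (conv eta We alpha).

Section Prim2.
Variables (g : R -> R) (C : R).
Hypotheses (mg : measurable_fun setT g) (gC : forall z, `|g z| <= C).

Lemma measurable_prim2 : measurable_fun setT
  (fun p : R * R => prim g (p.1 + clp eta p.2) - prim g p.1).
Proof.
have mp := prim_measurable mg gC.
apply: measurable_funB; last by apply: (measurableT_comp mp).
apply: (measurableT_comp mp); apply: measurable_funD => //.
by apply: (measurableT_comp (measurable_clp _)).
Qed.

Lemma prim2_bound (p : R * R) : `|prim g (p.1 + clp eta p.2) - prim g p.1| <= C * eta.
Proof.
have /andP[c0 c1] := clp_itv ma p.2.
apply: le_trans (prim_lip mg gC _ _) _; rewrite ler_wpM2l ?(C_ge0 gC) //.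
by rewrite (_ : _ - _ = clp eta p.2); [rewrite ger0_norm|ring].
Qed.

Lemma conv_clp (x : R) :
  cv g x = kavg eta We alpha (fun s => prim g (x + clp eta s) - prim g x).
Proof. by apply: (eq_kavg ma) => s s0; rewrite clp_id. Qed.

End Prim2.

(** For one window [x, x + s], Fubini puts [g y] outside and leaves the integral of [rho * dpsi]
    over [y - s, y], which [int_test_itv_le] bounds by [M / 2]. *)
Lemma int_test_conv_le (rho g : R -> R) (L1 L2 r rm M C : R) (psi dpsi : R -> R) :
  test_fun L1 L2 r psi dpsi -> in_L1 rho -> (forall x, `|rho x| <= rm) -> tvb rho M ->
  in_L1 g -> (forall x, `|g x| <= C) ->
  `|\int[mu]_x (rho x * dpsi x * cv g x)| <= W0 * (M / 2 * n1 g).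
Proof.
move=> tp irho rrm rM ig gC; have mg := in_L1_measurable ig.
have ia : in_L1 (fun x => rho x * dpsi x).
  exact: in_L1Mr irho (test_dmeasurable tp) (test_dbound tp).
under eq_int do rewrite conv_clp //.
apply: (int_kavg_le ma ia (measurable_prim2 mg gC) (prim2_bound mg gC)) => s s0.
have sE : clp eta s = s by exact: clp_id.
rewrite /= sE; case/andP: s0 => s0 _.
have E x : prim g (x + s) - prim g x = \int[mu]_y (g y * \1_(`[0, s] : set R) (y - x)).
  rewrite (prim_sub mg gC) ?lerDl // int_indicM; apply: eq_int => y.
  rewrite mulrC; congr (_ * _); rewrite !indicE; congr (nat_of_bool _)%:R; apply/idP/idP.
    by rewrite !inE /= !in_itv /= => /andP[h1 h2]; apply/andP; split; lra.
  by rewrite !inE /= !in_itv /= => /andP[h1 h2]; apply/andP; split; lra.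
have mk : measurable_fun setT (fun p : R * R => \1_(`[0, s] : set R) (p.2 - p.1) : R).
  apply: (@measurableT_comp _ _ _ _ _ _ (\1_(`[0, s] : set R) : R -> R)).
    exact: measurable_indic.
  exact: measurable_funB.
have k1 (p : R * R) : `|\1_(`[0, s] : set R) (p.2 - p.1) : R| <= 1.
  by rewrite indicE; case: (_ \in _); rewrite ?normr1 ?normr0 ?ler01.
under eq_int do rewrite E.
rewrite (fubini_swap (C := 1) ia ig mk k1) /=.
apply: ler_intMb => //.
  exact: (@measurable_int_param _ _ (fun p => \1_(`[0, s] : set R) (p.2 - p.1)) 1 ia mk k1).
move=> y; rewrite (eq_int (g := fun x => rho x * dpsi x * \1_(`[y - s, y] : set R) x)).
  by apply: (int_test_itv_le tp irho rrm rM); rewrite gerDl oppr_le0.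
move=> x; congr (_ * _); rewrite !indicE; congr (nat_of_bool _)%:R; apply/idP/idP.
  by rewrite !inE /= !in_itv /= => /andP[h1 h2]; apply/andP; split; lra.
by rewrite !inE /= !in_itv /= => /andP[h1 h2]; apply/andP; split; lra.
Qed.

(** The increment of a window integral is the difference of two integrals of [g] over intervals of
    length [d], at [x + s] and at [x]. Bounding [a] uniformly and [g] in L^1 gives an estimate in
    which [C] does not occur. *)
Lemma int_conv_incr_le a g (A C d : R) : in_L1 a -> (forall x, `|a x| <= A) ->
  in_L1 g -> (forall x, `|g x| <= C) -> 0 <= d ->
  `|\int[mu]_x (a x * (cv g (x + d) - cv g x))| <= W0 * (2 * (d * (A * n1 g))).
Proof.
move=> ia aA ig gC d0; have mg := in_L1_measurable ig.
have mgd := measurable_shift d mg.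
have gCd x : `|g (x + d)| <= C by [].
have one z : `|\int[mu]_x (a x * (prim g (x + z + d) - prim g (x + z)))| <= d * (A * n1 g).
  have mgz := measurable_shift z mg.
  have gCz x : `|g (x + z)| <= C by [].
  have := @int_prim_sub_approx _ _ _ mgz gCz a d 0 (A * n1 g) ia d0.
  rewrite mulr0 subr0.
  rewrite (eq_int (g := fun x => a x * (prim g (x + z + d) - prim g (x + z)))); last first.
    move=> x; rewrite (prim_shift mg gC) ?lerDl //; congr (_ * (prim g _ - _)); ring.
  apply => u _; rewrite subr0.
  under eq_int do rewrite mulrC.
  have igu : in_L1 (fun x => g (x + u + z)).
    by have := in_L1_shift (u + z) ig; under eq_fun do rewrite addrA.
  apply: le_trans (ler_intMb igu (in_L1_measurable ia) aA) _.
  suff -> : n1 (fun x => g (x + u + z)) = n1 g by [].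
  by rewrite -(n1_shift (u + z) ig); apply: eq_int => x; rewrite addrA.
pose k (p : R * R) := (prim (fun u => g (u + d)) (p.1 + clp eta p.2) - prim (fun u => g (u + d)) p.1)
  - (prim g (p.1 + clp eta p.2) - prim g p.1).
have mk : measurable_fun setT k.
  by apply: measurable_funB; [exact: (measurable_prim2 mgd gCd)|exact: (measurable_prim2 mg gC)].
have kC p : `|k p| <= 2 * (C * eta).
  apply: le_trans (ler_normB _ _) _.
  have := prim2_bound mgd gCd p; have := prim2_bound mg gC p; lra.
rewrite (eq_int (g := fun x => a x * kavg eta We alpha (fun s => k (x, s)))); last first.
  move=> x; congr (_ * _); rewrite -(conv_shift ma mg gC d x) (convB ma x mgd mg gCd gC).
  apply: (eq_kavg ma) => s s0; rewrite /k /= clp_id //; case/andP: s0 => s0 _.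
  by rewrite (prim_sub_fun mgd mg gCd gC) ?lerDl.
apply: (int_kavg_le ma ia mk kC) => s s0.
have sE : clp eta s = s by exact: clp_id.
case/andP: s0 => s0 _.
rewrite (eq_int (g := fun x => a x * (prim g (x + s + d) - prim g (x + s))
    - a x * (prim g (x + 0 + d) - prim g (x + 0)))); last first.
  move=> x; rewrite /k /= sE (prim_shift mg gC) ?lerDl // addr0.
  by rewrite (_ : x + s + d = x + d + s); ring.
have lipb z x : `|prim g (x + z + d) - prim g (x + z)| <= C * d.
  apply: le_trans (prim_lip mg gC _ _) _; rewrite ler_wpM2l ?(C_ge0 gC) //.
  by rewrite (_ : _ - _ = d); [rewrite ger0_norm|ring].
have mz z : measurable_fun setT (fun x : R => prim g (x + z + d) - prim g (x + z)).
  have mp := prim_measurable mg gC.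
  apply: measurable_funB; last exact: measurable_shift.
  under eq_fun do rewrite -addrA.
  exact: measurable_shift.
rewrite intB; last 2 first.
- exact: in_L1Mr ia (mz s) (lipb s).
- exact: in_L1Mr ia (mz 0) (lipb 0).
apply: le_trans (ler_normB _ _) _.
by rewrite [2 * _]mulr_natl mulr2n; apply: lerD; exact: one.
Qed.

Opaque conv dconv.

(** Meant for a translate of the solution, where [g] is a flux increment. There [int_test_conv_le]
    would give [M] times [n1 g], quadratic in the variation. Here [M] multiplies only the sup bound
    [A], and [n1 g] only [rm]. The idea is the product rule: [dpsi * cv g] is the derivative of
    [cv g * psi] minus [psi] times the derivative of [cv g], in terms of differences of step [d]. *)
Lemma int_test_conv_le_sup (rho g : R -> R) (L1 L2 r rm M C A : R) (psi dpsi : R -> R) :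
  test_fun L1 L2 r psi dpsi -> in_L1 rho -> (forall x, `|rho x| <= rm) -> tvb rho M ->
  in_L1 g -> (forall x, `|g x| <= C) -> (forall x, `|cv g x| <= A) ->
  `|\int[mu]_x (rho x * dpsi x * cv g x)| <= A * M + W0 * (2 * (rm * n1 g)).
Proof.
move=> tp irho rrm rM ig gC gA; have mg := in_L1_measurable ig.
have L10 := test_L1_ge0 tp; have L20 := test_L2_ge0 tp.
have A0 : 0 <= A by apply: le_trans (gA 0).
pose LD := W0 * (2 * C).
have LDl x y := conv_lip ma mg gC x y.
have mcg := conv_measurable ma mg gC.
have mpsi := test_measurable tp; have psi1 := test_norm1 tp.
pose J := \int[mu]_x (rho x * dpsi x * cv g x).
apply: (@ler_small _ _ _ (n1 rho * (LD * L1 + A * L2))) => d d0 d1.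
rewrite -(ler_pM2l d0) -/J.
have -> : d * `|J| = `|d * J| by rewrite normrM (gtr0_norm d0).
pose G x := cv g x * psi x.
have mG : measurable_fun setT G by exact: measurable_funM.
have GA x : `|G x| <= A by rewrite normrM -[leRHS]mulr1; apply: ler_pM.
have H1 := tvb_int_shift irho rM mG GA (ltW d0).
have irp : in_L1 (fun x => rho x * psi x) by exact: in_L1Mr psi1.
have rpr x : `|rho x * psi x| <= rm by rewrite normrM -[leRHS]mulr1; apply: ler_pM.
have H2 := int_conv_incr_le irp rpr ig gC (ltW d0).
have n1rp : 0 <= n1 g := n1_ge0 g.
have LD0 : 0 <= LD by rewrite !mulr_ge0 ?(mass_ge0 ma) // (le_trans _ (gC 0)).
(* Remainder in the discrete product rule for [G], of order [d ^+ 2]. *)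
pose Y x := rho x * (cv g (x + d) * (psi (x + d) - psi x) - d * (dpsi x * cv g x)).
have Yb x : `|Y x| <= `|rho x| * ((LD * L1 + A * L2) * d ^+ 2).
  rewrite /Y normrM ler_wpM2l //.
  have -> : cv g (x + d) * (psi (x + d) - psi x) - d * (dpsi x * cv g x) =
    cv g (x + d) * (psi (x + d) - psi x - d * dpsi x) +
    d * dpsi x * (cv g (x + d) - cv g x).
    by move: (cv g (x + d)) (cv g x) => u v; ring.
  apply: le_trans (ler_normD _ _) _.
  rewrite [X in _ <= X](_ : _ = A * (L2 * d ^+ 2) + LD * L1 * d ^+ 2); last by ring.
  apply: lerD; first by rewrite normrM; apply: ler_pM => //; exact: (test_taylor tp).
  rewrite !normrM (gtr0_norm d0).
  have h1 : `|cv g (x + d) - cv g x| <= LD * d.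
    by apply: le_trans (LDl _ _) _; rewrite (_ : x + d - x = d); [rewrite gtr0_norm|ring].
  have -> : LD * L1 * d ^+ 2 = d * L1 * (LD * d) by rewrite expr2; ring.
  apply: ler_pM => //; first by rewrite mulr_ge0 // ltW.
  by rewrite ler_wpM2l ?(ltW d0) // (test_dbound tp).
have mshift f : measurable_fun setT f -> measurable_fun setT (fun x : R => f (x + d)).
  by move=> mf; exact: measurable_shift.
have mY : measurable_fun setT Y.
  apply: measurable_funM; first exact: in_L1_measurable.
  apply: measurable_funB.
    by apply: measurable_funM; [exact: mshift|apply: measurable_funB => //; exact: mshift].
  apply: measurable_funM; first exact: measurable_cst.
  by apply: measurable_funM => //; exact: (test_dmeasurable tp).
have iB : in_L1 (fun x => `|rho x| * ((LD * L1 + A * L2) * d ^+ 2)).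
  apply: (in_L1Mr (C := `|(LD * L1 + A * L2) * d ^+ 2|)) => //; first exact: in_L1_norm.
have H3 : `|\int[mu]_x Y x| <= n1 rho * ((LD * L1 + A * L2) * d ^+ 2).
  rewrite -RintegralZr //; last exact: in_L1_norm.
  exact: ler_int_bound mY iB Yb.
have iY : in_L1 Y by exact: le_in_L1 mY Yb iB.
have iJ : in_L1 (fun x => rho x * dpsi x * cv g x).
  by apply: (in_L1Mr (C := A)) => //; exact: in_L1Mr (test_dmeasurable tp) (test_dbound tp).
have iG : in_L1 (fun x => rho x * G x) by exact: in_L1Mr GA.
have iGd : in_L1 (fun x => rho x * G (x + d)).
  by apply: (in_L1Mr (C := A)) => //; exact: mshift.
have iI : in_L1 (fun x => rho x * psi x * (cv g (x + d) - cv g x)).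
  apply: (in_L1Mr (C := A + A) irp (measurable_funB (mshift _ mcg) mcg)).
  by move=> x; apply: le_trans (ler_normB _ _) _; exact: lerD.
have dJ : d * J = \int[mu]_x (rho x * G (x + d)) - \int[mu]_x (rho x * G x)
    - \int[mu]_x (rho x * psi x * (cv g (x + d) - cv g x)) - \int[mu]_x Y x.
  rewrite -(intZl d) // -(intB iGd iG) -(intB (in_L1B iGd iG) iI).
  rewrite -(intB (in_L1B (in_L1B iGd iG) iI) iY).
  apply: eq_int => x; rewrite /Y /G.
  by move: (cv g (x + d)) (cv g x) => u v; ring.
have -> : d * (A * M + W0 * (2 * (rm * n1 g)) + n1 rho * (LD * L1 + A * L2) * d) =
    A * (d * M) + W0 * (2 * (d * (rm * n1 g))) + n1 rho * ((LD * L1 + A * L2) * d ^+ 2).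
  by rewrite expr2; ring.
rewrite dJ; apply: le_trans (ler_normB _ _) _; apply: lerD H3.
by apply: le_trans (ler_normB _ _) _; exact: lerD H1 H2.
Qed.

Lemma test_cutoff (L1 L2 r : R) (psi dpsi : R -> R) : test_fun L1 L2 r psi dpsi ->
  exists I : R -> R, [/\ in_L1 I, forall x, 0 <= I x, \int[mu]_x I x = 2 * `|r| &
    forall x, I x = 1 \/ psi x = 0 /\ dpsi x = 0].
Proof.
move=> tp; exists (\1_(`[- `|r|, `|r|])); split.
- exact: in_L1_indic.
- by move=> x; rewrite indicE.
- by rewrite int_indic; [ring|rewrite ge0_cp].
- move=> x; rewrite indicE; case: (boolP (_ \in _)) => [_|/negP xr]; [by left|right].
  have far : r <= `|x|.
    rewrite leNgt; apply/negP => xr'; apply: xr; apply/mem_set.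
    by rewrite /= in_itv /= -ler_norml; apply: le_trans (ltW xr') _; exact: ler_norm.
  by rewrite (test_supp tp far) (test_dsupp tp far).
Qed.

Lemma tvb_test (L1 L2 r : R) (psi dpsi : R -> R) : test_fun L1 L2 r psi dpsi ->
  tvb psi (L1 * (4 * `|r|)).
Proof.
move=> tp z z0; have [I [iI I0 intI I1]] := test_cutoff tp.
have ipsi := test_in_L1 tp; have L10 := test_L1_ge0 tp.
have iIz := in_L1_shift z iI.
have -> : z * (L1 * (4 * `|r|)) = \int[mu]_x (L1 * z * (I x + I (x + z))).
  rewrite intZl; last exact: in_L1D.
  by rewrite intD // int_shift // intI; ring.
apply: le_n1 => [||x]; first by apply: in_L1B => //; exact: in_L1_shift.
  by apply: in_L1Zl; exact: in_L1D.
have Lz : 0 <= L1 * z by rewrite mulr_ge0 // ltW.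
have gen : `|psi (x + z) - psi x| <= L1 * z.
  by apply: le_trans (test_lip tp _ _) _; rewrite (_ : x + z - x = z); [rewrite gtr0_norm|ring].
have [E|[p0 _]] := I1 x.
  by apply: le_trans gen _; rewrite E mulrDr mulr1 lerDl mulr_ge0.
have [E|[q0 _]] := I1 (x + z).
  by apply: le_trans gen _; rewrite E mulrDr mulr1 lerDr mulr_ge0.
by rewrite p0 q0 subrr normr0 mulr_ge0 // addr_ge0.
Qed.

(** The integral [S] of [psi x * (V (x + d) - V x)] is close to [d] times the left side because [V]
    is a primitive of [q], and, after a translation, to minus [d] times the integral of [dpsi * V].
    This handles the x-derivative of the flux in the entropy inequality. *)
Lemma int_test_dconv (h : R -> R) (L1 L2 r C : R) (psi dpsi : R -> R) :
  test_fun L1 L2 r psi dpsi -> measurable_fun setT h -> (forall x, `|h x| <= C) ->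
  \int[mu]_x (psi x * dconv eta We alpha h x) = - \int[mu]_x (dpsi x * cv h x).
Proof.
move=> tp mh hC; have [I [iI I0 intI I1]] := test_cutoff tp.
have L10 := test_L1_ge0 tp; have L20 := test_L2_ge0 tp.
have mq := dconv_measurable ma mh hC; have qb := dconv_bound ma mh hC.
have mV := conv_measurable ma mh hC; have Vb := conv_bound ma mh hC.
have Vq x y (xy : x <= y) := conv_sub_int ma mh hC xy.
move: (dconv eta We alpha h) (cv h) mq qb mV Vb Vq => q V mq qb mV Vb Vq.
set Q := W0 * (2 * C) in qb; set B := W0 * (C * eta) in Vb.
have B0 : 0 <= B by apply: le_trans (Vb 0).
have ipsi := test_in_L1 tp; have idpsi := test_din_L1 tp.
have tpsi := tvb_test tp; set T := L1 * _ in tpsi.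
apply/eqP; rewrite -subr_eq0 opprK -normr_le0; apply: (@ler_small _ _ _ (Q * T + B * (L2 * (4 * `|r|)))) => d d0 d1.
have d0' := ltW d0; rewrite add0r -(ler_pM2l d0).
set J := \int[mu]_x _; set J' := \int[mu]_x _.
pose S := \int[mu]_x (psi x * (V (x + d) - V x)).
have H1 : `|S - d * J| <= d * (Q * (d * T)).
  rewrite /S (eq_int (g := fun x => psi x * (prim q (x + d) - prim q x))); last first.
    by move=> x; rewrite Vq ?lerDl.
  apply: (int_prim_sub_approx mq qb ipsi d0') => z /andP[z0 zd].
  apply: le_trans (tvb_int_shift ipsi tpsi mq qb z0) _.
  have Q0 : 0 <= Q by apply: le_trans (qb 0).
  rewrite ler_wpM2l // ler_wpM2r // /T mulr_ge0 // mulr_ge0 //.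
have iIm := in_L1_shift (- d) iI.
have ipm := in_L1_shift (- d) ipsi.
have ipV : in_L1 (fun x => psi x * V x) by exact: in_L1Mr Vb.
have ipVd : in_L1 (fun x => psi x * V (x + d)).
  by apply: (in_L1Mr (C := B)) => //; exact: measurable_shift.
have ipmV : in_L1 (fun x => psi (x - d) * V x) by exact: in_L1Mr Vb.
have idV : in_L1 (fun x => d * (dpsi x * V x)) by apply: in_L1Zl; exact: in_L1Mr Vb.
have SE : S = \int[mu]_x (psi (x - d) * V x) - \int[mu]_x (psi x * V x).
  have ipmVd : in_L1 (fun x => psi (x + d - d) * V (x + d)).
    by rewrite (_ : (fun x => _) = (fun x => psi x * V (x + d))) //; apply/funext => x; rewrite addrK.
  rewrite -(int_shift d ipmV) -(intB ipmVd ipV).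
  by apply: eq_int => x; rewrite addrK mulrBr.
have H2 : `|S + d * J'| <= d * (B * (L2 * (4 * `|r|)) * d).
  have -> : d * (B * (L2 * (4 * `|r|)) * d) =
      \int[mu]_x (L2 * d ^+ 2 * B * (I x + I (x - d))).
    rewrite intZl; last exact: in_L1D.
    by rewrite intD // int_shift // intI expr2; ring.
  have -> : S + d * J' = \int[mu]_x ((psi (x - d) - psi x + d * dpsi x) * V x).
    rewrite SE /J' -(intZl d); last exact: in_L1Mr Vb.
    rewrite -(intB ipmV ipV) -(intD (in_L1B ipmV ipV) idV).
    by apply: eq_int => x; ring.
  apply: ler_int_bound => [||x].
  - apply: measurable_funM => //; apply: in_L1_measurable; apply: in_L1D; first exact: in_L1B.
    exact: in_L1Zl.
  - by apply: in_L1Zl; exact: in_L1D.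
  have LB : 0 <= L2 * d ^+ 2 * B by apply: mulr_ge0 => //; apply: mulr_ge0 => //; exact: sqr_ge0.
  have gen : `|(psi (x - d) - psi x + d * dpsi x) * V x| <= L2 * d ^+ 2 * B.
    rewrite normrM; apply: ler_pM => //.
    by have := test_taylor tp x (- d); rewrite sqrrN mulNr opprK.
  have [E|[p0 dp0]] := I1 x.
    by apply: le_trans gen _; rewrite E mulrDr mulr1 lerDl mulr_ge0.
  have [E|[q0 _]] := I1 (x - d).
    by apply: le_trans gen _; rewrite E mulrDr mulr1 lerDr mulr_ge0.
  by rewrite p0 q0 dp0 subrr mulr0 addr0 mul0r normr0 mulr_ge0 // addr_ge0.
have -> : d * `|J + J'| = `|(S + d * J') - (S - d * J)|.
  by rewrite -[in LHS](gtr0_norm d0) -normrM; congr (`|_|); ring.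
apply: le_trans (ler_normB _ _) _.
have -> : d * ((Q * T + B * (L2 * (4 * `|r|))) * d) =
  d * (B * (L2 * (4 * `|r|)) * d) + d * (Q * (d * T)) by ring.
exact: lerD H2 H1.
Qed.

End ConvBounds.

(** * Duality with the transport equation *)

Section Duality.
Context {R : realType}.
Local Notation mu := (@lebesgue_measure R).

Lemma small_mul (c e : R) : 0 <= c -> 0 < e ->
  exists2 x, 0 < x & forall y, 0 <= y <= x -> c * y <= e.
Proof.
move=> c0 e0; have c1 : 0 < c + 1 by rewrite ltr_wpDl.
exists (e / (c + 1)); first by rewrite divr_gt0.
move=> y /andP[y0]; rewrite ler_pdivlMr // => h; apply: le_trans h.
by rewrite mulrC ler_wpM2l // lerDl.
Qed.

(* Transport of a test function along one Euler step of size [h] for the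
   velocity [u], smoothed at scale [k] to remain of class C^{1,1}. *)
Lemma test_euler (L1 L2 r B L h k : R) (psi dpsi u : R -> R) :
  test_fun L1 L2 r psi dpsi -> 0 <= h -> 0 < k -> 0 <= L ->
  (forall x, `|u x| <= B) -> (forall x y, `|u x - u y| <= L * `|x - y|) ->
  test_fun (L1 * (1 + h * L)) (L2 * (1 + h * L) ^+ 2 + L1 * (h * (k^-1 * (2 * L))))
    (r + h * B) (fun x => psi (x + h * box k u x))
    (fun x => dpsi (x + h * box k u x) * (1 + h * (k^-1 * (u (x + k) - u x)))).
Proof.
move=> tp h0 k0 L0 uB uL.
have L10 := test_L1_ge0 tp; have L20 := test_L2_ge0 tp.
have cu := lip_continuous uL; have mu_ := continuous_measurable_fun cu.
have bB := box_bound mu_ uB k0.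
have dbx x := is_derive_box k mu_ uB x cu.
pose db x := k^-1 * (u (x + k) - u x).
have dbL x : `|db x| <= L.
  rewrite /db normrM gtr0_norm ?invr_gt0 // mulrC ler_pdivrMr //.
  by apply: le_trans (uL _ _) _; rewrite (_ : x + k - x = k); [rewrite gtr0_norm|ring].
have step_lip x y : `|x + h * box k u x - (y + h * box k u y)| <= (1 + h * L) * `|x - y|.
  have key v z : v <= z -> `|box k u z - box k u v| <= L * `|z - v|.
    move=> vz; have cb : {within `[v, z], continuous (box k u)}.
      by apply: continuous_subspaceT; exact: (box_continuous mu_ uB k0).
    by have [c _ ->] := MVT_segment vz (fun z _ => dbx z) cb; rewrite normrM ler_wpM2r // dbL.
  have bl : `|box k u x - box k u y| <= L * `|x - y|.
    have [xy|/ltW yx] := leP x y; last exact: key.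
    by rewrite -(opprB (box k u y)) normrN -(opprB y) normrN; exact: key.
  rewrite (_ : _ - _ = (x - y) + h * (box k u x - box k u y)); last by ring.
  apply: le_trans (ler_normD _ _) _; rewrite mulrDl mul1r lerD2l normrM ger0_norm //.
  by rewrite -mulrA ler_wpM2l.
have fac x : `|1 + h * db x| <= 1 + h * L.
  apply: le_trans (ler_normD _ _) _; rewrite normr1 lerD2l normrM ger0_norm //.
  by rewrite ler_wpM2l.
have hL1 : 0 <= 1 + h * L by rewrite addr_ge0 // mulr_ge0.
have far x : r + h * B <= `|x| -> r <= `|x + h * box k u x|.
  move=> hx; have := ler_normB (x + h * box k u x) (h * box k u x); rewrite addrK.
  have : `|h * box k u x| <= h * B by rewrite normrM ger0_norm // ler_wpM2l.
  by clear - hx; lra.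
split => [x|x|x y|x|x hx|x hx].
- by apply: (@is_derive1_comp _ psi (fun x => x + h * box k u x)); exact: (test_der tp).
- by rewrite normrM; apply: ler_pM => //; [exact: (test_dbound tp)|exact: fac].
- set X := x + _; set Y := y + _.
  rewrite (_ : _ - _ = (dpsi X - dpsi Y) * (1 + h * db x) + dpsi Y * (h * (db x - db y)));
    last by rewrite /db; ring.
  apply: le_trans (ler_normD _ _) _; rewrite [leRHS]mulrDl; apply: lerD.
    rewrite normrM expr2.
    have -> : L2 * ((1 + h * L) * (1 + h * L)) * `|x - y| =
      L2 * ((1 + h * L) * `|x - y|) * (1 + h * L) by ring.
    apply: ler_pM => //; apply: le_trans (test_dlip tp _ _) _.
    by rewrite ler_wpM2l // step_lip.
  rewrite normrM -mulrA; apply: ler_pM => //; first exact: (test_dbound tp).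
  rewrite normrM (ger0_norm h0) -mulrA ler_wpM2l //.
  rewrite /db -mulrBr normrM gtr0_norm ?invr_gt0 // -mulrA ler_pM2l ?invr_gt0 //.
  have := uL (x + k) (y + k); have := uL x y.
  rewrite (_ : x + k - (y + k) = x - y); last by ring.
  rewrite (_ : u (x + k) - u x - _ = u (x + k) - u (y + k) - (u x - u y)); last by ring.
  by move=> h1 h2; apply: le_trans (ler_normB _ _) _; clear - h1 h2; lra.
- exact: (test_01 tp).
- by apply: (test_supp tp); exact: far.
- by rewrite (test_dsupp tp) ?mul0r //; exact: far.
Qed.

(** Abstract setting: [der] says that [w] solves the continuity equation with velocity [U] up to a
    source whose pairing with a test function is at most [beta]. [B], [L], [Nw] and the moduli of
    [unif] govern the discretization error and disappear in the limit. *)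
Variables (w U : R -> R -> R) (s t B L Nw beta : R).
Hypotheses (st : s < t) (L0 : 0 <= L).
Hypothesis iw : forall q, s <= q <= t -> in_L1 (w q).
Hypothesis wN : forall q, s <= q <= t -> n1 (w q) <= Nw.
Hypothesis UB : forall q x, s <= q <= t -> `|U q x| <= B.
Hypothesis UL : forall q x y, s <= q <= t -> `|U q x - U q y| <= L * `|x - y|.
Hypothesis unif : forall e, 0 < e -> exists2 d, 0 < d &
  forall p q, s <= p <= t -> s <= q <= t -> `|p - q| <= d ->
    n1 (fun x => w p x - w q x) <= e /\ forall x, `|U p x - U q x| <= e.
Hypothesis der : forall L1 L2 r psi dpsi, test_fun L1 L2 r psi dpsi ->
  forall q, s < q < t -> exists2 l : R,
    is_derive q (1 : R) (fun q => \int[mu]_x (w q x * psi x)) l &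
    l <= \int[mu]_x (w q x * U q x * dpsi x) + beta.

Let mU q : s <= q <= t -> measurable_fun setT (U q).
Proof.
move=> hq; apply: continuous_measurable_fun.
by apply: (@lip_continuous _ _ L) => x y; exact: UL.
Qed.

Let B0 : 0 <= B.
Proof. by apply: le_trans (UB 0 (q := s) _) => //; rewrite lexx ltW. Qed.

Let Nw0 : 0 <= Nw.
Proof. by apply: le_trans (wN (q := s) _); [exact: n1_ge0|rewrite lexx ltW]. Qed.

(** One Euler step back from [t1]. The mean value theorem in time gives a pairing at an intermediate
    time; [e] pays for replacing it by the state at [t1 - h], [k] for smoothing the velocity, and
    the last term for the Taylor expansion of [psi] along the step. [M1] and [M2] are uniform over
    all steps. *)
Lemma duality_step (L1 L2 r M1 M2 k h e t1 : R) (psi dpsi : R -> R) :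
  test_fun L1 L2 r psi dpsi -> L1 <= M1 -> L2 <= M2 ->
  0 < k -> 0 < h -> s <= t1 - h -> t1 <= t ->
  (forall q, t1 - h <= q <= t1 -> n1 (fun x => w q x - w (t1 - h) x) <= e /\
    forall x, `|U q x - U (t1 - h) x| <= e) ->
  \int[mu]_x (w t1 x * psi x) <=
    \int[mu]_x (w (t1 - h) x * psi (x + h * box k (U (t1 - h)) x)) +
    h * (beta + ((M1 * (B + Nw)) * e + (Nw * L * M1) * k + (Nw * B ^+ 2 * M2) * h)).
Proof.
move=> tp L1M L2M k0 h0 st1 t1t close.
set t0 := t1 - h in st1 close *.
have t01 : t0 < t1 by rewrite /t0 ltrBlDr ltrDl.
have in0 : s <= t0 <= t by rewrite st1 /= (le_trans (ltW t01)).
have in1 : s <= t1 <= t by rewrite t1t andbT (le_trans st1) ?ltW.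
have inq q : t0 <= q <= t1 -> s <= q <= t.
  by case/andP => q0 q1; rewrite (le_trans st1 q0) (le_trans q1 t1t).
have e0 : 0 <= e.
  by have [+ _] := close t0 (introT andP (conj (lexx _) (ltW t01))); apply: le_trans; exact: n1_ge0.
have L10 := test_L1_ge0 tp; have L20 := test_L2_ge0 tp.
have mpsi := test_measurable tp; have mdpsi := test_dmeasurable tp.
have psi1 := test_norm1 tp; have dpsib := test_dbound tp.
have iwp q : t0 <= q <= t1 -> in_L1 (fun x => w q x * psi x).
  by move=> hq; apply: in_L1Mr (iw (inq _ hq)) mpsi psi1.
pose F q := \int[mu]_x (w q x * psi x).
have FL p q : t0 <= p <= t1 -> t0 <= q <= t1 -> `|F p - F q| <= n1 (fun x => w p x - w q x).
  move=> hp hq; rewrite /F -intB; [|exact: iwp|exact: iwp].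
  rewrite (eq_int (g := fun x => (w p x - w q x) * psi x)); last by move=> x; rewrite mulrBl.
  rewrite -[leRHS]mul1r; apply: ler_intMb => //.
  by apply: in_L1B; apply: iw; exact: inq.
have cF : {within `[t0, t1], continuous F}.
  apply/subspace_continuousP => p /=; rewrite in_itv /= => hp.
  apply/cvgrPdist_le => e' e'0; have [d d0 Hd] := unif e'0.
  near=> q; have hq : t0 <= q <= t1.
    suff : q \in `[t0, t1] by rewrite in_itv.
    by near: q; apply: withinT.
  apply: le_trans (FL _ _ hp hq) _.
  apply: (Hd p q (inq _ hp) (inq _ hq) _).1.
  near: q; rewrite near_withinE; near=> z => _.
  by near: z; apply: cvgr_dist_le => //; exact: cvg_id.
have dF q : q \in `]t0, t1[ -> is_derive q 1 F (derive1 F q).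
  rewrite in_itv /= => /andP[q0 q1].
  have [|l dl _] := der tp (q := q).
    by rewrite (le_lt_trans st1 q0) (lt_le_trans q1 t1t).
  by apply: DeriveDef; [exact: ex_derive|rewrite derive1E].
have [c cI Fc] := MVT t01 dF cF.
move: (cI); rewrite in_itv /= => /andP[c0 c1].
have hc : t0 <= c <= t1 by rewrite !ltW.
have [|l dl lle] := der tp (q := c).
  by rewrite (le_lt_trans st1 c0) (lt_le_trans c1 t1t).
have lE : derive1 F c = l by rewrite derive1E; exact: derive_val.
rewrite lE (_ : t1 - t0 = h) in Fc; last by rewrite /t0; ring.
have [cw cU] := close c hc.
set u := U t0; pose uk := box k u.
have uB x : `|u x| <= B by exact: UB.
have uL x y : `|u x - u y| <= L * `|x - y| by exact: UL.
have mu0 : measurable_fun setT u by exact: mU.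
have ukB x : `|uk x| <= B by exact: box_bound.
have muk : measurable_fun setT uk by exact: (box_measurable mu0 uB).
have uku x : `|uk x - u x| <= L * k by exact: box_approx.
have iw0 := iw in0; have iwc := iw (inq _ hc).
have mUc : measurable_fun setT (U c) by apply: mU; exact: inq.
have UcB x : `|U c x| <= B by apply: UB; exact: inq.
have iwd q : t0 <= q <= t1 -> in_L1 (fun x => w q x * dpsi x).
  by move=> hq; apply: in_L1Mr (iw (inq _ hq)) mdpsi dpsib.
have hB x : `|h * uk x| <= h * B by rewrite normrM gtr0_norm // ler_pM2l.
have S1 : \int[mu]_x (w c x * U c x * dpsi x) <=
    \int[mu]_x (w t0 x * (uk x * dpsi x)) + ((M1 * (B + Nw)) * e + (Nw * L * M1) * k).
  have i1 : in_L1 (fun x => w c x * U c x * dpsi x).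
    by apply: (in_L1Mr (C := L1)) => //; exact: in_L1Mr UcB.
  have mud : measurable_fun setT (fun x : R => uk x * dpsi x) by exact: measurable_funM.
  have udb x : `|uk x * dpsi x| <= B * L1 by rewrite normrM; apply: ler_pM.
  have i2 : in_L1 (fun x => w t0 x * (uk x * dpsi x)) by exact: in_L1Mr udb.
  rewrite -lerBlDl -intB //; apply: le_trans (ler_norm _) _.
  pose G x := `|w c x - w t0 x| * (B * M1) + `|w t0 x| * (M1 * (e + L * k)).
  have iG : in_L1 G.
    apply: in_L1D; [apply: (in_L1Mr (C := `|B * M1|))|apply: (in_L1Mr (C := `|M1 * (e + L * k)|))] => //.
      by apply: in_L1_norm; exact: in_L1B.
    exact: in_L1_norm.
  apply: (@le_trans _ _ (\int[mu]_x G x)).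
    apply: ler_int_bound => [||x] //; first by apply: in_L1_measurable; exact: in_L1B.
    rewrite (_ : _ - _ = (w c x - w t0 x) * (U c x * dpsi x) +
      w t0 x * (dpsi x * ((U c x - u x) - (uk x - u x)))); last by ring.
    apply: le_trans (ler_normD _ _) _; apply: lerD; rewrite normrM ler_wpM2l //.
      rewrite normrM; apply: ler_pM => //; exact: le_trans (dpsib x) L1M.
    rewrite normrM; apply: ler_pM => //; first exact: le_trans (dpsib x) L1M.
    by apply: le_trans (ler_normB _ _) _; apply: lerD; [exact: cU|exact: uku].
  rewrite intD; last 2 first.
  - apply: (in_L1Mr (C := `|B * M1|)) => //; by apply: in_L1_norm; exact: in_L1B.
  - apply: (in_L1Mr (C := `|M1 * (e + L * k)|)) => //; exact: in_L1_norm.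
  rewrite !RintegralZr //; try exact: in_L1_norm; last by apply: in_L1_norm; exact: in_L1B.
  have M10 : 0 <= M1 by exact: le_trans L1M.
  have -> : M1 * (B + Nw) * e + Nw * L * M1 * k = e * (B * M1) + Nw * (M1 * (e + L * k)) by ring.
  apply: lerD; apply: ler_wpM2r => //; try exact: wN.
    by rewrite mulr_ge0.
  by rewrite mulr_ge0 // addr_ge0 // mulr_ge0 // ltW.
(* second-order Taylor expansion of the Euler step *)
have S2 : \int[mu]_x (w t0 x * psi x) + h * \int[mu]_x (w t0 x * (uk x * dpsi x)) <=
    \int[mu]_x (w t0 x * psi (x + h * uk x)) + h * (Nw * B ^+ 2 * M2 * h).
  have i1 : in_L1 (fun x => w t0 x * psi x) by apply: iwp; rewrite lexx ltW.
  have mud : measurable_fun setT (fun x : R => uk x * dpsi x) by exact: measurable_funM.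
  have udb x : `|uk x * dpsi x| <= B * L1 by rewrite normrM; apply: ler_pM.
  have i2 : in_L1 (fun x => h * (w t0 x * (uk x * dpsi x))).
    by apply: in_L1Zl; exact: in_L1Mr udb.
  have ms : measurable_fun setT (fun x : R => psi (x + h * uk x)).
    apply: (measurableT_comp mpsi); apply: measurable_funD => //.
    by apply: measurable_funM => //; exact: measurable_cst.
  have i3 : in_L1 (fun x => w t0 x * psi (x + h * uk x)) by exact: in_L1Mr iw0 ms _.
  rewrite -intZl; last exact: in_L1Mr udb.
  rewrite -intD // -lerBlDl -intB //; last exact: in_L1D.
  apply: le_trans (ler_norm _) _.
  have -> : h * (Nw * B ^+ 2 * M2 * h) = Nw * (M2 * (h * B) ^+ 2) by rewrite !expr2; ring.
  have M20 : 0 <= M2 by exact: le_trans L2M.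
  have c20 : 0 <= M2 * (h * B) ^+ 2 by rewrite mulr_ge0 // sqr_ge0.
  apply: (@le_trans _ _ (n1 (w t0) * (M2 * (h * B) ^+ 2))); last first.
    by rewrite ler_wpM2r //; exact: wN.
  rewrite -RintegralZr //; last exact: in_L1_norm.
  apply: ler_int_bound => [||x].
  - by apply: in_L1_measurable; apply: in_L1B => //; exact: in_L1D.
  - by apply: (in_L1Mr (C := `|M2 * (h * B) ^+ 2|)) => //; exact: in_L1_norm.
  rewrite (_ : _ - _ = - (w t0 x * (psi (x + h * uk x) - psi x - h * uk x * dpsi x))); last by ring.
  rewrite normrN normrM ler_wpM2l //; apply: le_trans (test_taylor tp _ _) _.
  apply: ler_pM => //; first exact: sqr_ge0.
  rewrite -[(h * uk x) ^+ 2]real_normK ?num_real // !expr2; apply: ler_pM => //.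
have Ft : \int[mu]_x (w t1 x * psi x) = \int[mu]_x (w t0 x * psi x) + l * h.
  by rewrite -Fc /F addrC subrK.
have h2 : l * h <= h * (\int[mu]_x (w t0 x * (uk x * dpsi x)) +
    (M1 * (B + Nw) * e + Nw * L * M1 * k) + beta).
  by rewrite mulrC ler_pM2l //; apply: le_trans lle _; rewrite lerD2r.
rewrite Ft; move: S2 h2; rewrite -/uk.
move: (\int[mu]_x (w t0 x * psi x)) (\int[mu]_x (w t0 x * (uk x * dpsi x)))
  (\int[mu]_x (w t0 x * psi (x + h * uk x))) => a b d S2 h2.
apply: le_trans (lerD (lexx a) h2) _.
set X := M1 * (B + Nw) * e; set Y := Nw * L * M1 * k; set Z := Nw * B ^+ 2 * M2 * h.
rewrite (_ : a + _ = (a + h * b) + h * (X + Y + beta)); last by ring.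
rewrite (_ : d + _ = (d + h * Z) + h * (X + Y + beta)); last by ring.
by rewrite lerD2r.
Unshelve. all: by end_near. Qed.

Lemma duality (L1 L2 r : R) (psi dpsi : R -> R) : test_fun L1 L2 r psi dpsi ->
  \int[mu]_x (w t x * psi x) <= pospart (w s) + (t - s) * beta.
Proof.
move=> tp; apply/ler_addgt0Pr => e e0.
have L10 := test_L1_ge0 tp; have L20 := test_L2_ge0 tp.
pose T := t - s; have T0 : 0 < T by rewrite subr_gt0.
(* Bounds [(1 + h * L) ^+ j], the growth of the Lipschitz constant of the test function after [j]
   steps, for every subdivision. *)
pose E := expR (L * T); have E0 : 0 < E by exact: expR_gt0.
pose M1 := L1 * E; have M10 : 0 <= M1 by rewrite mulr_ge0 // ltW.
have e3 : 0 < e / 3 by rewrite divr_gt0.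
have BN0 : 0 <= B + Nw by rewrite addr_ge0.
have c10 : 0 <= T * (M1 * (B + Nw)) by rewrite mulr_ge0 ?(ltW T0) // mulr_ge0.
have c20 : 0 <= T * (Nw * L * M1).
  by apply: mulr_ge0; [exact: ltW|apply: mulr_ge0 => //; exact: mulr_ge0].
have [x1 x10 /(_ x1)] := small_mul c10 e3.
rewrite lexx (ltW x10) => /(_ isT) H1.
have [k k0 /(_ k)] := small_mul c20 e3.
rewrite lexx (ltW k0) => /(_ isT) H2.
pose C2 := k^-1 * (2 * L).
have C20 : 0 <= C2 by rewrite mulr_ge0 ?invr_ge0 ?(ltW k0) // mulr_ge0.
(* This constant involves [k^-1], because the derivative of the smoothed velocity has Lipschitz
   constant [C2]. So [k] is fixed before the step [h], which then has to make [M2 * h] small. *)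
pose M2 := (L2 + T * (M1 * C2)) * E ^+ 2.
have TMC : 0 <= T * (M1 * C2) by rewrite mulr_ge0 ?(ltW T0) // mulr_ge0.
have M20 : 0 <= M2 by apply: mulr_ge0; [exact: addr_ge0|exact: sqr_ge0].
have c30 : 0 <= T * (Nw * B ^+ 2 * M2).
  apply: mulr_ge0; [exact: ltW|apply: mulr_ge0 => //; apply: mulr_ge0 => //].
  exact: sqr_ge0.
have [x3 x30 H3] := small_mul c30 e3.
have [d d0 Hd] := unif x10.
pose m := Num.min d x3; have m0 : 0 < m by rewrite lt_min d0 x30.
pose n := (Num.truncn (T / m)).+1; pose h := T / n%:R.
have n0 : 0 < n%:R :> R by rewrite ltr0n.
have h0 : 0 < h by rewrite divr_gt0.
have hm : h <= m.
  rewrite /h ler_pdivrMr // mulrC -ler_pdivrMr //; apply: ltW; exact: truncnS_gt.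
have hd : h <= d by apply: le_trans hm _; rewrite ge_min lexx.
have hx3 : h <= x3 by apply: le_trans hm _; rewrite ge_min lexx orbT.
have {}H3 : T * (Nw * B ^+ 2 * M2) * h <= e / 3 by apply: H3; rewrite hx3 (ltW h0).
have nh : n%:R * h = T by rewrite /h mulrC divfK // gt_eqF.
pose err := M1 * (B + Nw) * x1 + Nw * L * M1 * k + Nw * B ^+ 2 * M2 * h.
have hL0 : 0 <= h * L by rewrite mulr_ge0 // ltW.
have hL1 : 1 <= 1 + h * L by rewrite lerDl.
have khT (j : nat) : (j <= n)%N -> j%:R * h <= T.
  by move=> jn; rewrite -nh ler_pM2r // ler_nat.
have powE (j : nat) : (j <= n)%N -> (1 + h * L) ^+ j <= E.
  move=> jn; apply: (@le_trans _ _ (expR (h * L) ^+ j)).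
    by apply: lerXn2r; rewrite ?nnegrE ?expR_ge0 ?expR_ge1Dx // (le_trans ler01).
  rewrite -expRM_natl ler_expR mulrA mulrC ler_wpM2l //; exact: khT.
(* Backwards in time: after [j] steps the transported test function is paired with [w] at time
   [t - j h]. *)
have main (j : nat) : (j <= n)%N -> exists l1 l2 rr (phi dphi : R -> R),
    [/\ test_fun l1 l2 rr phi dphi, l1 <= L1 * (1 + h * L) ^+ j,
      l2 <= (L2 + j%:R * h * (M1 * C2)) * ((1 + h * L) ^+ j) ^+ 2 &
      \int[mu]_x (w t x * psi x) <=
        \int[mu]_x (w (t - j%:R * h) x * phi x) + j%:R * h * (beta + err)].
  elim: j => [_|j ih jn].
    exists L1, L2, r, psi, dpsi; split; rewrite ?expr0 ?expr1n ?mul0r ?subr0 ?addr0 ?mulr1 //.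
  have [l1 [l2 [rr [phi [dphi [tphi l1b l2b ib]]]]]] := ih (ltnW jn).
  have l10 := test_L1_ge0 tphi; have l20 := test_L2_ge0 tphi.
  pose t1 := t - j%:R * h; pose t0 := t1 - h.
  have j0 : 0 <= j%:R * h by rewrite mulr_ge0 // ltW.
  have jS : j.+1%:R * h = j%:R * h + h by rewrite -natr1; ring.
  have t0E : t0 = t - j.+1%:R * h by rewrite jS /t0 /t1; ring.
  have st0 : s <= t0 by have := khT _ jn; rewrite t0E lerBrDr /T lerBrDl.
  have t1t : t1 <= t by rewrite /t1 gerBl.
  have t01 : t0 <= t1 by rewrite /t0 gerBl ltW.
  have in0 : s <= t0 <= t by rewrite st0 (le_trans t01).
  have powj := powE _ (ltnW jn).
  have pj1 : 1 <= (1 + h * L) ^+ j by exact: exprn_ege1.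
  have l1M : l1 <= M1 by apply: le_trans l1b _; rewrite /M1 ler_wpM2l.
  have l2M : l2 <= M2.
    apply: le_trans l2b _; rewrite /M2; apply: ler_pM.
    - by apply: addr_ge0 => //; apply: mulr_ge0 => //; apply: mulr_ge0.
    - exact: sqr_ge0.
    - by rewrite lerD2l; apply: ler_wpM2r; [exact: mulr_ge0|apply: khT; exact: ltnW].
    - by rewrite !expr2; apply: ler_pM => //; exact: (le_trans ler01 pj1).
  have close q : t0 <= q <= t1 -> n1 (fun x => w q x - w t0 x) <= x1 /\
      forall x, `|U q x - U t0 x| <= x1.
    case/andP => q0 q1; apply: Hd => //.
      by rewrite (le_trans st0 q0) (le_trans q1 t1t).
    rewrite ger0_norm ?subr_ge0 //; apply: le_trans hd.
    by rewrite lerBlDl /t0 subrK.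
  have step := duality_step tphi l1M l2M k0 h0 st0 t1t close.
  have te := test_euler tphi (ltW h0) k0 L0 (fun x => UB x in0) (fun x y => UL x y in0).
  exists (l1 * (1 + h * L)), (l2 * (1 + h * L) ^+ 2 + l1 * (h * C2)), (rr + h * B).
  exists (fun x => phi (x + h * box k (U t0) x)),
    (fun x => dphi (x + h * box k (U t0) x) * (1 + h * (k^-1 * (U t0 (x + k) - U t0 x)))).
  split.
  - exact: te.
  - by rewrite [(1 + h * L) ^+ j.+1]exprSr mulrA; apply: ler_wpM2r => //; exact: (le_trans ler01 hL1).
  - rewrite [(1 + h * L) ^+ j.+1]exprSr exprMn jS.
    set p := (1 + h * L) ^+ j; set q := 1 + h * L.
    have q20 : 1 <= q ^+ 2 by exact: exprn_ege1.
    have p20 : 1 <= p ^+ 2 by exact: exprn_ege1.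
    apply: (@le_trans _ _ ((L2 + j%:R * h * (M1 * C2)) * p ^+ 2 * q ^+ 2 + M1 * (h * C2))).
      apply: lerD; first by apply: ler_wpM2r => //; exact: sqr_ge0.
      by apply: ler_wpM2r => //; rewrite mulr_ge0 // ltW.
    rewrite [leRHS](_ : _ = (L2 + j%:R * h * (M1 * C2)) * p ^+ 2 * q ^+ 2 +
      M1 * (h * C2) * (p ^+ 2 * q ^+ 2)); last by ring.
    rewrite lerD2l -[leLHS]mulr1; apply: ler_wpM2l.
      by apply: mulr_ge0 => //; apply: mulr_ge0 => //; exact: ltW.
    by rewrite -[1]mulr1; apply: ler_pM.
  - rewrite -t0E; apply: le_trans ib _.
    apply: le_trans (lerD step (lexx (j%:R * h * (beta + err)))) _.
    by rewrite -/err jS le_eqVlt; apply/orP; left; apply/eqP; ring.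
have [l1 [l2 [rr [phi [dphi [tphi _ _]]]]]] := main n (leqnn _).
rewrite nh (_ : t - T = s); last by rewrite /T; ring.
have iws : in_L1 (w s) by apply: iw; rewrite lexx ltW.
have H4 := int_test_le_pospart iws tphi.
move/le_trans; apply; rewrite mulrDr addrA; apply: lerD.
  by rewrite lerD2r.
rewrite (_ : T * err = T * (M1 * (B + Nw)) * x1 + T * (Nw * L * M1) * k +
  T * (Nw * B ^+ 2 * M2) * h); last by rewrite /err; ring.
apply: (@le_trans _ _ (e / 3 + e / 3 + e / 3)).
  by apply: lerD => //; apply: lerD.
by rewrite le_eqVlt; apply/orP; left; apply/eqP; field.
Qed.

(** [duality] bounds every pairing at time [t], and by [pospart_dense] the pairings exhaust the
    positive part. *)
Lemma pospart_growth (M : R) : tvb (w t) M ->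
  pospart (w t) <= pospart (w s) + (t - s) * beta.
Proof.
move=> wM; have iwt : in_L1 (w t) by apply: iw; rewrite lexx ltW.
apply/ler_addgt0Pr => e e0.
have [L1 [L2 [r [psi [dpsi [tp H]]]]]] := pospart_dense iwt wM e0.
by rewrite -lerBlDr; apply: le_trans H _; exact: duality tp.
Qed.

End Duality.

(** * A Gronwall lemma without integrals, and uniform continuity *)

Section Growth.
Context {R : realType}.
Local Notation mu := (@lebesgue_measure R).

Lemma inv_1sub_le_expR (y : R) : 0 <= y -> y <= 2^-1 -> (1 - y)^-1 <= expR (y * (1 + 2 * y)).
Proof.
move=> y0 y1; have h : 0 < 1 - y by lra.
have -> : (1 - y)^-1 = 1 + y / (1 - y) by field; rewrite gt_eqF.
apply: le_trans (expR_ge1Dx _) _; rewrite ler_expR ler_pdivrMr //.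
rewrite -mulrA -[leLHS]mulr1 ler_wpM2l //.
have : 0 <= y * (1 - 2 * y) by apply: mulr_ge0; lra.
lra.
Qed.

(** The hypothesis uses a bound [b] of [f] on a subinterval instead of an integral, so measurability
    in time never arises. On a step of length [h] the supremum [S] satisfies [S <= f p + h K S],
    whence the factor [(1 - K * h)^-1], which is iterated. The bound [b0] makes the supremum finite
    and leaves no trace in the conclusion. *)
Lemma gronwall (f : R -> R) (s t K b0 : R) : s < t -> 0 <= K ->
  (forall q, s <= q <= t -> 0 <= f q <= b0) ->
  (forall p q b, s <= p -> p < q -> q <= t -> (forall r, p <= r <= q -> f r <= b) ->
    f q <= f p + (q - p) * (K * b)) ->
  f t <= expR (K * (t - s)) * f s.
Proof.
move=> st K0 fb H; set T := t - s; have T0 : 0 < T by rewrite subr_gt0.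
have f0 q : s <= q <= t -> 0 <= f q by move=> /fb/andP[].
have step p h : s <= p -> 0 < h -> p + h <= t -> K * h <= 2^-1 ->
    f (p + h) <= (1 - K * h)^-1 * f p.
  move=> sp h0 pht Kh.
  have inq q : p <= q <= p + h -> s <= q <= t.
    by case/andP => q0 q1; rewrite (le_trans sp q0) (le_trans q1 pht).
  have pp : p <= p <= p + h by rewrite lexx lerDl ltW.
  have pe : p <= p + h <= p + h by rewrite lexx lerDl ltW.
  pose A := [set f q | q in [set q | p <= q <= p + h]].
  have supA : has_sup A.
    split; first by exists (f p), p.
    by exists b0 => _ [q /= /inq /fb /andP[_ hq] <-].
  have fS q : p <= q <= p + h -> f q <= sup A.
    by move=> hq; apply: sup_upper_bound => //; exists q.
  have S0 : 0 <= sup A by apply: le_trans (f0 _ (inq _ pp)) (fS _ pp).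
  have SA : sup A <= f p + h * (K * sup A).
    apply: ge_sup; first by exists (f p), p.
    move=> _ [q /= hq <-]; case/andP: (hq) => q0 q1.
    move: q0; rewrite (le_eqVlt p q) => /orP[/eqP <-|q0].
      by rewrite lerDl mulr_ge0 ?(ltW h0) // mulr_ge0.
    apply: le_trans (H p q (sup A) sp q0 (le_trans q1 pht) _) _.
      by move=> r /andP[r0 r1]; apply: fS; rewrite r0 (le_trans r1 q1).
    rewrite lerD2l; apply: ler_wpM2r; first by rewrite mulr_ge0.
    by rewrite lerBlDl.
  have c0 : 0 < 1 - K * h by rewrite subr_gt0; apply: le_lt_trans Kh _; lra.
  rewrite mulrC ler_pdivlMr //; apply: le_trans (_ : sup A * (1 - K * h) <= _).
    by apply: ler_wpM2r; [exact: ltW|exact: fS].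
  by rewrite (_ : sup A * _ = sup A - h * (K * sup A)) ?lerBlDr //; ring.
pose F := expR (K * T) * f s.
have sS : s <= s <= t by rewrite lexx ltW.
have F0 : 0 <= F by rewrite mulr_ge0 ?expR_ge0 ?f0.
(* The [n] factors [expR (K h (1 + 2 K h))] multiply to [expR (K T + c h)], since [n h = T]. *)
pose c := 2 * (K * T) * K.
have c0 : 0 <= c by apply: mulr_ge0 => //; apply: mulr_ge0 => //; apply: mulr_ge0 => //; exact: ltW.
apply: (@ler_small _ _ _ (2 * c * F)) => d d0 d1.
pose m := Num.min d (2^-1 / (K + c + 1)).
have Kc : 0 < K + c + 1 by rewrite ltr_wpDl // addr_ge0.
have m0 : 0 < m by rewrite lt_min d0 divr_gt0 // invr_gt0.
pose n := (Num.truncn (T / m)).+1; pose h := T / n%:R.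
have n0 : 0 < n%:R :> R by rewrite ltr0n.
have h0 : 0 < h by rewrite divr_gt0.
have hm : h <= m.
  rewrite /h ler_pdivrMr // mulrC -ler_pdivrMr //; apply: ltW; exact: truncnS_gt.
have hd : h <= d by apply: le_trans hm _; rewrite ge_min lexx.
have h2 : h * (K + c + 1) <= 2^-1.
  by rewrite -ler_pdivlMr //; apply: le_trans hm _; rewrite ge_min lexx orbT.
have nh : n%:R * h = T by rewrite /h mulrC divfK // gt_eqF.
have Kh0 : 0 <= K * h by rewrite mulr_ge0 // ltW.
have ch0 : 0 <= c * h by rewrite mulr_ge0 // ltW.
have Kh : K * h <= 2^-1.
  apply: le_trans h2; rewrite mulrC ler_pM2l // -addrA lerDl addr_ge0 //.
have ch : c * h <= 2^-1.
  apply: le_trans h2; rewrite mulrC ler_pM2l // addrAC lerDr addr_ge0 //.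
have iter (j : nat) : (j <= n)%N -> f (s + j%:R * h) <= (1 - K * h)^-1 ^+ j * f s.
  elim: j => [_|j ih jn]; first by rewrite mul0r addr0 expr0 mul1r.
  have jS : s + j.+1%:R * h = s + j%:R * h + h by rewrite -natr1; ring.
  have jT : s + j.+1%:R * h <= t.
    by rewrite -lerBrDl -/T -nh ler_pM2r // ler_nat.
  rewrite jS exprS -mulrA; apply: le_trans (step _ _ _ h0 _ Kh) _.
  - by rewrite lerDl mulr_ge0 // ltW.
  - by rewrite -jS.
  - rewrite ler_wpM2l ?invr_ge0 ?ih ?(ltnW jn) //; lra.
have -> : t = s + n%:R * h by rewrite nh /T addrC subrK.
apply: le_trans (iter n (leqnn _)) _.
have e1 : (1 - K * h)^-1 ^+ n <= expR (K * T) * (1 + 2 * c * h).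
  apply: (@le_trans _ _ (expR (K * h * (1 + 2 * (K * h))) ^+ n)).
    apply: lerXn2r; rewrite ?nnegrE ?expR_ge0 ?invr_ge0 //; first lra.
    exact: inv_1sub_le_expR.
  rewrite -expRM_natl.
  have -> : n%:R * (K * h * (1 + 2 * (K * h))) = K * T + c * h by rewrite /c -nh; ring.
  rewrite expRD ler_pM2l ?expR_gt0 //.
  have : expR (c * h) * (1 - c * h) <= 1.
    have := expR_ge1Dx (- (c * h)); rewrite -(ler_pM2l (expR_gt0 (c * h))).
    by rewrite expRN divff ?gt_eqF ?expR_gt0.
  rewrite -ler_pdivlMr ?div1r; last lra.
  move/le_trans; apply; rewrite -[leLHS]mul1r ler_pdivrMr; last lra.
  have : 0 <= c * h * (1 - 2 * (c * h)) by apply: mulr_ge0; lra.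
  lra.
apply: le_trans (ler_wpM2r (f0 _ sS) e1) _.
have -> : expR (K * T) * (1 + 2 * c * h) * f s = F + 2 * c * F * h by rewrite /F; ring.
by rewrite -/F lerD2l ler_wpM2l // mulr_ge0 // mulr_ge0.
Qed.

(** Both distances in the triangle inequality start at the middle point, as the covering argument
    measures from the centre of a ball. *)
Lemma heine (D : R -> R -> R) (s t : R) :
  (forall p q r, s <= p <= t -> s <= q <= t -> s <= r <= t -> D p r <= D q p + D q r) ->
  (forall p e, s <= p <= t -> 0 < e ->
    exists2 d, 0 < d & forall q, s <= q <= t -> `|p - q| < d -> D p q <= e) ->
  forall e, 0 < e -> exists2 d, 0 < d &
    forall p q, s <= p <= t -> s <= q <= t -> `|p - q| <= d -> D p q <= e.
Proof.
move=> tri loc e e0.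
have e20 : 0 < e / 2 by rewrite divr_gt0.
have /compact_near_coveringP cov := @segment_compact R s t.
pose P (i x : R) := forall q, s <= q <= t -> `|x - q| <= i -> s <= x <= t -> D x q <= e.
have near_P x : `[s, t]%classic x -> \forall x' \near x & i \near (0:R)^'+, P i x'.
  rewrite /= in_itv /= => hx; have [d d0 Hd] := loc x _ hx e20.
  have d20 : 0 < d / 2 by rewrite divr_gt0.
  exists ([set x' | `|x - x'| < d / 2], [set i | i < d / 2]).
    split; first by apply: (@cvgr_dist_lt _ _ _ (nbhs x) _ id x) => //; exact: cvg_id.
    by apply: nbhs_right_lt.
  move=> [x' i] /= [xx' ii] q hq x'q hx'.
  have xq : `|x - q| < d.
    rewrite (_ : x - q = (x - x') + (x' - q)); last by ring.
    by apply: le_lt_trans (ler_normD _ _) _; lra.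
  have xx2 : `|x - x'| < d by lra.
  apply: le_trans (tri x' x q hx' hx hq) _.
  by have := Hd _ hq xq; have := Hd _ hx' xx2; lra.
have := cov _ _ P _ near_P; move=> /(_ _) [d /= d0 Hd].
have d20 : 0 < d / 2 by rewrite divr_gt0.
exists (d / 2) => // p q hp hq pq.
have dd : ball (0 : R) d (d / 2).
  by rewrite /ball /= sub0r normrN ger0_norm ?(ltW d20) // ltr_pdivrMr // ltr_pMr // ltr1n.
by apply: (Hd (d / 2) dd d20 p) => //=; rewrite in_itv.
Qed.

End Growth.

(** * Curves of densities *)

Section Curve.
Context {R : realType}.
Local Notation mu := (@lebesgue_measure R).

Lemma within_itv_continuous (f : R -> R) (s t : R) :
  (forall p e, s <= p <= t -> 0 < e -> exists2 d, 0 < d &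
    forall q, s <= q <= t -> `|p - q| < d -> `|f p - f q| <= e) ->
  {within `[s, t], continuous f}.
Proof.
move=> H; apply/subspace_continuousP => x /=; rewrite in_itv /= => hx.
apply/cvgrPdist_le => e e0; have [d d0 Hd] := H x e hx e0.
rewrite near_withinE; apply/nbhs_ballP; exists d => //= q xq; rewrite in_itv /= => hq.
exact: Hd.
Qed.

Lemma tvbB (f g : R -> R) (M1 M2 : R) : in_L1 f -> in_L1 g -> tvb f M1 -> tvb g M2 ->
  tvb (fun x => f x - g x) (M1 + M2).
Proof.
move=> fi gi fM gM z z0; have := fM z z0; have := gM z z0.
have k1 := in_L1B (in_L1_shift z fi) fi; have k2 := in_L1B (in_L1_shift z gi) gi.
have := n1D k1 (in_L1N k2); rewrite n1N.
rewrite (_ : (fun x => _ + _) = (fun x => f (x + z) - g (x + z) - (f x - g x))).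
  by move=> a b c; lra.
by apply/funext => x; ring.
Qed.

Variables (eta We : R) (alpha : R -> R).
Hypothesis ma : mixture eta We alpha.
Local Notation cv := (conv eta We alpha).
Local Notation W0 := (mass eta We alpha).

Variables (h : R -> R) (rm N C : R).
Hypotheses (N0 : 0 <= N) (rm0 : 0 <= rm).
Hypothesis hN : forall a b, `|h a - h b| <= N * `|a - b|.
Hypothesis hC : forall a, `|h a| <= C.

(* The sign [sg = -1] describes time-reversed solutions. *)
Record curve (sg : R) (rho : R -> R -> R) (s t : R) : Prop := Curve {
  curve_L1 : forall q, s <= q <= t -> in_L1 (rho q);
  curve_itv : forall q x, s <= q <= t -> 0 <= rho q x <= rm;
  curve_cont : forall p e, s <= p <= t -> 0 < e -> exists2 d, 0 < d &
    forall q, s <= q <= t -> `|p - q| < d -> n1 (fun x => rho p x - rho q x) <= e;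
  curve_der : forall L1 L2 r psi dpsi, test_fun L1 L2 r psi dpsi ->
    forall q, s < q < t ->
      is_derive q (1 : R) (fun q : R => \int[mu]_x (rho q x * psi x))
        (sg * \int[mu]_x (rho q x * cv (fun y => h (rho q y)) x * dpsi x)) }.

Lemma curve_sub sg rho s t s' t' : s <= s' -> t' <= t -> curve sg rho s t -> curve sg rho s' t'.
Proof.
move=> ss tt [c1 c2 c3 c4].
have sub q : s' <= q <= t' -> s <= q <= t.
  by case/andP=> a b; rewrite (le_trans ss a) (le_trans b tt).
split.
- by move=> q /sub; exact: c1.
- by move=> q x /sub; exact: c2.
- move=> p e /sub hp e0; have [d d0 H] := c3 p e hp e0.
  by exists d => // q /sub; exact: H.
- move=> L1 L2 r psi dpsi tp q /andP[a b]; apply: c4 tp _ _.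
  by rewrite (le_lt_trans ss a) (lt_le_trans b tt).
Qed.

Lemma measurable_flux (f : R -> R) : in_L1 f -> measurable_fun setT (fun x => h (f x)).
Proof.
move=> /in_L1_measurable mf; apply: (measurableT_comp _ mf).
by apply: continuous_measurable_fun; apply: lip_continuous hN.
Qed.

Lemma in_L1_fluxB (f g : R -> R) : in_L1 f -> in_L1 g -> in_L1 (fun x => h (f x) - h (g x)).
Proof.
move=> fi gi; apply: (@le_in_L1 _ _ (fun x => N * `|f x - g x|)) => //.
  by apply: measurable_funB; exact: measurable_flux.
by apply: in_L1Zl; apply: in_L1_norm; exact: in_L1B.
Qed.

Lemma n1_fluxB (f g : R -> R) : in_L1 f -> in_L1 g ->
  n1 (fun x => h (f x) - h (g x)) <= N * n1 (fun x => f x - g x).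
Proof.
move=> fi gi; rewrite -intZl; last by apply: in_L1_norm; exact: in_L1B.
apply: le_n1 => //; first exact: in_L1_fluxB.
by apply: in_L1Zl; apply: in_L1_norm; exact: in_L1B.
Qed.

Lemma conv_fluxB (f g : R -> R) x : in_L1 f -> in_L1 g ->
  cv (fun y => h (f y)) x - cv (fun y => h (g y)) x = cv (fun y => h (f y) - h (g y)) x.
Proof. by move=> fi gi; apply: (convB ma (C := C)) => //; exact: measurable_flux. Qed.

Lemma conv_fluxB_le (f g : R -> R) x : in_L1 f -> in_L1 g ->
  `|cv (fun y => h (f y)) x - cv (fun y => h (g y)) x| <= W0 * (N * n1 (fun x => f x - g x)).
Proof.
move=> fi gi; rewrite conv_fluxB //.
apply: (le_trans (@conv_n1 _ _ _ _ ma _ (C + C) _ _ x _)).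
- by apply: measurable_funB; exact: measurable_flux.
- by move=> z; apply: le_trans (ler_normB _ _) _; apply: lerD.
- exact: in_L1_fluxB.
- by apply: ler_wpM2l; [exact: mass_ge0|exact: n1_fluxB].
Qed.

Lemma curve_unif sg rho s t e : curve sg rho s t -> 0 < e -> exists2 d, 0 < d &
  forall p q, s <= p <= t -> s <= q <= t -> `|p - q| <= d ->
    n1 (fun x => rho p x - rho q x) <= e.
Proof.
move=> c e0; apply: (@heine _ (fun p q => n1 (fun x => rho p x - rho q x))) => //; last first.
  by move=> p e'; exact: (curve_cont c).
move=> p q r hp hq hr.
apply: le_trans (n1_sub (curve_L1 c hp) (curve_L1 c hq) (curve_L1 c hr)) _.
by rewrite lerD2r -n1N; under eq_fun do rewrite opprB.
Qed.

Lemma curve_n1_bounded sg rho s t : s <= t -> curve sg rho s t ->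
  exists b, forall q, s <= q <= t -> n1 (rho q) <= b.
Proof.
move=> st c.
have [|p pi H] := @EVT_max _ (fun q => n1 (rho q)) s t st.
  apply: within_itv_continuous => p e hp e0.
  have [d d0 H] := curve_cont c hp e0; exists d => // q hq pq.
  by apply: le_trans (H q hq pq); apply: n1_dist; exact: (curve_L1 c).
by exists (n1 (rho p)) => q hq; apply: H; rewrite in_itv.
Qed.

Lemma curve_dist_bounded sg rho sig s t : s <= t -> curve sg rho s t -> curve sg sig s t ->
  exists b, forall q, s <= q <= t -> n1 (fun x => rho q x - sig q x) <= b.
Proof.
move=> st c1 c2; have [b1 H1] := curve_n1_bounded st c1.
have [b2 H2] := curve_n1_bounded st c2; exists (b1 + b2) => q hq.
apply: le_trans (n1D (curve_L1 c1 hq) (in_L1N (curve_L1 c2 hq))) _.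
by rewrite n1N; apply: lerD; [exact: H1|exact: H2].
Qed.

(** With [w = rho - sig] transported by the velocity of [sig], the remaining source is [rho] times
    the difference of the velocities, paired with [dpsi]. The L^1 norm is the sum of the positive
    parts of [w] and [- w], each growing at rate at most [beta]; hence [2 * beta]. *)
Lemma curve_growth sg rho sig s t beta M1 M2 : `|sg| = 1 -> s < t ->
  curve sg rho s t -> curve sg sig s t -> tvb (rho t) M1 -> tvb (sig t) M2 ->
  (forall L1 L2 r psi dpsi, test_fun L1 L2 r psi dpsi -> forall q, s < q < t ->
    `|\int[mu]_x (rho q x * dpsi x * cv (fun y => h (rho q y) - h (sig q y)) x)| <= beta) ->
  n1 (fun x => rho t x - sig t x) <=
    n1 (fun x => rho s x - sig s x) + (t - s) * (2 * beta).
Proof.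
move=> sg1 st c1 c2 rM sM hb.
pose w q x := rho q x - sig q x.
pose U q x := sg * cv (fun y => h (sig q y)) x.
have tt : s <= t <= t by rewrite lexx ltW.
have iw q : s <= q <= t -> in_L1 (w q).
  by move=> hq; apply: in_L1B; [exact: (curve_L1 c1)|exact: (curve_L1 c2)].
have [Nw wN] := curve_dist_bounded (ltW st) c1 c2.
have mh q : s <= q <= t -> measurable_fun setT (fun y => h (sig q y)).
  by move=> hq; apply: measurable_flux; exact: (curve_L1 c2).
have W00 := mass_ge0 ma.
have nsg x : `|sg * x| = `|x| by rewrite normrM sg1 mul1r.
have UB q x : s <= q <= t -> `|U q x| <= W0 * (C * eta).
  by move=> hq; rewrite nsg; apply: (conv_bound ma (mh q hq)).
have UL q x y : s <= q <= t -> `|U q x - U q y| <= W0 * (2 * C) * `|x - y|.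
  by move=> hq; rewrite /U -mulrBr nsg; apply: (conv_lip ma (mh q hq)).
have C0 : 0 <= C by apply: le_trans (hC 0).
have unif e : 0 < e -> exists2 d, 0 < d & forall p q, s <= p <= t -> s <= q <= t ->
    `|p - q| <= d -> n1 (fun x => w p x - w q x) <= e /\ forall x, `|U p x - U q x| <= e.
  (* [w] moves by at most two L^1 distances, and [U] by at most [W0 * N] times one. *)
  move=> e0; pose e' := e / (2 + W0 * N).
  have D0 : 0 < 2 + W0 * N by rewrite ltr_wpDr ?mulr_ge0.
  have e'0 : 0 < e' by rewrite divr_gt0.
  have ee : 2 * e' + W0 * (N * e') = e by rewrite /e'; field; rewrite gt_eqF.
  have x0 : 0 <= W0 * (N * e') by rewrite mulr_ge0 // mulr_ge0 // ltW.
  have [d1 d10 H1] := curve_unif c1 e'0; have [d2 d20 H2] := curve_unif c2 e'0.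
  exists (Num.min d1 d2); first by rewrite lt_min d10.
  move=> p q hp hq; rewrite le_min => /andP[pq1 pq2].
  have h1 := H1 p q hp hq pq1; have h2 := H2 p q hp hq pq2; split.
    rewrite (_ : (fun x => _) = (fun x => (rho p x - rho q x) + - (sig p x - sig q x))); last first.
      by apply/funext => x; rewrite /w; ring.
    have i1 := in_L1B (curve_L1 c1 hp) (curve_L1 c1 hq).
    have i2 := in_L1B (curve_L1 c2 hp) (curve_L1 c2 hq).
    apply: le_trans (n1D i1 (in_L1N i2)) _; rewrite n1N; lra.
  move=> x; rewrite /U -mulrBr nsg.
  apply: le_trans (conv_fluxB_le _ (curve_L1 c2 hp) (curve_L1 c2 hq)) _.
  apply: (@le_trans _ _ (W0 * (N * e'))); last lra.
  by apply: ler_wpM2l => //; apply: ler_wpM2l.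
have der (sg' : R) L1 L2 r psi dpsi : `|sg'| = 1 -> test_fun L1 L2 r psi dpsi ->
    forall q, s < q < t -> exists2 l : R,
    is_derive q (1 : R) (fun q : R => \int[mu]_x (sg' * w q x * psi x)) l &
    l <= \int[mu]_x (sg' * w q x * U q x * dpsi x) + beta.
  move=> sg'1 tp q sqt.
  have hq : s <= q <= t by case/andP: sqt => a b; rewrite !ltW.
  pose E := \int[mu]_x (rho q x * dpsi x * cv (fun y => h (rho q y) - h (sig q y)) x).
  have D1 := curve_der c1 tp sqt; have D2 := curve_der c2 tp sqt.
  exists (\int[mu]_x (sg' * w q x * U q x * dpsi x) + sg' * sg * E); last first.
    rewrite lerD2l; apply: le_trans (ler_norm _) _.
    by rewrite !normrM sg1 sg'1 !mul1r; exact: hb tp _ _.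
  have mp := test_measurable tp; have mdp := test_dmeasurable tp.
  have i1 := curve_L1 c1 hq; have i2 := curve_L1 c2 hq.
  have mh1 := measurable_flux i1; have mh2 := measurable_flux i2.
  pose V1 := cv (fun y => h (rho q y)); pose V2 := cv (fun y => h (sig q y)).
  have iV f g (fi : in_L1 f) (gi : in_L1 g) : in_L1 (fun x => f x * cv (fun y => h (g y)) x * dpsi x).
    apply: in_L1Mr (test_dbound tp) => //.
    apply: in_L1Mr (conv_bound ma (measurable_flux gi) (fun z => hC _)) => //.
    exact: conv_measurable (measurable_flux gi) (fun z => hC _).
  pose I1 := \int[mu]_x (rho q x * V1 x * dpsi x).
  pose I2 := \int[mu]_x (sig q x * V2 x * dpsi x).
  pose I3 := \int[mu]_x (rho q x * V2 x * dpsi x).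
  have eE : E = I1 - I3.
    rewrite /I1 /I3 -intB; [|exact: iV|exact: iV].
    by apply: eq_int => x; rewrite -conv_fluxB // -/V1 -/V2; ring.
  have -> : \int[mu]_x (sg' * w q x * U q x * dpsi x) + sg' * sg * E = sg' * (sg * I1 - sg * I2).
    have -> : \int[mu]_x (sg' * w q x * U q x * dpsi x) = sg' * sg * (I3 - I2).
      rewrite /I3 /I2 -intB; [|exact: iV|exact: iV].
      rewrite -intZl; last by apply: in_L1B; exact: iV.
      by apply: eq_int => x; rewrite /w /U -/V2; ring.
    by rewrite eE; move: I1 I2 I3 {eE} => a b c; ring.
  have D3 : is_derive q (1 : R) (fun z : R => sg' * (\int[mu]_x (rho z x * psi x) -
      \int[mu]_x (sig z x * psi x))) _ := is_deriveZ sg' (is_deriveB D1 D2).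
  move: D3; apply: near_eq_is_derive.
  have : q \in `]s, t[ by rewrite in_itv.
  move=> /near_in_itvoo; apply: filterS => z; rewrite in_itv /= => /andP[z0 z1].
  have hz : s <= z <= t by rewrite !ltW.
    have ip f (fi : in_L1 f) : in_L1 (fun x => f x * psi x).
    by apply: in_L1Mr (test_norm1 tp) => //.
  have j1 := ip _ (curve_L1 c1 hz); have j2 := ip _ (curve_L1 c2 hz).
  rewrite -intB // -intZl; last exact: in_L1B.
  by apply: eq_int => x; rewrite /w; ring.
have wM : tvb (w t) (M1 + M2) := tvbB (curve_L1 c1 tt) (curve_L1 c2 tt) rM sM.
have LB : 0 <= W0 * (2 * C) by rewrite mulr_ge0 // mulr_ge0.
have nw (sg' : R) f : `|sg'| = 1 -> n1 (fun x => sg' * f x) = n1 f.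
  by move=> e; apply: eq_int => x; rewrite normrM e mul1r.
have pg (sg' : R) : `|sg'| = 1 ->
    pospart (fun x => sg' * w t x) <= pospart (fun x => sg' * w s x) + (t - s) * beta.
  move=> e1; apply: (@pospart_growth _ (fun q x => sg' * w q x) U s t _ _ Nw beta st LB
    _ _ UB UL _ _ (M1 + M2)).
  - by move=> q hq; apply: in_L1Zl; exact: iw.
  - by move=> q hq; rewrite nw //; exact: wN.
  - move=> e e0; have [d d0 H] := unif e e0; exists d => // p q hp hq pq.
    have [H1 H2] := H p q hp hq pq; split => //.
    by under eq_fun do rewrite -mulrBr; rewrite nw.
  - by move=> L1 L2 r psi dpsi tp q hq; exact: der tp q hq.
  - by move=> z z0; under eq_fun do rewrite -mulrBr; rewrite nw //; exact: wM.
rewrite -/(w t) -/(w s) !n1_pospart; [|by apply: iw; rewrite lexx ltW|exact: iw].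
have E1 f : pospart (fun x => 1 * f x) = pospart f by under eq_fun do rewrite mul1r.
have E2 f : pospart (fun x => -1 * f x) = pospart (fun x => - f x).
  by under eq_fun do rewrite mulN1r.
have := pg 1 (normr1 _); have := pg (-1) (normrN1 _); rewrite !E1 !E2.
move: (pospart _) (pospart _) (pospart _) (pospart _) => a b c e h1 h2; nra.
Qed.

End Curve.

(** * L^1 stability and propagation of the variation within one noise step *)

Section CurveEstimates.
Context {R : realType}.
Local Notation mu := (@lebesgue_measure R).
Variables (eta We : R) (alpha : R -> R).
Hypothesis ma : mixture eta We alpha.
Local Notation cv := (conv eta We alpha).
Local Notation W0 := (mass eta We alpha).

Lemma tvb_ge0 (f : R -> R) M : tvb f M -> 0 <= M.
Proof. by move=> /(_ 1 ltr01); rewrite mul1r; apply: le_trans; exact: n1_ge0. Qed.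

Lemma tvb_le (f : R -> R) M M' : M <= M' -> tvb f M -> tvb f M'.
Proof. by move=> MM H z z0; apply: le_trans (H z z0) _; rewrite ler_pM2l. Qed.

Lemma tvb_lim (f : R -> R) M : in_L1 f ->
  (forall e, 0 < e -> exists g, [/\ in_L1 g, tvb g M & n1 (fun x => f x - g x) <= e]) ->
  tvb f M.
Proof.
move=> fi H z z0; apply/ler_addgt0Pr => e e0.
have e20 : 0 < e / 2 by rewrite divr_gt0.
have [g [gi gM fg]] := H _ e20.
have fgi := in_L1B fi gi; have fgz := in_L1_shift z fgi.
have i1 := in_L1B fgz fgi; have i2 := in_L1B (in_L1_shift z gi) gi.
have -> : (fun x => f (x + z) - f x) =
    (fun x => (f (x + z) - g (x + z) - (f x - g x)) + (g (x + z) - g x)).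
  by apply/funext => x; ring.
apply: le_trans (n1D i1 i2) _; have := gM z z0.
have := n1D fgz (in_L1N fgi); rewrite n1N (n1_shift (f := fun x => f x - g x)) //.
lra.
Qed.

(** The least constant in [tvb], as soon as a finite one exists; this is the function of time to
    which Gronwall's lemma is applied. *)
Definition best (f : R -> R) : R := sup [set n1 (fun x => f (x + z) - f x) / z | z in [set z | 0 < z]].

Lemma best_le f M : tvb f M -> best f <= M.
Proof.
move=> H; apply: ge_sup; first by exists (n1 (fun x => f (x + 1) - f x) / 1), 1 => //=.
by move=> _ [z /= z0 <-]; rewrite ler_pdivrMr // mulrC; exact: H.
Qed.

Lemma tvb_best f M : tvb f M -> tvb f (best f).
Proof.
move=> H z z0; rewrite mulrC -ler_pdivrMr //; apply: sup_upper_bound; last by exists z.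
split; first by exists (n1 (fun x => f (x + 1) - f x) / 1), 1 => //=.
by exists M => _ [y /= y0 <-]; rewrite ler_pdivrMr // mulrC; exact: H.
Qed.

Variables (h : R -> R) (rm N C : R).
Hypotheses (N0 : 0 <= N) (rm0 : 0 <= rm).
Hypothesis hN : forall a b, `|h a - h b| <= N * `|a - b|.
Hypothesis hC : forall a, `|h a| <= C.
Local Notation curve := (curve eta We alpha h rm).

(** The equation commutes with translations in space: the shift is thrown onto the test function,
    and [conv_shift] handles the velocity. *)
Lemma curve_shift sg rho s t z : curve sg rho s t ->
  curve sg (fun q x => rho q (x + z)) s t.
Proof.
move=> c; split.
- by move=> q hq; apply: in_L1_shift; exact: (curve_L1 c).
- by move=> q x hq; exact: (curve_itv c).
- move=> p e hp e0; have [d d0 H] := curve_cont c hp e0; exists d => // q hq pq.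
  rewrite (n1_shift (f := fun x => rho p x - rho q x)); first exact: H.
  by apply: in_L1B; exact: (curve_L1 c).
- move=> L1 L2 r psi dpsi tp q hq.
  have tp' := test_shift tp (- z); have D := curve_der c tp' hq.
  have sh (f g : R -> R) (p : R) : in_L1 f -> measurable_fun setT g -> (forall x, `|g x| <= p) ->
      \int[mu]_x (f x * g (x - z)) = \int[mu]_x (f (x + z) * g x).
    move=> fi mg gp; rewrite -(int_shift z); last first.
      by apply: in_L1Mr fi _ (fun x => gp _); exact: (measurable_shift (- z) mg).
    by apply: eq_int => x; rewrite addrK.
  have hq' : s <= q <= t by case/andP: hq => a b; rewrite !ltW.
  have iq := curve_L1 c hq'; have mh := measurable_flux hN iq.
  rewrite (_ : \int[mu]_x (rho q (x + z) * _ * _) =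
    \int[mu]_x (rho q x * cv (fun y => h (rho q y)) x * dpsi (x - z))).
    move: D; apply: near_eq_is_derive; have : q \in `]s, t[ by rewrite in_itv.
    move=> /near_in_itvoo; apply: filterS => y; rewrite in_itv /= => /andP[y0 y1].
    apply: sh (test_measurable tp) (test_norm1 tp).
    by apply: (curve_L1 c); rewrite !ltW.
  rewrite (sh (fun x => rho q x * cv (fun y => h (rho q y)) x) _ L1).
  - apply: eq_int => x /=; congr (_ * dpsi x); congr (_ * _).
    exact: (conv_shift ma mh (fun _ => hC _) z x).
  - apply: in_L1Mr iq _ (conv_bound ma mh (fun z => hC _)).
    exact: conv_measurable mh (fun z => hC _).
  - exact: test_dmeasurable tp.
  - exact: test_dbound tp.
Qed.

Lemma curve_rev sg rho s t : curve sg rho s t ->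
  curve (- sg) (fun q => rho (s + t - q)) s t.
Proof.
move=> c; have rv q : s <= q <= t -> s <= s + t - q <= t.
  by case/andP => a b; apply/andP; split; lra.
split.
- by move=> q /rv; exact: (curve_L1 c).
- by move=> q x /rv; exact: (curve_itv c).
- move=> p e /rv hp e0; have [d d0 H] := curve_cont c hp e0; exists d => // q /rv hq pq.
  by apply: H => //; rewrite (_ : _ - _ = - (p - q)) ?normrN //; ring.
- move=> L1 L2 r psi dpsi tp q hq.
  have hq' : s < s + t - q < t by case/andP: hq => a b; apply/andP; split; lra.
  have D := curve_der c tp hq'.
  have D2 : is_derive q (1 : R) (fun q : R => s + t - q) (-1).
    by apply: is_derive_eq; rewrite ?addr0 ?add0r ?sub0r ?mul1r.
  by have D3 := is_derive1_comp (g := fun q : R => s + t - q) D D2; rewrite mulrN1 -mulNr in D3; exact: D3.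
Qed.

(** [int_test_conv_le] provides [beta = W0 * (M / 2 * (N * b))]. The factor 2 of [curve_growth]
    cancels the 1/2, and Gronwall's lemma gives the exponent. The uniform bound [M] concerns [rho]
    because the source carries [rho]. *)
Lemma curve_stability sg rho sig s t M : `|sg| = 1 -> s <= t ->
  curve sg rho s t -> curve sg sig s t ->
  (forall q, s <= q <= t -> tvb (rho q) M) ->
  (forall q, s <= q <= t -> exists M', tvb (sig q) M') ->
  n1 (fun x => rho t x - sig t x) <=
    expR (N * W0 * M * (t - s)) * n1 (fun x => rho s x - sig s x).
Proof.
move=> sg1; rewrite le_eqVlt => /orP[/eqP <- *|st c1 c2 HM HM'].
  by rewrite subrr mulr0 expR0 mul1r.
have W00 := mass_ge0 ma.
have M0 : 0 <= M by apply: (@tvb_ge0 (rho s)); apply: HM; rewrite lexx ltW.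
have [b0 Hb0] := curve_dist_bounded (ltW st) c1 c2.
apply: (@gronwall _ (fun q => n1 (fun x => rho q x - sig q x)) s t _ b0) => //.
- by rewrite !mulr_ge0.
- by move=> q hq; rewrite n1_ge0 Hb0.
move=> p q b sp pq qt Hb.
have sub r : p <= r <= q -> s <= r <= t.
  by case/andP=> x y; rewrite (le_trans sp x) (le_trans y qt).
have qq : p <= q <= q by rewrite lexx ltW.
have [M' qM'] := HM' q (sub q qq).
have c1' := curve_sub sp qt c1; have c2' := curve_sub sp qt c2.
have -> : N * W0 * M * b = 2 * (W0 * (M / 2 * (N * b))) by field.
apply: (curve_growth ma N0 hN hC sg1 pq c1' c2' _ qM').
  by apply: HM; exact: sub.
move=> L1 L2 r psi dpsi tp y /andP[y0 y1].
have hy : p <= y <= q by rewrite !ltW.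
have i1 := curve_L1 c1' hy; have i2 := curve_L1 c2' hy.
apply: (le_trans (int_test_conv_le ma (rm := rm) (M := M) (C := C + C) tp i1 _ _ _ _)).
- by move=> x; have /andP[u0 u1] := curve_itv c1' x hy; rewrite ger0_norm.
- by apply: HM; exact: sub.
- exact: in_L1_fluxB.
- by move=> z; apply: le_trans (ler_normB _ _) _; apply: lerD.
apply: ler_wpM2l => //; apply: ler_wpM2l; first by rewrite divr_ge0.
apply: le_trans (n1_fluxB hN i1 i2) _.
by apply: ler_wpM2l => //; exact: Hb.
Qed.

(** Growth rate of the variation: [W0 * (2 * C)] is the Lipschitz constant of the velocity, which
    bounds its increment under a translation; the other summand is the second term of
    [int_test_conv_le_sup]; the outer 2 is that of [curve_growth]. *)
Let G := 2 * (W0 * (2 * C + 2 * (rm * N))).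

Let G0 : 0 <= G.
Proof.
have C0 : 0 <= C by apply: le_trans (hC 0).
by rewrite mulr_ge0 // mulr_ge0 ?(mass_ge0 ma) // addr_ge0 ?mulr_ge0.
Qed.

(** The translate of a solution is again a solution, and [curve_growth] compares the two. The bound
    [b0] is purely qualitative: it starts Gronwall's lemma and is absent from the conclusion, which
    is what makes the category argument possible. *)
Lemma curve_tvb sg rho s t b0 M : `|sg| = 1 -> s <= t -> curve sg rho s t ->
  (forall q, s <= q <= t -> tvb (rho q) b0) -> tvb (rho s) M ->
  tvb (rho t) (expR (G * (t - s)) * M).
Proof.
move=> sg1; rewrite le_eqVlt => /orP[/eqP <- *|st c HM sM].
  by rewrite subrr mulr0 expR0 mul1r.
have W00 := mass_ge0 ma; have C0 : 0 <= C by apply: le_trans (hC 0).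
have tt : s <= t <= t by rewrite lexx ltW.
have ss : s <= s <= t by rewrite lexx ltW.
apply: (@tvb_le _ (best (rho t))); last exact: tvb_best (HM t tt).
apply: (@le_trans _ _ (expR (G * (t - s)) * best (rho s))); last first.
  by rewrite ler_pM2l ?expR_gt0 //; exact: best_le.
apply: (@gronwall _ (fun q => best (rho q)) s t _ b0) => //.
  by move=> q hq; rewrite (best_le (HM q hq)) (tvb_ge0 (tvb_best (HM q hq))).
move=> p q b sp pq qt Hb.
have sub r : p <= r <= q -> s <= r <= t.
  by case/andP=> x y; rewrite (le_trans sp x) (le_trans y qt).
have pp : p <= p <= q by rewrite lexx ltW.
have qq : p <= q <= q by rewrite lexx ltW.
have Mb r : p <= r <= q -> tvb (rho r) b.
  by move=> hr; apply: tvb_le (Hb r hr) _; apply: tvb_best (HM r (sub r hr)).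
have b00 : 0 <= b := tvb_ge0 (Mb p pp).
have c' := curve_sub sp qt c.
apply: best_le => z z0; have cz := curve_shift z c'.
pose beta := W0 * (2 * C) * z * b + W0 * (2 * (rm * (N * (z * b)))).
have -> : z * (best (rho p) + (q - p) * (G * b)) = z * best (rho p) + (q - p) * (2 * beta).
  by rewrite /G /beta; ring.
have tz (f : R -> R) : in_L1 f -> tvb f b -> tvb (fun x => f (x + z)) b.
  move=> fi H y y0; under eq_fun do rewrite addrAC.
  rewrite (n1_shift (f := fun x => f (x + y) - f x)); first exact: H.
  by apply: in_L1B => //; exact: in_L1_shift.
apply: (@le_trans _ _ (n1 (fun x => rho p (x + z) - rho p x) + (q - p) * (2 * beta))); last first.
  by rewrite lerD2r; exact: (tvb_best (HM p (sub p pp))).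
apply: (curve_growth ma N0 hN hC sg1 pq cz c' (tz _ (curve_L1 c' qq) (Mb q qq)) (Mb q qq)).
move=> L1 L2 r psi dpsi tp y /andP[y0 y1].
have hy : p <= y <= q by rewrite !ltW.
have i1 := curve_L1 cz hy; have i2 := curve_L1 c' hy.
apply: (le_trans (int_test_conv_le_sup ma (rm := rm) (M := b) (C := C + C)
  (A := W0 * (2 * C) * z) tp i1 _ _ _ _ _)).
- by move=> x; have /andP[u0 u1] := curve_itv cz x hy; rewrite ger0_norm.
- exact: tz i2 (Mb y hy).
- exact: in_L1_fluxB.
- by move=> u; apply: le_trans (ler_normB _ _) _; apply: lerD.
- move=> x; have mh := measurable_flux hN i2.
  rewrite -(conv_fluxB ma hN hC) //.
  rewrite (conv_shift ma mh (fun z => hC _)).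
  apply: le_trans (conv_lip ma mh (fun z => hC _) _ _) _.
  by rewrite addrAC subrr add0r (gtr0_norm z0).
rewrite lerD2l; apply: ler_wpM2l => //; apply: ler_wpM2l => //; apply: ler_wpM2l => //.
apply: le_trans (n1_fluxB hN i1 i2) _.
by apply: ler_wpM2l => //; exact: Mb.
Qed.

Lemma curve_tvb_rev sg rho s t b0 M : `|sg| = 1 -> s <= t -> curve sg rho s t ->
  (forall q, s <= q <= t -> tvb (rho q) b0) -> tvb (rho t) M ->
  tvb (rho s) (expR (G * (t - s)) * M).
Proof.
move=> sg1 st c Hb tM; have := curve_rev c.
move=> /curve_tvb -/(_ b0 M); rewrite normrN addrK; apply => //; last by rewrite addrAC subrr add0r.
by move=> q /andP[a b]; apply: Hb; apply/andP; split; lra.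
Qed.

End CurveEstimates.

(** * Local boundedness by nested intervals *)

Section LocalBoundedness.
Context {R : realType}.

(* [Q q M] reads [f q <= M] for a lower semicontinuous function [f : R -> [0, +oo]]
   whose values at the ends of an interval on which it is bounded are comparable. *)
Record comparable_level (Q : R -> R -> Prop) (a b B : R) : Prop := ComparableLevel {
  level_le : forall q M M', M <= M' -> Q q M -> Q q M';
  level_finite : forall q, a <= q <= b -> exists M, Q q M;
  level_closed : forall q M, a <= q <= b ->
    (forall e, 0 < e -> exists q', [/\ a <= q' <= b, `|q - q'| < e & Q q' M]) -> Q q M;
  level_fwd : forall s t b0 M, a <= s -> s <= t -> t <= b ->
    (forall q, s <= q <= t -> Q q b0) -> Q s M -> Q t (B * M);
  level_bwd : forall s t b0 M, a <= s -> s <= t -> t <= b ->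
    (forall q, s <= q <= t -> Q q b0) -> Q t M -> Q s (B * M) }.

Definition bounded_level (Q : R -> R -> Prop) s t := exists M, forall q, s <= q <= t -> Q q M.

Lemma comparable_level_opp Q a b B : comparable_level Q a b B ->
  comparable_level (fun q => Q (- q)) (- b) (- a) B.
Proof.
move=> c; have opp (s t q : R) : - t <= q <= - s -> s <= - q <= t.
  by case/andP => x y; apply/andP; split; lra.
split.
- by move=> q M M'; exact: (level_le c).
- by move=> q /opp; exact: (level_finite c).
- move=> q M /opp hq H; apply: (level_closed c hq) => e e0.
  have [q' [h1 h2 h3]] := H e e0; exists (- q'); split => //; first exact: opp.
  by rewrite -opprD normrN.
- move=> s t b0 M bs st ta H; apply: (level_bwd c (b0 := b0)); [lra|lra|lra|].
  by move=> q hq; rewrite -[q]opprK; apply: H; apply/andP; case/andP: hq => x y; split; lra.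
- move=> s t b0 M bs st ta H; apply: (level_fwd c (b0 := b0)); [lra|lra|lra|].
  by move=> q hq; rewrite -[q]opprK; apply: H; apply/andP; case/andP: hq => x y; split; lra.
Qed.

(** Reading [Q q M] as [f q <= M], let [x] be the last time up to which [f] is bounded from [q0] on.
    If [f x <= n], the backward comparison would give [f q0 <= B n]. So [f > n] at [x], hence near
    [x] by semicontinuity, while [f] is unbounded just to the right of [x]. *)
Lemma unbounded_step_right Q a b B n q0 t : comparable_level Q a b B ->
  a <= q0 -> q0 <= t -> t <= b -> ~ bounded_level Q q0 t -> ~ Q q0 (B * n) ->
  exists s' t', [/\ q0 <= s', s' <= t', t' <= t, ~ bounded_level Q s' t' &
    forall q, s' <= q <= t' -> ~ Q q n].
Proof.
move=> c aq qt tb bad nQ.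
pose A := [set r | q0 <= r <= t /\ bounded_level Q q0 r].
have [M0 QM0] : exists M, Q q0 M by apply: (level_finite c); rewrite aq (le_trans qt).
have Aq0 : A q0.
  split; first by rewrite lexx.
  by exists M0 => q /le_anti <-.
have supA : has_sup A by split; [exists q0|exists t => r [/andP[]]].
pose x := sup A.
have qx : q0 <= x by exact: sup_upper_bound.
have xt : x <= t by apply: ge_sup; [exists q0|move=> r [/andP[]]].
have axb : a <= x <= b by rewrite (le_trans aq qx) (le_trans xt tb).
(* A bound valid on all of [q0, x[: starting from [q0], [level_fwd] gives [B * M0] whatever bound
   [b0] is available up to the given time. *)
pose M1 := Num.max M0 (B * M0).
have QM1 : Q q0 M1 by apply: level_le c _ _ _ _ QM0; rewrite le_max lexx.
have Qr r : q0 <= r -> r < x -> Q r M1.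
  move=> qr rx; have [|r' [/andP[r0 r1] [b0 Hb0]]] := sup_adherent _ supA (eps := x - r).
    by rewrite subr_gt0.
  rewrite -/x subKr => rr'.
  apply: (level_le c (M := B * M0)); first by rewrite le_max lexx orbT.
  apply: (level_fwd c aq qr (b0 := b0)) => //; first by rewrite (le_trans (ltW rr')) // (le_trans r1).
  by move=> q /andP[u0 u1]; apply: Hb0; rewrite u0 (le_trans u1 (ltW rr')).
have Qx : Q x M1.
  move: qx; rewrite le_eqVlt => /orP[/eqP <- //|qx].
  apply: (level_closed c axb) => e e0; pose r := Num.max q0 (x - e / 2).
  have rx : r < x by rewrite gt_max qx /= ltrBlDr ltrDl divr_gt0.
  have qr : q0 <= r by rewrite le_max lexx.
  exists r; split; [|rewrite gtr0_norm ?subr_gt0 //|exact: Qr].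
    by rewrite (le_trans aq qr) (le_trans (ltW rx)) // (le_trans xt).
  have : x - e / 2 <= r by rewrite le_max lexx orbT.
  lra.
have good : forall q, q0 <= q <= x -> Q q M1.
  move=> q /andP[u]; rewrite le_eqVlt => /orP[/eqP -> //|]; exact: Qr.
have nQx : ~ Q x n.
  move=> H; apply: nQ; apply: (level_bwd c aq qx _ good H).
  by case/andP: axb.
have [e e0 He] : exists2 e, 0 < e & forall q, a <= q <= b -> `|x - q| < e -> ~ Q q n.
  apply: contrapT => H; apply: nQx; apply: (level_closed c axb) => e e0.
  apply: contrapT => H2; apply: H; exists e => // q hq xq Qq; apply: H2; exists q; split => //.
have xlt : x < t.
  rewrite lt_neqAle xt andbT; apply/eqP => E; apply: bad; exists M1.
  by rewrite -E.
pose t' := Num.min t (x + e / 2).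
have xt' : x < t' by rewrite lt_min xlt ltrDl divr_gt0.
have t't : t' <= t by rewrite ge_min lexx.
have t'e : t' <= x + e / 2 by rewrite ge_min lexx orbT.
exists x, t'; split => //; first exact: ltW.
  move=> [M2 H2]; have : t' <= x.
    apply: sup_upper_bound => //; split; first by rewrite t't (le_trans qx (ltW xt')).
    exists (Num.max M1 M2) => q /andP[u0 u1]; have [u2|u2] := leP q x.
      by apply: level_le c _ _ _ _ (good q _); rewrite ?u0 // le_max lexx.
    by apply: level_le c _ _ _ _ (H2 q _); rewrite ?(ltW u2) // le_max lexx orbT.
  by rewrite leNgt xt'.
move=> q /andP[u0 u1]; apply: He.
  by case/andP: axb => v0 v1; rewrite (le_trans v0 u0) (le_trans u1) // (le_trans t't).
by rewrite ler0_norm ?subr_le0 //; lra.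
Qed.

(** Some [q0] exceeds the level [B * n], since otherwise this level would be a bound. [f] is
    unbounded on one side of [q0]; the left side is treated by reflection. *)
Lemma unbounded_step Q a b B n s t : comparable_level Q a b B ->
  a <= s -> s <= t -> t <= b -> ~ bounded_level Q s t ->
  exists s' t', [/\ s <= s', s' <= t', t' <= t, ~ bounded_level Q s' t' &
    forall q, s' <= q <= t' -> ~ Q q n].
Proof.
move=> c as_ st tb bad.
have [q0 /andP[sq qt] nQ] : exists2 q, s <= q <= t & ~ Q q (B * n).
  apply: contrapT => H; apply: bad; exists (B * n) => q hq.
  by apply: contrapT => H2; apply: H; exists q.
have [bR|bR] := pselect (bounded_level Q q0 t); last first.
  have [s' [t' [h1 h2 h3 h4 h5]]] :=
    unbounded_step_right c (le_trans as_ sq) qt tb bR nQ.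
  by exists s', t'; split => //; exact: le_trans h1.
have bL : ~ bounded_level (fun q => Q (- q)) (- q0) (- s).
  move=> [M1 H1]; apply: bad; have [M2 H2] := bR.
  exists (Num.max M1 M2) => q /andP[u0 u1]; have [u2|u2] := leP q q0.
    apply: level_le c _ _ _ _ _; last by rewrite -[q]opprK; apply: H1; rewrite !lerN2 u0 u2.
    by rewrite le_max lexx.
  apply: level_le c _ _ _ _ (H2 q _); last by rewrite u1 ltW.
  by rewrite le_max lexx orbT.
have nQ' : ~ Q (- - q0) (B * n) by rewrite opprK.
have c' := comparable_level_opp c.
have [||| s' [t' [h1 h2 h3 h4 h5]]] := unbounded_step_right c' _ _ _ bL nQ'.
- by rewrite lerN2 (le_trans qt tb).
- by rewrite lerN2.
- by rewrite lerN2.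
exists (- t'), (- s'); split; [lra|lra|lra| |].
  move=> [M H]; apply: h4; exists M => q /andP[u0 u1]; apply: H; apply/andP; split; lra.
move=> q /andP[u0 u1]; rewrite -[q]opprK; apply: h5; apply/andP; split; lra.
Qed.

(* Baire-type argument: nested intervals on which [f] is unbounded and [f > n]. *)
Lemma comparable_level_bounded Q a b B : a <= b -> comparable_level Q a b B ->
  bounded_level Q a b.
Proof.
move=> ab c; apply: contrapT => bad.
pose inv (p : R * R) := [/\ a <= p.1, p.1 <= p.2, p.2 <= b & ~ bounded_level Q p.1 p.2].
have step (x : nat * (R * R)) : exists p' : R * R, inv x.2 ->
    [/\ inv p', x.2.1 <= p'.1, p'.2 <= x.2.2 & forall q, p'.1 <= q <= p'.2 -> ~ Q q x.1%:R].
  have [[h1 h2 h3 h4]|ni] := pselect (inv x.2); last by exists x.2 => /ni.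
  have [s' [t' [k1 k2 k3 k4 k5]]] := unbounded_step x.1%:R c h1 h2 h3 h4.
  exists (s', t') => _; split => //=; split => //=; [exact: le_trans k1|exact: le_trans k3 _].
have [F HF] := choice step.
(* [f] exceeds [n] on the interval of index [n + 1], so a point common to all the intervals would
   have no finite level. *)
pose u := fix u n := if n is m.+1 then F (m, u m) else (a, b).
have iu n : inv (u n).
  by elim: n => [|n ih] /=; [split|case: (HF (n, u n) ih)].
have u1 n : (u n).1 <= (u n.+1).1 by case: (HF (n, u n) (iu n)).
have u2 n : (u n.+1).2 <= (u n).2 by case: (HF (n, u n) (iu n)).
have u3 n q : (u n.+1).1 <= q <= (u n.+1).2 -> ~ Q q n%:R.
  by case: (HF (n, u n) (iu n)) => _ _ _; apply.
have m1 n m : (n <= m)%N -> (u n).1 <= (u m).1.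
  by move=> /subnK <-; elim: (m - n)%N => // k ih; apply: le_trans ih (u1 _).
have m2 n m : (n <= m)%N -> (u m).2 <= (u n).2.
  by move=> /subnK <-; elim: (m - n)%N => // k ih; apply: le_trans (u2 _) ih.
have m12 n m : (u n).1 <= (u m).2.
  have [_ h _ _] := iu (maxn n m).
  apply: le_trans (m1 _ _ (leq_maxl n m)) _; apply: le_trans h (m2 _ _ (leq_maxr n m)).
pose x := sup (range (fun n => (u n).1)).
have hs : has_sup (range (fun n => (u n).1)).
  by split; [exists (u 0).1, 0|exists b => _ [n _ <-]; exact: (m12 n 0)].
have x1 n : (u n).1 <= x by apply: sup_upper_bound => //; exists n.
have x2 n : x <= (u n).2.
  by apply: ge_sup; [case: hs|move=> _ [m _ <-]; exact: m12].
have [M QM] : exists M, Q x M by apply: (level_finite c); rewrite (x1 0) (x2 0).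
apply: (u3 (Num.truncn M).+1 x); first by rewrite x1 x2.
by apply: level_le c _ _ _ _ QM; apply: ltW; exact: truncnS_gt.
Qed.

End LocalBoundedness.

(** * From the entropy inequality to the weak form *)

Section TimeCutoff.
Context {R : realType}.
Local Notation mu := (@lebesgue_measure R).

Lemma box_cst (h : R -> R) (C k c x : R) : measurable_fun setT h -> (forall z, `|h z| <= C) ->
  0 < k -> (forall z, x <= z <= x + k -> h z = c) -> box k h x = c.
Proof.
move=> mh hC k0 hc; have xk : x <= x + k by rewrite lerDl ltW.
rewrite /box (prim_sub mh hC xk).
rewrite (@eq_Rintegral _ _ _ mu _ (cst c)); last first.
  by move=> z; rewrite inE /= in_itv /= => /hc.
rewrite Rintegral_cst //= lebesgue_measure_itv /= lte_fin ltrDl k0.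
by rewrite -EFinB /= addrAC subrr add0r mulrCA mulVf ?mulr1 // gt_eqF.
Qed.

(* The cutoff is the average over [t, t + k] of a piecewise linear one. *)
Lemma time_cutoff (r k : R) : 0 < k -> exists th dth : R -> R,
  [/\ forall t, is_derive t (1 : R) th (dth t) /\ 0 <= th t <= 1,
      continuous dth,
      forall t, (t <= r -> th t = 1) /\ (r + 3 * k <= t -> th t = 0) &
      forall t, dth t <= 0 /\ (~ (r <= t <= r + 3 * k) -> dth t = 0)].
Proof.
(* [g] falls from 1 to 0 on [r + 2k, r + 3k]; averaging over [t, t + k] looks ahead by [k] and so
   keeps the value 1 up to [r]. *)
move=> k0; pose g (t : R) : R := Num.max 0 (Num.min 1 (k^-1 * (r + 3 * k - t))).
have ki0 : 0 < k^-1 by rewrite invr_gt0.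
have g01 t : 0 <= g t <= 1.
  by rewrite le_max lexx /= ge_max ler01 ge_min lexx.
have gn s t : s <= t -> g t <= g s.
  move=> st; rewrite /g ge_max le_max lexx /= le_max; apply/orP; right.
  rewrite le_min ge_min lexx /= ge_min; apply/orP; right.
  by rewrite ler_pM2l // lerD2l lerN2.
have g1 t : t <= r + 2 * k -> g t = 1.
  move=> h; rewrite /g min_l; first by rewrite max_r.
  by rewrite mulrC ler_pdivlMr // mul1r; lra.
have g0 t : r + 3 * k <= t -> g t = 0.
  move=> h; rewrite /g max_l // ge_min; apply/orP; right.
  by rewrite pmulr_rle0 // subr_le0.
have gL s t : s <= t -> g s - g t <= k^-1 * (t - s).
  move=> st; have x0 : 0 <= k^-1 * (t - s) by rewrite mulr_ge0 ?subr_ge0 // ltW.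
  have e : k^-1 * (r + 3 * k - s) = k^-1 * (r + 3 * k - t) + k^-1 * (t - s) by ring.
  rewrite /g e; move: (k^-1 * _) (k^-1 * _) x0 => a x x0.
  by rewrite /Num.max /Num.min; do !case: ifPn; rewrite -?leNgt => *; lra.
have gl s t : `|g s - g t| <= k^-1 * `|s - t|.
  have [st|ts] := leP s t.
    rewrite (ler0_norm (_ : s - t <= 0)) ?subr_le0 // opprB ger0_norm ?subr_ge0; first exact: gL.
    exact: gn.
  rewrite (gtr0_norm (_ : 0 < s - t)) ?subr_gt0 // -[g s - g t]opprB normrN.
  rewrite ger0_norm ?subr_ge0; [apply: gL; exact: ltW|apply: gn; exact: ltW].
have cg := lip_continuous gl.
have mg : measurable_fun setT g by exact: continuous_measurable_fun.
have gb t : `|g t| <= 1 by case/andP: (g01 t) => a b; rewrite ger0_norm.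
exists (box k g), (fun t => k^-1 * (g (t + k) - g t)); split.
- move=> t; split; first exact: is_derive_box mg gb _ cg.
  by apply/andP; split; [apply: (box_ge mg gb)|apply: (box_le mg gb)] => // z; case/andP: (g01 z).
- have cg' : continuous (fun t => k^-1 * (g (t + k) - g t)).
    apply: (@lip_continuous _ _ (k^-1 * (k^-1 * 2))) => s t.
    rewrite -mulrBr normrM (gtr0_norm ki0) -mulrA ler_pM2l //.
    rewrite (_ : _ - _ = (g (s + k) - g (t + k)) - (g s - g t)); last by ring.
    apply: le_trans (ler_normB _ _) _.
    have := gl (s + k) (t + k); have := gl s t.
    by rewrite (_ : s + k - (t + k) = s - t); [lra|ring].
  exact: cg'.
- move=> t; split => h; apply: (box_cst mg gb k0) => z /andP[z0 z1].
    by apply: g1; lra.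
  by apply: g0; lra.
- move=> t; split; first by rewrite pmulr_rle0 // subr_le0; apply: gn; rewrite lerDl ltW.
  have [h1|h1] := leP r t; have [h2|h2] := leP t (r + 3 * k) => // _.
  + by rewrite !g0 ?subrr ?mulr0; lra.
  + by rewrite !g1 ?subrr ?mulr0; lra.
  + by rewrite !g1 ?subrr ?mulr0; lra.
Qed.

Variables (T m0 Nn Nm : R) (m n : R -> R).
Hypothesis mc : {within `[0, T], continuous m}.
Hypothesis mb : forall t : R, t \in `[0, T[ -> `|m t| <= Nm.
Hypothesis nm : measurable_fun `[0, T[ n.
Hypothesis nb : forall t : R, t \in `[0, T[ -> `|n t| <= Nn.
Hypothesis identity : forall (th dth : R -> R) (r : R), (forall t : R, is_derive t (1 : R) th (dth t)) ->
  continuous dth -> (forall t, 0 <= th t) -> r < T -> (forall t, r <= t -> th t = 0) ->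
  \int[mu]_(t in `[0, T[) (dth t * m t + th t * n t) + th 0 * m0 = 0.

Let cut (f : R -> R) t := \1_(`[0, T[%classic : set R) t * f t.

Lemma cut_measurable f : measurable_fun `[0, T[ f -> measurable_fun setT (cut f).
Proof.
move=> mf; have -> : cut f = f \_ `[0, T[.
  by apply/funext => t; rewrite /cut patchE indicE; case: ifP => _; rewrite ?mul1r ?mul0r.
by apply/(measurable_restrictT f).
Qed.

Lemma cut_bound f (b : R) : (forall t : R, t \in `[0, T[ -> `|f t| <= b) -> 0 <= b ->
  forall t, `|cut f t| <= b.
Proof.
move=> fb b0 t; rewrite /cut indicE; case: (boolP (t \in _)) => h.
  by rewrite mul1r; apply: fb; move: h; rewrite inE.
by rewrite mul0r normr0.
Qed.

Lemma cut_in f (t : R) : t \in `[0, T[ -> cut f t = f t.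
Proof. by move=> h; rewrite /cut indicE mem_set // mul1r. Qed.

Lemma cut_out f (t : R) : t < 0 -> cut f t = 0.
Proof.
by move=> h; rewrite /cut indicE memNset ?mul0r //= in_itv /= leNgt h.
Qed.

(** [identity] is the distributional form of [m' = n], [m 0 = m0]. With a cutoff dropping from 1 to
    0 just after [r], [- dth] is an approximate identity at [r] and [th] tends to the indicator of
    [0, r]. Since [n] may jump between noise steps, the limit rests on its bound rather than on
    continuity. *)
Lemma weak_derivative r : 0 <= r -> r < T -> m r = m0 + prim (cut n) r.
Proof.
move=> r0 rT; have rI : r \in `[0, T[ by rewrite in_itv /= r0.
have Nn0 : 0 <= Nn by apply: le_trans (nb rI).
have Nm0 : 0 <= Nm by apply: le_trans (mb rI).
have mm : measurable_fun `[0, T[ m.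
  apply: (@measurable_funS _ _ _ _ `[0, T]) => //; last exact: subspace_continuous_measurable_fun.
  by apply: subset_itvl; rewrite bnd_simp.
have mnT := cut_measurable nm; have mmT := cut_measurable mm.
have bnT := cut_bound nb Nn0; have bmT := cut_bound mb Nm0.
suff H e : 0 < e -> `|m r - m0 - prim (cut n) r| <= e.
  apply/eqP; rewrite -subr_eq0 opprD addrA -normr_le0.
  by apply/ler_addgt0Pr => e e0; rewrite add0r; exact: H.
move=> e0.
have e20 : 0 < e / 2 by rewrite divr_gt0.
have [d d0 Hd] : exists2 d, 0 < d & forall t, 0 <= t <= T -> `|r - t| < d -> `|m r - m t| <= e / 2.
  have /subspace_continuousP/(_ r) := mc; rewrite /= in_itv /= r0 (ltW rT) => /(_ isT).
  move=> /cvgrPdist_le/(_ _ e20); rewrite near_withinE => /nbhs_ballP [d /= d0 Hd].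
  by exists d => // t ht rt; apply: Hd => //; rewrite /= in_itv.
(* The three terms keep [r, r + 3k] inside the continuity window of [m], keep it below [T], and make
   the integral of [n] over it at most [e / 2]. *)
pose k := Num.min (Num.min (d / 4) ((T - r) / 4)) (e / 2 / (3 * Nn + 1)).
have N1 : 0 < 3 * Nn + 1 by rewrite ltr_wpDl // mulr_ge0.
have k0 : 0 < k by rewrite !lt_min !divr_gt0 // subr_gt0.
have kd : k <= d / 4 by rewrite !ge_min lexx.
have kT : k <= (T - r) / 4 by rewrite !ge_min lexx orbT.
have kN : 3 * k * Nn <= e / 2.
  have : k * (3 * Nn + 1) <= e / 2 by rewrite -ler_pdivlMr // ge_min lexx orbT.
  by move: k k0 {kd kT} => y y0; lra.
have [th [dth [H1 cdth H3 H4]]] := time_cutoff r k0.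
have dth1 t : is_derive t (1 : R) th (dth t) by case: (H1 t).
have rk : r + 3 * k < T by move: k k0 kT {kd kN H3 H4} => y *; lra.
have th01 t : 0 <= th t <= 1 by case: (H1 t).
have th0 t : 0 <= th t by case/andP: (th01 t).
have ID := identity dth1 cdth th0 rk (fun t => (H3 t).2).
have th00 : th 0 = 1 by case: (H3 0) => ->.
rewrite th00 mul1r int_indicM in ID.
have mdth : measurable_fun setT dth := continuous_measurable_fun cdth.
have mth : measurable_fun setT th.
  apply: continuous_measurable_fun => t; apply/differentiable_continuous/derivable1_diffP.
  by case: (dth1 t).
pose I := \1_(`[r, r + 3 * k]%classic : set R) : R -> R.
have dthI t : I t * dth t = dth t.
  rewrite /I indicE; case: (boolP (t \in _)) => h; first by rewrite mul1r.
  rewrite mul0r; case: (H4 t) => _ -> //; move: h; rewrite notin_setE /= in_itv.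
  by move=> h1 h2; apply: h1.
have rk3 : r <= r + 3 * k by rewrite lerDl mulr_ge0 // ltW.
have [D dthD] : exists D, forall t, `|dth t| <= D.
  have [|c _ Hc] := @EVT_max _ (fun t => `|dth t|) r (r + 3 * k) rk3.
    apply: continuous_subspaceT => t; apply: (continuous_comp (cdth t)).
    exact: norm_continuous.
  exists `|dth c| => t; case: (boolP ((r <= t) && (t <= r + 3 * k))) => h.
    by apply: Hc; rewrite in_itv.
  by case: (H4 t) => _ -> //; [rewrite normr0|exact/negP].
have D0 : 0 <= D by apply: le_trans (dthD 0).
have idth : in_L1 dth.
  by rewrite (_ : dth = fun t => I t * dth t); [exact: in_L1_indic_bounded mdth dthD|apply/funext].
(* Total mass -1: the weight [- dth] averages [m] over [r, r + 3k]. *)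
have intdth : \int[mu]_t dth t = -1.
  have -> : \int[mu]_t dth t = \int[mu]_t (I t * dth t) by apply: eq_int.
  rewrite -int_indicM -(prim_sub mdth dthD rk3).
  have cst x y : prim dth x - th x = prim dth y - th y.
    apply: (@is_derive_0_is_cst _ (fun x => prim dth x - th x)) => z.
    rewrite -(subrr (dth z)); apply: is_deriveB; apply: (is_derive_prim mdth dthD); exact: cdth.
  have := cst (r + 3 * k) r; have [_ ->] := H3 (r + 3 * k) => //; have [-> // _] := H3 r.
  by lra.
have i1 : in_L1 (fun t => dth t * cut m t) by exact: in_L1Mr idth mmT bmT.
have i2 : in_L1 (fun t => th t * cut n t).
  rewrite (_ : (fun t => _) = (fun t => (\1_(`[0, T]%classic : set R) t : R) * (th t * cut n t))).
    apply: (@in_L1_indic_bounded _ _ Nn); first exact: measurable_funM.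
    move=> z; rewrite normrM -[leRHS]mul1r; apply: ler_pM => //.
    by rewrite ger0_norm //; case/andP: (th01 z).
  apply/funext => t; rewrite {2}/cut /cut !indicE.
  case: (boolP (t \in `[0, T[%classic)) => h; last by rewrite !(mul0r, mulr0).
  rewrite mem_set ?mul1r //; move: h; rewrite inE /= !in_itv /= => /andP[-> /ltW ->] //.
have E1 : \int[mu]_x (\1_(`[0, T[%classic : set R) x * (dth x * m x + th x * n x)) =
    \int[mu]_x (dth x * cut m x) + \int[mu]_x (th x * cut n x).
  by rewrite -intD //; apply: eq_int => x; rewrite /cut; ring.
rewrite E1 in ID.
have A1 : `|\int[mu]_x (dth x * cut m x) + m r| <= e / 2.
  have -> : \int[mu]_x (dth x * cut m x) + m r = \int[mu]_x (dth x * cut m x - m r * dth x).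
    by rewrite intB // ?intZl // ?intdth; [ring|exact: in_L1Zl].
  have -> : e / 2 = \int[mu]_x (- (e / 2) * dth x) by rewrite intZl // intdth; ring.
  apply: ler_int_bound; first by apply: in_L1_measurable; apply: in_L1B => //; exact: in_L1Zl.
    exact: in_L1Zl.
  move=> t; rewrite (_ : _ - _ = dth t * (cut m t - m r)); last by ring.
  have [dle dz] := H4 t; rewrite normrM ler0_norm // (mulrC (- dth t)) mulNr -mulrN.
  case: (boolP ((r <= t) && (t <= r + 3 * k))) => [/andP[t0 t1]|/negP/dz ->]; last by rewrite oppr0 !mulr0.
  apply: ler_wpM2r; first by rewrite oppr_ge0.
  have tT : t < T by exact: le_lt_trans t1 rk.
  have t00 : 0 <= t by exact: le_trans t0.
  rewrite cut_in ?in_itv /= ?t00 // -[_ - _]opprB normrN; apply: Hd; first by rewrite t00 ltW.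
  rewrite ler0_norm ?subr_le0 // opprB; move: kd t1; generalize k => y; lra.
have A2 : `|\int[mu]_x (th x * cut n x) - prim (cut n) r| <= e / 2.
  have -> : prim (cut n) r = \int[mu]_t ((\1_(`[0, r]%classic : set R) t : R) * cut n t).
    by rewrite -int_indicM -(prim_sub mnT bnT r0) /prim subrr subr0.
  have ir := in_L1_indic_bounded 0 r mnT bnT.
  rewrite -intB //; apply: le_trans kN.
  have -> : 3 * k * Nn = \int[mu]_t (Nn * I t).
    rewrite intZl; last exact: in_L1_indic.
    by rewrite int_indic // addrAC subrr add0r mulrC.
  apply: ler_int_bound; first by apply: in_L1_measurable; exact: in_L1B.
    by apply: in_L1Zl; exact: in_L1_indic.
  move=> t; rewrite -mulrBl normrM mulrC.
  have I0 : 0 <= I t by rewrite /I indicE.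
  have [t0|t0] := ltP t 0; first by rewrite cut_out // normr0 mul0r mulr_ge0.
  apply: ler_pM => //; rewrite indicE.
  have [tr|tr] := leP t r.
    rewrite mem_set /= ?in_itv /= ?t0 //.
    by have [-> // _] := H3 t; rewrite subrr normr0.
  have -> : (t \in `[0, r]%classic) = false by rewrite memNset //= in_itv /= t0 leNgt tr.
  rewrite subr0 ger0_norm //.
  have [tk|tk] := leP t (r + 3 * k).
    by rewrite /I indicE mem_set /= ?in_itv /= ?(ltW tr) //; case/andP: (th01 t).
  by have [_ th_0] := H3 t; rewrite th_0 // ltW.
move: ID A1 A2; move: (\int[mu]_x _) (\int[mu]_x _) (prim _ _) (m r) => a b c u.
rewrite !ler_norml => ID /andP[h1 h2] /andP[h3 h4]; apply/andP; split; lra.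
Qed.

End TimeCutoff.

(** * Relative derivatives and tensor-product test functions *)

Section DeriveWithin.
Context {R : realType}.
Local Notation mu := (@lebesgue_measure R).

Lemma limit_point_proper (A : set R) (x : R) :
  (forall e, 0 < e -> exists y, [/\ A y, y != x & `|x - y| < e]) ->
  ProperFilter (within A x^').
Proof.
move=> H; split; last exact: within_filter.
rewrite /within /= => /nbhs_ballP [e /= e0 He].
have [y [Ay yx xy]] := H e e0; exact: (He y xy yx Ay).
Qed.

Lemma cvg_quotient_within (A : set R) (f : R -> R) (x l : R) :
  is_derive x (1 : R) f l -> quotient_within A f x --> l.
Proof.
move=> [df <-]; apply: cvg_trans (_ : (f y - f x) / (y - x) @[y --> x^'] --> _).
  by apply: cvg_app; exact: cvg_within.
have : h^-1 *: ((f \o shift x) (h *: 1) - f x) @[h --> (0:R)^'] --> 'D_1 f x by exact: df.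
move=> /cvgrPdist_le H; apply/cvgrPdist_le => e e0.
have /nbhs_ballP [d /= d0 Hd] := H e e0; apply/nbhs_ballP; exists d => // y xy yx /=.
have := Hd (y - x) _ _; rewrite /= [_ *: 1]mulr1 subrK [_ *: _]mulrC; apply.
  by rewrite /ball /= sub0r opprB.
by rewrite subr_eq0.
Qed.

Lemma derive_within_eq (A : set R) (f : R -> R) (x l : R) :
  ProperFilter (within A x^') -> quotient_within A f x --> l -> derive_within A f x = l.
Proof. by move=> pF H; apply/cvg_lim. Qed.

(** Makes the punctured relative filter proper, so that the limit in [derive_within] is unique; at
    an end point the approximating points come from one side. *)
Lemma itv_limit_point (b : bool) (s t x : R) : s < t -> x \in Interval (BLeft s) (BSide b t) ->
  ProperFilter (within [set` Interval (BLeft s) (BSide b t)] x^').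
Proof.
move=> st hx; apply: limit_point_proper => e e0.
have sx : s <= x by move: hx; rewrite in_itv /= => /andP[].
have xt : x <= t by move: hx; rewrite in_itv /=; case: b => /= /andP[_] //; exact: ltW.
have [xt'|xt'] := ltP x t.
  exists (Num.min (x + e / 2) ((x + t) / 2)); set y := Num.min _ _.
  have y1 : y <= x + e / 2 by rewrite ge_min lexx.
  have y2 : y <= (x + t) / 2 by rewrite ge_min lexx orbT.
  have y3 : x < y by rewrite lt_min; apply/andP; split; lra.
  split; [|by rewrite gt_eqF|by rewrite ltr0_norm ?subr_lt0 //; lra].
  by rewrite /= in_itv /=; case: (b) => /=; apply/andP; split; lra.
have -> : x = t by apply/eqP; rewrite eq_le xt.
exists (Num.max (t - e / 2) ((s + t) / 2)); set y := Num.max _ _.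
have y1 : t - e / 2 <= y by rewrite le_max lexx.
have y2 : (s + t) / 2 <= y by rewrite le_max lexx orbT.
have y3 : y < t by rewrite gt_max; apply/andP; split; lra.
split; [|by rewrite lt_eqF|by rewrite gtr0_norm ?subr_gt0 //; lra].
by rewrite /= in_itv /=; case: (b) => /=; apply/andP; split; lra.
Qed.

Lemma int_is_derive (F f : R -> R) (a b : R) : a <= b ->
  (forall x, is_derive x (1 : R) F (f x)) -> continuous f ->
  \int[mu]_(x in `[a, b]) f x = F b - F a.
Proof.
rewrite le_eqVlt => /orP[/eqP <- *|ab dF cf]; first by rewrite set_itv1 Rintegral_set1 subrr.
rewrite /Rintegral (@continuous_FTC2 _ f F) //; last first.
- by move=> x _; rewrite derive1E; case: (dF x).
- have cF : continuous F.
    by move=> x; apply/differentiable_continuous/derivable1_diffP; case: (dF x).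
  split; first by move=> x _; case: (dF x).
  + by apply: cvg_at_right_filter; exact: cF.
  + by apply: cvg_at_left_filter; exact: cF.
- exact: continuous_subspaceT.
Qed.

(** [th] vanishes from some [r < T] on, which keeps the support compact in the half-open strip while
    [th 0] remains free. *)
Lemma product_test_function (T r L1 L2 Rr : R) (th dth psi dpsi : R -> R) : 0 < T -> r < T ->
  (forall t, is_derive t (1 : R) th (dth t)) -> continuous dth -> (forall t, 0 <= th t) ->
  (forall t, r <= t -> th t = 0) -> test_fun L1 L2 Rr psi dpsi ->
  [/\ test_function T (fun t x => th t * psi x),
      forall t x, t \in `[0, T[ -> dt T (fun t x => th t * psi x) t x = dth t * psi x &
      forall t x, dx (fun t x => th t * psi x) t x = th t * dpsi x].
Proof.
move=> T0 rT dt_ cdth th0 thr tp.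
have cth : continuous th.
  by move=> t; apply/differentiable_continuous/derivable1_diffP; case: (dt_ t).
have cpsi := test_continuous tp; have cdpsi := test_dcontinuous tp.
have D1 x t : is_derive t (1 : R) (fun t => th t * psi x) (dth t * psi x).
  apply: (is_derive_eq (is_deriveM (dt_ t) (is_derive_cst (psi x) t 1))).
  by rewrite scaler0 add0r; exact: mulrC.
have D2 t x : is_derive x (1 : R) (fun x => th t * psi x) (th t * dpsi x).
  exact: is_deriveZ (test_der tp x).
have E1 t x : t \in `[0, T[ -> dt T (fun t x => th t * psi x) t x = dth t * psi x.
  move=> ht; apply: derive_within_eq; first exact: itv_limit_point.
  exact: cvg_quotient_within.
have E2 t x : dx (fun t x => th t * psi x) t x = th t * dpsi x.
  by rewrite /dx derive1E; case: (D2 t x).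
have cM (f g : R -> R) : continuous f -> continuous g ->
    continuous (fun p : R * R => f p.1 * g p.2).
  move=> cf cg p; apply: cvgM.
    by apply: (@cvg_comp _ _ _ fst f); [exact: cvg_fst|exact: cf].
  by apply: (@cvg_comp _ _ _ snd g); [exact: cvg_snd|exact: cg].
split => //; split.
- move=> t x ht; split; last by case: (D2 t x).
  by apply/cvg_ex; exists (dth t * psi x); exact: cvg_quotient_within.
- by apply: continuous_subspaceT; exact: cM.
- split; last first.
    by under eq_fun do rewrite E2; apply: continuous_subspaceT; exact: cM.
  apply: (@subspace_eq_continuous _ _ _ (fun p : R * R => dth p.1 * psi p.2)).
    by move=> p; rewrite inE => hp; rewrite [RHS]E1 // in_itv.
  by apply: continuous_subspaceT; exact: cM.
- by move=> t x _; rewrite mulr_ge0 //; case/andP: (test_01 tp x).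
- exists (`[0, r] `*` `[- `|Rr|, `|Rr|]); split.
  + by apply: compact_setX; exact: segment_compact.
  + move=> [t x] /= [/= + _]; rewrite in_itv /= /strip /= => /andP[-> tr].
    exact: le_lt_trans rT.
  + move=> [t x] /= /andP[t0 tT] nK; have [tr|/ltW/thr ->] := leP t r; last by rewrite mul0r.
    rewrite (test_supp tp) ?mulr0 // leNgt; apply/negP => xR; apply: nK; split => /=.
      by rewrite in_itv /= t0.
    by rewrite in_itv /= -ler_norml ltW // (lt_le_trans xR) // ler_norm.
Qed.

End DeriveWithin.

(** * The weak form on each noise step *)

Section WeakForm.
Context {R : realType}.
Local Notation mu := (@lebesgue_measure R).
Variables (Wk : R -> R) (eta rmax : R) (v eps : R -> R) (T : R).
Variables (We : R) (alpha : R -> R).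
Hypothesis ma : mixture eta We alpha.
Local Notation cv := (conv eta We alpha).
Local Notation W0 := (mass eta We alpha).
Hypotheses (T0 : 0 < T) (rmax0 : 0 <= rmax).

Variables (delta : R) (h : nat -> R -> R) (N C : R).
Hypotheses (delta0 : 0 < delta) (N0 : 0 <= N).
Hypothesis hN : forall k a b, `|h k a - h k b| <= N * `|a - b|.
Hypothesis hC : forall k a, `|h k a| <= C.

Definition in_piece (k : nat) (t : R) := k%:R * delta <= t < k.+1%:R * delta.

Lemma in_piece_truncn t : 0 <= t -> in_piece (Num.truncn (t / delta)) t.
Proof.
move=> t0; have /truncn_itv/andP[a b] : 0 <= t / delta by rewrite divr_ge0 // ltW.
by rewrite /in_piece -ler_pdivlMr // a -ltr_pdivrMr.
Qed.

Lemma truncn_in_piece k t : in_piece k t -> Num.truncn (t / delta) = k.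
Proof.
move=> /andP[a b]; apply/eqP; rewrite truncn_eq; last first.
  by rewrite divr_ge0 ?(ltW delta0) // (le_trans _ a) // mulr_ge0 // ltW.
by rewrite ler_pdivlMr // a ltr_pdivrMr.
Qed.

Variables (rho : R -> R -> R) (rho0 : R -> R).
Hypothesis rL1 : forall t, 0 <= t <= T -> in_L1 (rho t).
Hypothesis rI : forall t x, 0 <= t <= T -> 0 <= rho t x <= rmax.
Hypothesis rC : forall p e, 0 <= p <= T -> 0 < e -> exists2 d, 0 < d &
  forall q, 0 <= q <= T -> `|p - q| < d -> n1 (fun x => rho p x - rho q x) <= e.
Hypothesis r0L1 : in_L1 rho0.
Hypothesis r0I : forall x, 0 <= rho0 x <= rmax.
Hypothesis Vconv : forall t k x, 0 <= t <= T -> in_piece k t ->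
  V_eps Wk eta v eps rho t x = cv (fun y => h k (rho t y)) x.
Hypothesis ent : entropy_inequality Wk eta v eps T rho rho0.

Let g t y := h (Num.truncn (t / delta)) (rho t y).

Let mg t : 0 <= t <= T -> measurable_fun setT (g t).
Proof. by move=> ht; apply: (measurable_flux (hN _)); exact: rL1. Qed.

Let gC t y : `|g t y| <= C.
Proof. exact: hC. Qed.

Let Vg t x : 0 <= t <= T -> V_eps Wk eta v eps rho t x = cv (g t) x.
Proof. by move=> ht; apply: Vconv => //; apply: in_piece_truncn; case/andP: ht. Qed.

Let B := W0 * (C * eta).

Let Vb t x : 0 <= t <= T -> `|cv (g t) x| <= B.
Proof. by move=> ht; apply: (conv_bound ma (mg ht) (gC t)). Qed.

Let mV t : 0 <= t <= T -> measurable_fun setT (cv (g t)).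
Proof. by move=> ht; apply: (conv_measurable ma (mg ht) (gC t)). Qed.

Let rb t x : 0 <= t <= T -> `|rho t x| <= rmax.
Proof. by move=> /rI -/(_ x)/andP[a b]; rewrite ger0_norm. Qed.

Section OneTest.
Variables (L1 L2 Rr : R) (psi dpsi : R -> R).
Hypothesis tp : test_fun L1 L2 Rr psi dpsi.

Let m t := \int[mu]_x (rho t x * psi x).
Let n t := \int[mu]_x (rho t x * cv (g t) x * dpsi x).
Let m0 := \int[mu]_x (rho0 x * psi x).

Let ipsi : in_L1 psi := test_in_L1 tp.
Let idpsi : in_L1 dpsi := test_din_L1 tp.
Let mpsi : measurable_fun setT psi := test_measurable tp.
Let mdpsi : measurable_fun setT dpsi := test_dmeasurable tp.

Let im t : 0 <= t <= T -> in_L1 (fun x => rho t x * psi x).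
Proof. by move=> ht; apply: in_L1Mr (rL1 ht) mpsi (test_norm1 tp). Qed.

Let iV t : 0 <= t <= T -> in_L1 (fun x => rho t x * cv (g t) x).
Proof. by move=> ht; apply: in_L1Mr (rL1 ht) (mV ht) (fun x => Vb x ht). Qed.

Let i_n t : 0 <= t <= T -> in_L1 (fun x => rho t x * cv (g t) x * dpsi x).
Proof. by move=> ht; apply: in_L1Mr (iV ht) mdpsi (test_dbound tp). Qed.

Let B0 : 0 <= B.
Proof. by apply: le_trans (Vb 0 (t := 0) _); rewrite // lexx ltW. Qed.

Lemma m_bound t : 0 <= t <= T -> `|m t| <= rmax * n1 psi.
Proof.
move=> ht; rewrite /n1 -intZl; last exact: in_L1_norm.
apply: ler_int_bound; first exact: in_L1_measurable (im ht).
  by apply: in_L1Zl; exact: in_L1_norm.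
by move=> x; rewrite normrM; apply: ler_wpM2r => //; exact: rb.
Qed.

Lemma n_bound t : 0 <= t <= T -> `|n t| <= rmax * B * n1 dpsi.
Proof.
move=> ht; rewrite /n1 -intZl; last exact: in_L1_norm.
apply: ler_int_bound; first exact: in_L1_measurable (i_n ht).
  by apply: in_L1Zl; exact: in_L1_norm.
move=> x; rewrite !normrM; apply: ler_wpM2r => //.
by apply: ler_pM => //; [exact: rb|exact: Vb].
Qed.

Lemma m_dist s t : 0 <= s <= T -> 0 <= t <= T -> `|m s - m t| <= n1 (fun x => rho s x - rho t x).
Proof.
move=> hs ht; rewrite -intB; [|exact: im|exact: im].
apply: ler_int_bound; first by apply: in_L1_measurable; apply: in_L1B; exact: im.
  by apply: in_L1_norm; apply: in_L1B; exact: rL1.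
move=> x; rewrite -mulrBl normrM -[leRHS]mulr1; apply: ler_wpM2l => //.
exact: test_norm1 tp x.
Qed.

(** Lipschitz constant of [n] with respect to the L^1 distance: the first term accounts for the
    change of [rho] in front of the velocity, the second for the change of the velocity. *)
Let K := B * L1 + rmax * (W0 * N) * n1 dpsi.

Let K0 : 0 <= K.
Proof.
have L10 := test_L1_ge0 tp; have W00 := mass_ge0 ma.
have nn := n1_ge0 dpsi; rewrite /K; apply: addr_ge0; first exact: mulr_ge0.
by apply: mulr_ge0 nn; apply: mulr_ge0 => //; exact: mulr_ge0.
Qed.

Lemma n_dist k s t : 0 <= s <= T -> 0 <= t <= T -> in_piece k s -> in_piece k t ->
  `|n s - n t| <= K * n1 (fun x => rho s x - rho t x).
Proof.
move=> hs ht ps pt; set D := n1 _.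
have id : in_L1 (fun x => `|rho s x - rho t x|).
  by apply: in_L1_norm; apply: in_L1B; exact: rL1.
have gd x : `|cv (g s) x - cv (g t) x| <= W0 * (N * D).
  rewrite /g (truncn_in_piece ps) (truncn_in_piece pt).
  by apply: (conv_fluxB_le ma (hN k) (hC k)); exact: rL1.
have -> : K * D = \int[mu]_x (B * L1 * `|rho s x - rho t x| + rmax * (W0 * N) * D * `|dpsi x|).
  have id' := in_L1_norm idpsi.
  have E1 : \int[mu]_x `|rho s x - rho t x| = D by [].
  have E2 : \int[mu]_x `|dpsi x| = n1 dpsi by [].
  rewrite intD; [|exact: in_L1Zl|exact: in_L1Zl].
  by rewrite intZl // intZl // E1 E2 /K; ring.
rewrite -intB; [|exact: i_n|exact: i_n].
apply: ler_int_bound; first by apply: in_L1_measurable; apply: in_L1B; exact: i_n.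
  by apply: in_L1D; apply: in_L1Zl => //; exact: in_L1_norm.
move=> x; move: (gd x) (Vb x hs) (rb x ht) (test_dbound tp x).
move: (cv (g s) x) (cv (g t) x) => a b ab aB rt dL.
rewrite (_ : _ - _ = (rho s x - rho t x) * a * dpsi x + rho t x * (a - b) * dpsi x); last by ring.
apply: le_trans (ler_normD _ _) _; rewrite !normrM; apply: lerD.
  rewrite -[B * L1 * _]mulrC mulrA; by apply: ler_pM => //; apply: ler_wpM2l.
apply: ler_wpM2r => //; apply: le_trans (ler_pM _ _ rt ab) _ => //.
by rewrite !mulrA.
Qed.

Lemma m_continuous : {within `[0, T], continuous m}.
Proof.
apply: within_itv_continuous => p e hp e0; have [d d0 H] := rC hp e0.
by exists d => // q hq pq; apply: le_trans (m_dist hp hq) (H q hq pq).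
Qed.

Let TI t : t \in `[0, T[ -> 0 <= t <= T.
Proof. by rewrite in_itv /= => /andP[-> /ltW]. Qed.

Lemma n_near p e k : 0 <= p <= T -> in_piece k p -> 0 < e -> exists2 d, 0 < d &
  forall q, 0 <= q <= T -> in_piece k q -> `|p - q| < d -> `|n p - n q| <= e.
Proof.
move=> hp pp e0; have K1 : 0 < K + 1 by rewrite ltr_wpDl.
have [d d0 H] := rC hp (divr_gt0 e0 K1); exists d => // q hq pq pqd.
apply: le_trans (n_dist hp hq pp pq) _.
have := H q hq pqd; rewrite ler_pdivlMr // mulrDr mulr1 mulrC => h1.
by apply: le_trans h1; rewrite lerDl n1_ge0.
Qed.

(** [n] is continuous relative to each half-open noise step but may jump between steps; the steps
    are countably many. *)
Lemma n_measurable : measurable_fun `[0, T[ n.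
Proof.
have -> : `[0, T[%classic = \bigcup_k (`[0, T[%classic `&` `[k%:R * delta, k.+1%:R * delta[%classic).
  apply/seteqP; split => [t tT|t [k _ []]//].
  exists (Num.truncn (t / delta)) => //; split => //=.
  by rewrite in_itv /=; apply: in_piece_truncn; move: tT; rewrite /= in_itv /= => /andP[].
rewrite measurable_fun_bigcup => [k|k]; last exact: measurableI.
 apply: subspace_continuous_measurable_fun; first exact: measurableI.
apply/subspace_continuousP => p [/= pT pk].
have hp := TI pT; have pp : in_piece k p by move: pk; rewrite in_itv.
apply/cvgrPdist_le => e e0; have [d d0 H] := n_near hp pp e0.
rewrite near_withinE; apply/nbhs_ballP; exists d => //= q pq [/= qT qk].
by apply: H => //; exact: TI.
Qed.

Lemma int_cutoff_derivative (th dth : R -> R) :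
  (forall t : R, is_derive t (1 : R) th (dth t)) -> continuous dth -> th T = 0 ->
  \int[mu]_(t in `[0, T[) dth t = - th 0.
Proof.
move=> dt_ cdth thT; rewrite Rintegral_itv_bndo_bndc.
  by rewrite (int_is_derive (ltW T0) dt_ cdth) thT sub0r.
apply: (@integrableS _ _ _ mu `[0, T]%classic) => //.
apply: continuous_compact_integrable; first exact: segment_compact.
exact: continuous_subspaceT.
Qed.

(** With [c = 0] the entropy inequality says that the left side is nonnegative. With [c = rmax + 1]
    the sign of [rho - c] is -1 everywhere, and the parts multiplied by [c] cancel: in time because
    [th] vanishes at [T], in space by [int_test_dconv]. What remains says that the left side is
    nonpositive. *)
Lemma entropy_identity (th dth : R -> R) (r : R) : (forall t : R, is_derive t (1 : R) th (dth t)) ->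
  continuous dth -> (forall t, 0 <= th t) -> r < T -> (forall t, r <= t -> th t = 0) ->
  \int[mu]_(t in `[0, T[) (dth t * m t + th t * n t) + th 0 * m0 = 0.
Proof.
move=> dt_ cdth th0 rT thr.
have [tf Edt Edx] := product_test_function T0 rT dt_ cdth th0 thr tp.
pose c := rmax + 1; pose Psi := \int[mu]_x psi x.
have inner0 t : t \in `[0, T[ ->
    \int[mu]_(x in setT) (`|rho t x - 0| * dt T (fun t x => th t * psi x) t x
          + Num.sg (rho t x - 0)
            * (f_eps Wk eta v eps rho t x (rho t x) - f_eps Wk eta v eps rho t x 0)
              * dx (fun t x => th t * psi x) t x
          - Num.sg (rho t x - 0)
            * derive1 (fun y => f_eps Wk eta v eps rho t y 0) x * (th t * psi x)) =
    dth t * m t + th t * n t.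
  move=> tT; have ht := TI tT.
  rewrite -intZl ?im // -intZl ?i_n // -intD; [|apply: in_L1Zl; exact: im|apply: in_L1Zl; exact: i_n].
  apply: eq_int => x; rewrite Edt // Edx subr0.
  have -> : (fun y => f_eps Wk eta v eps rho t y 0) = cst 0.
    by apply/funext => y; rewrite /f_eps mul0r.
  rewrite derive1_cst mulr0 mul0r subr0 /f_eps mul0r subr0 Vg // mulrA.
  have /andP[r0 _] := rI x ht; move: (cv (g t) x) => a.
  (* Where [rho] vanishes [Num.sg] is 0, but so is the flux. *)
  move: r0; rewrite le_eqVlt => /orP[/eqP <-|r0]; first by rewrite sgr0 normr0; ring.
  by rewrite gtr0_norm // gtr0_sg //; ring.
have innerc t : t \in `[0, T[ ->
    \int[mu]_(x in setT) (`|rho t x - c| * dt T (fun t x => th t * psi x) t x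
          + Num.sg (rho t x - c)
            * (f_eps Wk eta v eps rho t x (rho t x) - f_eps Wk eta v eps rho t x c)
              * dx (fun t x => th t * psi x) t x
          - Num.sg (rho t x - c)
            * derive1 (fun y => f_eps Wk eta v eps rho t y c) x * (th t * psi x)) =
    (c * Psi) * dth t - (dth t * m t + th t * n t).
  move=> tT; have ht := TI tT.
  have mq := dconv_measurable ma (mg ht) (gC t); have qb := dconv_bound ma (mg ht) (gC t).
  pose q := dconv eta We alpha (g t); pose A := \int[mu]_x (dpsi x * cv (g t) x).
  have iq : in_L1 (fun x => psi x * q x) by exact: in_L1Mr ipsi mq qb.
  have iA : in_L1 (fun x => dpsi x * cv (g t) x) by exact: in_L1Mr idpsi (mV ht) (fun x => Vb x ht).
  have qA : \int[mu]_x (psi x * q x) = - A by exact: int_test_dconv tp (mg ht) (gC t).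
  (* The integrand with the almost everywhere derivative [q] of the velocity in place of [derive1];
     the two agree off the null set [Z]. *)
  pose G x := c * dth t * psi x + - dth t * (rho t x * psi x) + c * th t * (dpsi x * cv (g t) x)
     + - th t * (rho t x * cv (g t) x * dpsi x) + c * th t * (psi x * q x).
  have j1 := in_L1Zl (c * dth t) ipsi; have j2 := in_L1Zl (- dth t) (im ht).
  have j3 := in_L1Zl (c * th t) iA; have j4 := in_L1Zl (- th t) (i_n ht).
  have j5 := in_L1Zl (c * th t) iq.
  have j12 := in_L1D j1 j2; have j123 := in_L1D j12 j3; have j1234 := in_L1D j123 j4.
  have iG : in_L1 G := in_L1D j1234 j5.
  have intG : \int[mu]_x G x = (c * Psi) * dth t - (dth t * m t + th t * n t).
    rewrite (intD j1234 j5) (intD j123 j4) (intD j12 j3) (intD j1 j2) !intZl //; try exact: i_n.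
      by rewrite qA -/A -/Psi -/(m t) -/(n t); ring.
    exact: im.
  (* The derivative is known to the right of a base point; to the left of this one both [psi] and
     [dpsi] vanish. *)
  have [Z [mZ Z0 sZ]] := ae_is_derive_conv ma (mg ht) (gC t) (- `|Rr| - 1).
  rewrite -intG; apply: (Rintegral_eq_off_null (N := Z)) => //.
    exact: in_L1_measurable iG.
  move=> x _ nZ; rewrite Edt // Edx.
  have /andP[_ r1] := rI x ht; have rc : rho t x - c < 0 by rewrite /c; lra.
  rewrite ltr0_norm // ltr0_sg // /f_eps Vg //.
  have -> : (fun y => c * V_eps Wk eta v eps rho t y) = (fun y => c * cv (g t) y).
    by apply/funext => y; rewrite Vg.
  have [xb|xb] := ltP (- `|Rr| - 1) x.
    have dx_ : is_derive x 1 (cv (g t)) (q x).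
      apply: contrapT => nd; apply: nZ; apply: sZ => /= H; exact: nd (H xb).
    have -> : derive1 (fun y => c * cv (g t) y) x = c * q x.
      by rewrite derive1E; case: (is_deriveZ c dx_).
    by rewrite /G; move: (cv (g t) x) (q x) => a b; ring.
  have xR : Rr <= `|x|.
    by have := ler_norm Rr; have := ler_norm (- x); rewrite normrN; lra.
  by rewrite /G (test_supp tp xR) (test_dsupp tp xR); ring.
pose J t := dth t * m t + th t * n t.
have cth : continuous th.
  by move=> t; apply/differentiable_continuous/derivable1_diffP; case: (dt_ t).
have bnd (f : R -> R) : continuous f -> exists D, forall t, 0 <= t <= T -> `|f t| <= D.
  move=> cf; have [|y _ Hy] := @EVT_max _ (fun t => `|f t|) 0 T (ltW T0).
    apply: continuous_subspaceT => t; apply: (continuous_comp (cf t)); exact: norm_continuous.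
  by exists `|f y| => t ht; apply: Hy; rewrite in_itv.
have [D1 HD1] := bnd _ cdth; have [D2 HD2] := bnd _ cth.
have mf (f : R -> R) : continuous f -> measurable_fun `[0, T[ f.
  by move=> cf; apply: measurable_funTS; exact: continuous_measurable_fun.
have mm : measurable_fun `[0, T[ m.
  apply: (@measurable_funS _ _ _ _ `[0, T]) => //.
  apply: subspace_continuous_measurable_fun => //; exact: m_continuous.
have fin : (mu `[0%R, T[ < +oo)%E by rewrite lebesgue_measure_itv /= lte_fin T0 -EFinB ltry.
have iJ : mu.-integrable `[0, T[ (EFin \o J).
  apply: measurable_bounded_integrable => //.
    apply: measurable_funD; apply: measurable_funM => //; try exact: mf.
    exact: n_measurable.
  exists (D1 * (rmax * n1 psi) + D2 * (rmax * B * n1 dpsi)); split; first exact: num_real.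
  move=> M HM t /= /TI ht; apply: le_trans (ltW HM); apply: le_trans (ler_normD _ _) _.
  by rewrite !normrM; apply: lerD; apply: ler_pM => //; [exact: HD1|exact: m_bound|exact: HD2|exact: n_bound].
have idth k : mu.-integrable `[0, T[ (EFin \o (fun t => k * dth t)).
  apply: measurable_bounded_integrable => //.
    by apply: measurable_funM => //; exact: mf.
  exists (`|k| * D1); split; first exact: num_real.
  by move=> M HM t /= /TI ht; apply: le_trans (ltW HM); rewrite normrM; apply: ler_wpM2l => //; exact: HD1.
have ih0 : 0 <= \int[mu]_(t in `[0, T[) J t + th 0 * m0.
  have := ent 0 tf; rewrite (@eq_Rintegral _ _ _ mu _ J); last first.
    by move=> t; rewrite inE => tT; exact: inner0.
  rewrite [X in _ + X](_ : _ = th 0 * m0) // -intZl; last first.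
    by apply: in_L1Mr r0L1 mpsi (test_norm1 tp).
  by apply: eq_int => x; rewrite subr0 ger0_norm; [ring|case/andP: (r0I x)].
have ihc : 0 <= \int[mu]_(t in `[0, T[) (c * Psi * dth t - J t) + th 0 * (c * Psi - m0).
  have := ent c tf; rewrite (@eq_Rintegral _ _ _ mu _ (fun t => c * Psi * dth t - J t)); last first.
    by move=> t; rewrite inE => tT; exact: innerc.
  rewrite [X in _ + X](_ : _ = th 0 * (c * Psi - m0)) //.
  have i0 : in_L1 (fun x => rho0 x * psi x) by apply: in_L1Mr r0L1 mpsi (test_norm1 tp).
  rewrite -[c * Psi]intZl // -intB ?intZl //; last exact: in_L1Zl.
  rewrite -intZl; last by apply: in_L1B => //; exact: in_L1Zl.
  apply: eq_int => x; have /andP[_ r1] := r0I x.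
  by rewrite ler0_norm; [ring|rewrite /c; lra].
have thT : th T = 0 by apply: thr; exact: ltW.
move: ihc; rewrite RintegralB // RintegralZl //; last first.
  by have := idth 1; under [X in _ \o X]eq_fun do rewrite mul1r.
rewrite (int_cutoff_derivative dt_ cdth thT).
move: ih0; rewrite -/J; move: (\int[mu]_(t in _) J t) => a h1 h2.
by apply/eqP; rewrite eq_le; apply/andP; split; lra.
Qed.

Let mE r : 0 <= r -> r < T -> m r = m0 + prim (fun t => \1_(`[0, T[%classic : set R) t * n t) r.
Proof.
move=> r0 rT; apply: (weak_derivative m_continuous _ n_measurable _ entropy_identity r0 rT).
  by move=> t /TI; exact: m_bound.
by move=> t /TI; exact: n_bound.
Qed.

Lemma weak_initial : m 0 = m0.
Proof. by rewrite mE // /prim subrr addr0. Qed.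

(** In the interior of a noise step [n] is continuous, so the primitive in [mE] is differentiable
    there. *)
Lemma weak_is_derive k q : 0 < q -> q < T -> k%:R * delta < q -> q < k.+1%:R * delta ->
  is_derive q (1 : R) m (\int[mu]_x (rho q x * cv (fun y => h k (rho q y)) x * dpsi x)).
Proof.
move=> q0 qT kq qk; pose f t := \1_(`[0, T[%classic : set R) t * n t.
have hq : 0 <= q <= T by rewrite !ltW.
have pq : in_piece k q by rewrite /in_piece (ltW kq).
have fE u : 0 < u -> u < T -> f u = n u.
  by move=> u0 uT; rewrite /f indicE mem_set /= ?in_itv /= ?(ltW u0) // mul1r.
have -> : \int[mu]_x (rho q x * cv (fun y => h k (rho q y)) x * dpsi x) = f q.
  by rewrite (fE q q0 qT) /n /g (truncn_in_piece pq).
have mf : measurable_fun setT f by exact: cut_measurable n_measurable.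
have Nn0 : 0 <= rmax * B * n1 dpsi by apply: le_trans (n_bound hq).
have fb : forall t, `|f t| <= rmax * B * n1 dpsi.
  by apply: cut_bound => // t /TI; exact: n_bound.
have near_q : \forall t \near q, [/\ 0 < t, t < T, k%:R * delta < t & t < k.+1%:R * delta].
  near=> t; split; near: t; [exact: lt_nbhsr|exact: lt_nbhsl|exact: lt_nbhsr|exact: lt_nbhsl].
have cf : {for q, continuous f}.
  apply/cvgrPdist_le => e e0; have [d d0 H] := n_near hq pq e0.
  near=> t; have [t0 tT tk kt] : [/\ 0 < t, t < T, k%:R * delta < t & t < k.+1%:R * delta] by near: t.
  rewrite (fE q q0 qT) (fE t t0 tT); apply: H.
  - by rewrite !ltW.
  - by rewrite /in_piece (ltW tk).
  - by near: t; apply/nbhs_ballP; exists d.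
have := is_deriveD (is_derive_cst m0 q 1) (is_derive_prim mf fb cf); rewrite add0r.
apply: near_eq_is_derive; near=> t.
have [t0 tT _ _] : [/\ 0 < t, t < T, k%:R * delta < t & t < k.+1%:R * delta] by near: t.
by rewrite mE ?(ltW t0).
Unshelve. all: by end_near. Qed.

End OneTest.

Lemma weak_curve k s t : 0 <= s -> t <= T -> k%:R * delta <= s -> t <= k.+1%:R * delta ->
  curve eta We alpha (h k) rmax 1 rho s t.
Proof.
move=> s0 tT ks tk.
have sub q : s <= q <= t -> 0 <= q <= T.
  by case/andP=> a b; rewrite (le_trans s0 a) (le_trans b tT).
split.
- by move=> q /sub; exact: rL1.
- by move=> q x /sub; exact: rI.
- move=> p e /sub hp e0; have [d d0 H] := rC hp e0.
  by exists d => // q /sub; exact: H.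
- move=> L1 L2 r psi dpsi tp q /andP[sq qt]; rewrite mul1r.
  apply: (@weak_is_derive L1 L2 r psi dpsi tp k q).
  + exact: le_lt_trans sq.
  + exact: lt_le_trans tT.
  + exact: le_lt_trans sq.
  + exact: lt_le_trans tk.
Qed.

End WeakForm.

(** The initial datum is attained in the sense of equal pairings. Pairings exhaust the positive
    parts of [f - g] and of its opposite, and never exceed those of [f0 - g0] and its opposite. *)
Lemma n1_initial_le (R : realType) (f g f0 g0 : R -> R) (M : R) :
  in_L1 f -> in_L1 g -> in_L1 f0 -> in_L1 g0 -> tvb (fun x => f x - g x) M ->
  (forall L1 L2 r psi dpsi, test_fun L1 L2 r psi dpsi ->
    \int[lebesgue_measure]_x (f x * psi x) = \int[lebesgue_measure]_x (f0 x * psi x) /\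
    \int[lebesgue_measure]_x (g x * psi x) = \int[lebesgue_measure]_x (g0 x * psi x)) ->
  n1 (fun x => f x - g x) <= n1 (fun x => f0 x - g0 x).
Proof.
move=> fi gi f0i g0i wM H.
have iM (u : R -> R) L1 L2 r psi dpsi : in_L1 u -> test_fun L1 L2 r psi dpsi ->
    in_L1 (fun x => u x * psi x).
  by move=> ui tp; exact: in_L1Mr ui (test_measurable tp) (test_norm1 tp).
have pp (u u0 : R -> R) : in_L1 u -> in_L1 u0 -> tvb u M ->
    (forall L1 L2 r psi dpsi, test_fun L1 L2 r psi dpsi ->
      \int[lebesgue_measure]_x (u x * psi x) = \int[lebesgue_measure]_x (u0 x * psi x)) ->
    pospart u <= pospart u0.
  move=> ui u0i uM E; apply/ler_addgt0Pr => e e0.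
  have [L1 [L2 [r [psi [dpsi [tp le]]]]]] := pospart_dense ui uM e0.
  by rewrite -lerBlDr; apply: le_trans le _; rewrite (E _ _ _ _ _ tp); exact: int_test_le_pospart tp.
have i1 := in_L1B fi gi; have i2 := in_L1B f0i g0i.
rewrite !n1_pospart //; apply: lerD; apply: pp => //; try exact: in_L1N.
- move=> L1 L2 r psi dpsi tp; have [E1 E2] := H _ _ _ _ _ tp.
  have e (u w : R -> R) : in_L1 u -> in_L1 w -> \int[lebesgue_measure]_x ((u x - w x) * psi x) =
      \int[lebesgue_measure]_x (u x * psi x) - \int[lebesgue_measure]_x (w x * psi x).
    move=> ui wi; rewrite -intB; [|exact: iM tp|exact: iM tp].
    by apply: eq_int => x; rewrite mulrBl.
  by rewrite !e // E1 E2.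
- move=> z z0; rewrite (_ : (fun x => _) = fun x => - (f (x + z) - g (x + z) - (f x - g x))).
    by rewrite n1N; exact: wM.
  by apply/funext => x; ring.
- move=> L1 L2 r psi dpsi tp; have [E1 E2] := H _ _ _ _ _ tp.
  have e (u w : R -> R) : in_L1 u -> in_L1 w -> \int[lebesgue_measure]_x (- (u x - w x) * psi x) =
      \int[lebesgue_measure]_x (w x * psi x) - \int[lebesgue_measure]_x (u x * psi x).
    move=> ui wi; rewrite -intB; [|exact: iM tp|exact: iM tp].
    by apply: eq_int => x; ring.
  by rewrite !e // E1 E2.
Qed.

(** * Gluing the noise steps *)

Section Pieces.
Context {R : realType}.
Local Notation mu := (@lebesgue_measure R).
Variables (eta We : R) (alpha : R -> R).
Hypothesis ma : mixture eta We alpha.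
Local Notation W0 := (mass eta We alpha).
Variables (delta T rm N C : R) (h : nat -> R -> R).
Hypotheses (delta0 : 0 < delta) (T0 : 0 <= T) (N0 : 0 <= N) (rm0 : 0 <= rm).
Hypothesis hN : forall k a b, `|h k a - h k b| <= N * `|a - b|.
Hypothesis hC : forall k a, `|h k a| <= C.

(** [curve] takes time derivatives at interior times only, so closed steps are allowed: the jump of
    the noise at the end of a step is not seen, and neighbouring steps share an end point for
    gluing. *)
Definition piecewise_curve (rho : R -> R -> R) := forall k s t, 0 <= s -> t <= T ->
  k%:R * delta <= s -> t <= k.+1%:R * delta -> curve eta We alpha (h k) rm 1 rho s t.

Definition finite_tvb (rho : R -> R -> R) :=
  forall q, 0 <= q <= T -> exists M, tvb (rho q) M.

(** The levels of [tvb] are closed by [tvb_lim] and comparable in both directions of time with the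
    constant [expR (G * (b - a))]. *)
Lemma curve_tvb_bounded k rho a b : a <= b -> curve eta We alpha (h k) rm 1 rho a b ->
  (forall q, a <= q <= b -> exists M, tvb (rho q) M) ->
  exists M, forall q, a <= q <= b -> tvb (rho q) M.
Proof.
move=> ab c fin; pose G := 2 * (W0 * (2 * C + 2 * (rm * N))).
have C0 : 0 <= C by apply: le_trans (hC 0 0).
have G0 : 0 <= G.
  by rewrite mulr_ge0 // mulr_ge0 ?(mass_ge0 ma) // addr_ge0 ?mulr_ge0.
apply: (@comparable_level_bounded _ (fun q => tvb (rho q)) a b (expR (G * (b - a)))) => //.
have mon s t M : a <= s -> s <= t -> t <= b -> 0 <= M ->
    expR (G * (t - s)) * M <= expR (G * (b - a)) * M.
  move=> as_ st tb M0; apply: ler_wpM2r => //; rewrite ler_expR ler_wpM2l //; lra.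
split => //.
- by move=> q M M'; exact: tvb_le.
- move=> q M hq H; apply: tvb_lim; first exact: (curve_L1 c).
  move=> e e0; have [d d0 Hd] := curve_cont c hq e0; have [q' [h1 h2 h3]] := H d d0.
  by exists (rho q'); split => //; [exact: (curve_L1 c)|exact: Hd].
- move=> s t b0 M as_ st tb Hb sM; have M0 := tvb_ge0 sM.
  apply: tvb_le (mon s t M as_ st tb M0) _.
  exact: (curve_tvb ma N0 rm0 (hN k) (hC k) (normr1 _) st (curve_sub as_ tb c) Hb sM).
- move=> s t b0 M as_ st tb Hb tM; have M0 := tvb_ge0 tM.
  apply: tvb_le (mon s t M as_ st tb M0) _.
  exact: (curve_tvb_rev ma N0 rm0 (hN k) (hC k) (normr1 _) st (curve_sub as_ tb c) Hb tM).
Qed.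

Lemma delta_cover t : exists n : nat, t <= n%:R * delta.
Proof.
exists (Num.truncn (t / delta)).+1; rewrite -ler_pdivrMr //; apply: ltW; exact: truncnS_gt.
Qed.

Lemma tvb_bounded rho : piecewise_curve rho -> finite_tvb rho ->
  exists M, forall q, 0 <= q <= T -> tvb (rho q) M.
Proof.
move=> pc fin; have [n nT] := delta_cover T.
suff [M H] : exists M, forall q, 0 <= q <= T -> q <= n%:R * delta -> tvb (rho q) M.
  by exists M => q hq; apply: H => //; case/andP: hq => _ /le_trans; apply.
elim: n {nT} => [|n [M1 H1]].
  have h0 : 0 <= (0 : R) <= T by rewrite lexx.
  have [M HM] := fin 0 h0.
  exists M => q /andP[q0 _]; rewrite mul0r => q1.
  by have -> : q = 0 by apply/le_anti; rewrite q0 q1.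
have [nT|Tn] := leP (n%:R * delta) T; last first.
  by exists M1 => q hq _; apply: H1 => //; case/andP: hq => _ /le_trans; apply; exact: ltW.
pose b := Num.min T (n.+1%:R * delta).
have nb : n%:R * delta <= b by rewrite le_min nT ler_pM2r // ler_nat /=.
have n0 : 0 <= n%:R * delta by rewrite mulr_ge0 // ltW.
have bT : b <= T by rewrite ge_min lexx.
have bn : b <= n.+1%:R * delta by rewrite ge_min lexx orbT.
have [M2 H2] := curve_tvb_bounded nb (pc n _ _ n0 bT (lexx _) bn)
  (fun q hq => fin q (introT andP (conj (le_trans n0 (proj1 (andP hq)))
    (le_trans (proj2 (andP hq)) bT)))).
exists (Num.max M1 M2) => q /andP[q0 qT] qn; have [qn'|qn'] := leP q (n%:R * delta).
  by apply: tvb_le (H1 q _ qn'); rewrite ?q0 // le_max lexx.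
apply: tvb_le (H2 q _); first by rewrite le_max lexx orbT.
by rewrite (ltW qn') le_min qT.
Qed.

(** Induction over the noise steps; one [M] serves all of them, so the exponents add up. *)
Lemma piecewise_stability rho sig M : piecewise_curve rho -> piecewise_curve sig ->
  (forall q, 0 <= q <= T -> tvb (rho q) M) -> finite_tvb sig -> forall t, 0 <= t <= T ->
  n1 (fun x => rho t x - sig t x) <= expR (N * W0 * M * t) * n1 (fun x => rho 0 x - sig 0 x).
Proof.
move=> pr ps HM fin t ht; have [n nt] := delta_cover t.
elim: n t ht nt => [|n ih] t /andP[t0 tT] tn.
  have -> : t = 0 by apply/le_anti; rewrite t0 -(mul0r delta) tn.
  by rewrite mulr0 expR0 mul1r.
have [tn'|nt] := leP t (n%:R * delta); first by apply: ih; rewrite ?t0.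
set s := n%:R * delta in nt ih; have s0 : 0 <= s by rewrite mulr_ge0 // ltW.
have sT : 0 <= s <= T by rewrite s0 (le_trans (ltW nt) tT).
have c1 := pr n s t s0 tT (lexx _) tn; have c2 := ps n s t s0 tT (lexx _) tn.
have sub q : s <= q <= t -> 0 <= q <= T.
  by case/andP => a b; rewrite (le_trans s0 a) (le_trans b tT).
have := curve_stability ma N0 (hN n) (hC n) (normr1 _) (ltW nt) c1 c2 _ _ (M := M).
move=> /(_ (fun q hq => HM q (sub q hq)) (fun q hq => fin q (sub q hq))).
move/le_trans; apply; apply: le_trans (ler_wpM2l (expR_ge0 _) (ih s sT (lexx _))) _.
rewrite mulrA -expRD (_ : _ + _ = N * W0 * M * t) //; ring.
Qed.

End Pieces.

(** * Kernel, velocity and noise *)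

Section DerivativeOnInterval.
Context {R : realType}.
Local Notation mu := (@lebesgue_measure R).
Variables (s t : R) (f : R -> R).
Hypothesis st : s < t.
Hypothesis df : forall x, `[s, t]%classic x -> derivable_within `[s, t] f x.
Local Notation Df := (derive_within `[s, t] f).

Lemma derivable_within_dist x e : s <= x <= t -> 0 < e -> exists2 d, 0 < d &
  forall y, s <= y <= t -> y != x -> `|x - y| < d -> `|Df x - (f y - f x) / (y - x)| <= e.
Proof.
move=> hx e0; have Ax : `[s, t]%classic x by rewrite /= in_itv.
have /cvgrPdist_le/(_ _ e0) := df Ax; rewrite near_withinE => /nbhs_ballP[d /= d0 H].
by exists d => // y hy yx xy; apply: H => //; rewrite /= in_itv.
Qed.

Lemma derivable_within_itv_continuous : {within `[s, t], continuous f}.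
Proof.
apply: within_itv_continuous => x e hx e0.
have [d d0 H] := derivable_within_dist hx ltr01.
have K0 : 0 < `|Df x| + 1 by rewrite ltr_wpDl.
exists (Num.min d (e / (`|Df x| + 1))); first by rewrite lt_min d0 divr_gt0.
move=> y hy; rewrite lt_min ltr_pdivlMr // => /andP[xy1 xy2].
have [->|yx] := eqVneq y x; first by rewrite subrr normr0 ltW.
have yx0 : y - x != 0 by rewrite subr_eq0.
have -> : f x - f y = (f y - f x) / (y - x) * (x - y) by field.
rewrite normrM; apply: le_trans (ltW xy2); rewrite mulrC ler_wpM2l //.
set q := _ / _; have := H y hy yx xy1; rewrite -/q => h1.
have : `|q| <= `|Df x| + `|Df x - q|.
  by rewrite -[X in `|X| <= _](subKr (Df x)); exact: ler_normB.
lra.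
Qed.

Lemma is_derive_within_itv x : s < x < t -> is_derive x (1 : R) f (Df x).
Proof.
move=> /andP[sx xt]; have hx : s <= x <= t by rewrite !ltW.
have H : h^-1 *: ((f \o shift x) (h *: 1) - f x) @[h --> (0:R)^'] --> Df x.
  apply/cvgrPdist_le => e e0; have [d d0 H] := derivable_within_dist hx e0.
  pose d' := Num.min d (Num.min (x - s) (t - x)).
  have d'0 : 0 < d' by rewrite !lt_min d0 !subr_gt0 sx.
  apply/nbhs_ballP; exists d' => // h; rewrite /ball /= sub0r normrN => hd h0.
  rewrite [_ *: 1]mulr1 [_ *: _]mulrC.
  have [hd1 hd2 hd3] : [/\ `|h| < d, `|h| < x - s & `|h| < t - x].
    by move: hd; rewrite !lt_min => /andP[-> /andP[-> ->]].
  have := H (h + x) _ _ _; rewrite addrK; apply.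
  - have := ler_norm h; have := ler_norm (- h); rewrite normrN => h1 h2.
    by apply/andP; split; lra.
  - by rewrite -subr_eq0 addrK.
  - by rewrite opprD addrA addrAC subrr sub0r normrN.
have D : derivable f x 1 by apply/cvg_ex; exists (Df x).
by split => //; exact/cvg_lim.
Qed.

Lemma mvt_within a b : s <= a -> a <= b -> b <= t ->
  exists2 c, a <= c <= b & f b - f a = Df c * (b - a).
Proof.
move=> sa ab bt; have [x||] := @MVT_segment _ f Df a b ab.
- rewrite in_itv /= => /andP[ax xb]; apply: is_derive_within_itv.
  by rewrite (le_lt_trans sa ax) (lt_le_trans xb bt).
- apply: continuous_subspaceW derivable_within_itv_continuous.
  by move=> x /=; rewrite !in_itv /= => /andP[u v]; rewrite (le_trans sa u) (le_trans v bt).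
by move=> c; rewrite in_itv /= => hc E; exists c.
Qed.

Hypothesis cDf : {within `[s, t], continuous Df}.

Lemma ftc_within a b : s <= a -> a <= b -> b <= t ->
  \int[mu]_(x in `[a, b]) Df x = f b - f a.
Proof.
move=> sa; rewrite le_eqVlt => /orP[/eqP <- _|ab bt]; first by rewrite set_itv1 Rintegral_set1 subrr.
have sub : `[a, b]%classic `<=` `[s, t]%classic.
  by move=> x /=; rewrite !in_itv /= => /andP[u v]; rewrite (le_trans sa u) (le_trans v bt).
have dD x : x \in `]a, b[ -> is_derive x (1 : R) f (Df x).
  rewrite in_itv /= => /andP[ax xb]; apply: is_derive_within_itv.
  by rewrite (le_lt_trans sa ax) (lt_le_trans xb bt).
rewrite /Rintegral (@continuous_FTC2 _ Df f) //.
- exact: continuous_subspaceW cDf.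
- have /continuous_within_itvP := continuous_subspaceW sub derivable_within_itv_continuous.
  move=> /(_ ab)[_ c1 c2]; split => // x hx; by case: (dD x hx).
- by move=> x hx; rewrite derive1E; case: (dD x hx).
Qed.

End DerivativeOnInterval.

(** * The kernel as a mixture of windows *)

Section KernelMixture.
Context {R : realType}.
Local Notation mu := (@lebesgue_measure R).
Variables (W : R -> R) (eta : R).
Hypotheses (eta0 : 0 < eta) (WC1 : C1_on `[0, eta] W).
Hypothesis W_ge0 : forall x, x \in `[0, eta] -> 0 <= W x.
Hypothesis dW_le0 : forall x, x \in `[0, eta] -> derive_within `[0, eta] W x <= 0.

Definition decay (s : R) : R := \1_(`[0, eta]%classic : set R) s * - derive_within `[0, eta] W s.

Let WD x : `[0, eta]%classic x -> derivable_within `[0, eta] W x.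
Proof. by case: WC1 => H _; exact: H. Qed.

Let cDW : {within `[0, eta], continuous (derive_within `[0, eta] W)}.
Proof. by case: WC1. Qed.

Lemma in_L1_cut_integrable (D : set R) (f : R -> R) : measurable D ->
  mu.-integrable D (EFin \o f) -> in_L1 (fun x => \1_D x * f x).
Proof.
move=> mD; rewrite integrable_mkcond // /in_L1; congr (mu.-integrable _ _).
apply/funext => x; rewrite patchE /= indicE.
by case: ifP => _; rewrite ?mul1r ?mul0r.
Qed.

Lemma in_L1_decay : in_L1 decay.
Proof.
have := continuous_compact_integrable (@segment_compact _ 0 eta) cDW.
move=> /(in_L1_cut_integrable (measurable_itv _))/in_L1N.
by congr in_L1; apply/funext => x; rewrite /decay mulrN.
Qed.

(** Layer-cake form: by the fundamental theorem of calculus, [W z] is [W eta] plus the mass of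
    [- W'] on [z, eta], which is the total weight of the windows [0, s] that contain [z]. *)
Lemma kernel_tail z : 0 <= z <= eta ->
  W z = W eta + \int[mu]_s (decay s * \1_([set s : R | z <= s]) s).
Proof.
move=> /andP[z0 ze].
have -> : \int[mu]_s (decay s * \1_([set s : R | z <= s]) s) =
    \int[mu]_s - (\1_(`[z, eta]%classic : set R) s * derive_within `[0, eta] W s).
  apply: eq_int => s; rewrite /decay !indicE /=.
  have -> : (s \in `[z, eta]%classic) = (s \in `[0, eta]%classic) && (s \in [set s : R | z <= s]).
    apply/idP/andP => [|[]]; rewrite !inE /= !in_itv /=.
      by move=> /andP[zs se]; rewrite (le_trans z0 zs).
    by move=> /andP[_ ->] ->.
  by case: (_ \in _); case: (_ \in _); rewrite /= ?(mul0r, mulr0, mul1r, mulr1, oppr0).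
have E : \int[mu]_(s in `[z, eta]) derive_within `[0, eta] W s = \int[mu]_s
    (\1_(`[z, eta]%classic : set R) s * derive_within `[0, eta] W s) by exact: int_indicM.
rewrite intN -?E; first by rewrite (ftc_within WD cDW z0 ze (lexx _)); ring.
apply: in_L1_cut_integrable => //; apply: continuous_compact_integrable; first exact: segment_compact.
by apply: continuous_subspaceW cDW => x /=; rewrite !in_itv /= => /andP[u ->]; rewrite (le_trans z0 u).
Qed.

Lemma kernel_mixture : mixture eta (W eta) decay.
Proof.
split; first exact: ltW.
- by apply: W_ge0; rewrite in_itv /= lexx ltW.
- move=> s; rewrite /decay indicE; case: (boolP (s \in _)) => h; last by rewrite mul0r.
  by rewrite mul1r oppr_ge0; apply: dW_le0; move: h; rewrite inE.
- exact: in_L1_decay.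
Qed.

(** The layer-cake form at 0, where every window counts. This is the origin of [W 0] in the
    exponent. *)
Lemma mass_kernel : mass eta (W eta) decay = W 0.
Proof.
rewrite /mass (kernel_tail (z := 0)) ?lexx ?(ltW eta0) //; congr (_ + _).
apply: eq_int => s; rewrite /decay !indicE; case: (boolP (s \in `[0, eta]%classic)) => h.
  by rewrite mem_set ?mulr1 //; move: h; rewrite inE /= in_itv /= => /andP[].
by rewrite !mul0r.
Qed.

(** Insert the layer-cake form and exchange the integrals: for fixed [s] the points with
    [y - x <= s] form the window [x, x + s]. *)
Lemma kernel_conv (g : R -> R) (C x : R) : measurable_fun setT g -> (forall y, `|g y| <= C) ->
  \int[mu]_(y in `[x, x + eta]) (W (y - x) * g y) = conv eta (W eta) decay g x.
Proof.
move=> mg gC; pose a y := \1_(`[x, x + eta]%classic : set R) y * g y.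
have ia : in_L1 a by exact: in_L1_indic_bounded.
have id := in_L1_decay.
pose k (p : R * R) : R := \1_([set p : R * R | p.1 - x <= p.2]) p.
have mk : measurable_fun setT k.
  apply: measurable_indic; rewrite -[X in measurable X]setTI.
  apply: (@measurable_fun_le _ _ _ setT (fun p : R * R => p.1 - x) snd) => //.
  exact: measurable_funB.
have k1 p : `|k p| <= 1 by rewrite /k indicE; case: (_ \in _); rewrite ?normr1 ?normr0.
have fub := fubini_swap ia id mk k1.
have E1 s : 0 <= s <= eta -> \int[mu]_y (a y * k (y, s)) = prim g (x + s) - prim g x.
  move=> /andP[s0 se]; have xs : x <= x + s by rewrite lerDl.
  rewrite (prim_sub mg gC xs) [RHS]int_indicM.
  apply: eq_int => y; rewrite /a /k !indicE mulrAC; congr (_ * _).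
  have -> : (y \in `[x, x + s]%classic) = (y \in `[x, x + eta]%classic) && ((y, s) \in [set p : R * R | p.1 - x <= p.2]).
    apply/idP/andP => [|[]]; rewrite !inE /= !in_itv /= lerBlDl.
      by move=> /andP[xy ys]; rewrite xy ys (le_trans ys) // lerD2l.
    by move=> /andP[-> _] ->.
  by case: (_ \in _); case: (_ \in _); rewrite /= ?(mul0r, mulr0, mul1r, mulr1).
rewrite [LHS]int_indicM /conv /kavg.
have -> : \int[mu]_s (decay s * (prim g (x + clp eta s) - prim g x)) =
    \int[mu]_s (decay s * \int[mu]_y (a y * k (y, s))).
  apply: eq_int => s; rewrite /decay indicE; case: (boolP (s \in _)) => h; last by rewrite !mul0r.
  have hs : 0 <= s <= eta by move: h; rewrite inE /= in_itv.
  by rewrite E1 // clp_id.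
rewrite -fub.
have -> : prim g (x + eta) - prim g x = \int[mu]_y a y.
  have xe : x <= x + eta by rewrite lerDl ltW.
  by rewrite (prim_sub mg gC xe) [LHS]int_indicM.
have mint : measurable_fun setT (fun y => \int[mu]_s (decay s * k (y, s))).
  exact: (measurable_int_param (k := fun p => k (p.2, p.1)) id
    (measurableT_comp mk (measurable_fun_pair measurable_snd measurable_fst)) (fun p => k1 _)).
have ii : in_L1 (fun y => a y * \int[mu]_s (decay s * k (y, s))).
  apply: (in_L1Mr ia mint (C := 1 * n1 decay)) => y.
  apply: ler_intMb => //; exact: (measurableT_comp mk (measurable_pair1 _)).
rewrite -intZl // -intD //; last exact: in_L1Zl.
apply: eq_int => y; rewrite {1}/a indicE; case: (boolP (y \in _)) => h; last first.
  by rewrite /a indicE (negbTE h) !mul0r mulr0 addr0.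
rewrite mul1r kernel_tail; last first.
  by move: h; rewrite inE /= in_itv /= => /andP[y0 y1]; rewrite subr_ge0 y0 lerBlDl.
rewrite /a indicE h mul1r mulrDl; congr (_ + _); rewrite mulrC; congr (_ * _).
Qed.

End KernelMixture.

(** * Lipschitz bound for the random velocity *)

Section VelocityNoise.
Context {R : realType}.
Variables (rmax vmax : R) (v : R -> R).
Hypotheses (rmax0 : 0 < rmax) (hv : velocity rmax vmax v).
Local Notation Dv := (derive_within `[0, rmax] v).

Let vD x : `[0, rmax]%classic x -> derivable_within `[0, rmax] v x.
Proof. by case: hv => -[[H _] _] *; exact: H. Qed.

Let cDv : {within `[0, rmax], continuous Dv}.
Proof. by case: hv => -[[_ H] _] *. Qed.

Let Dv_le0 r : 0 <= r <= rmax -> Dv r <= 0.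
Proof. by case: hv => _ _ H _ _ hr; apply: H; rewrite in_itv. Qed.

Lemma velocity_nonincreasing a b : 0 <= a -> a <= b -> b <= rmax -> v b <= v a.
Proof.
move=> a0 ab br; have [c /andP[ac cb] E] := mvt_within vD a0 ab br.
rewrite -subr_le0 E; apply: mulr_le0_ge0; last by rewrite subr_ge0.
by apply: Dv_le0; rewrite (le_trans a0 ac) (le_trans cb br).
Qed.

Lemma velocity_itv r : 0 <= r <= rmax -> 0 <= v r <= vmax.
Proof.
move=> /andP[r0 r1]; have [_ H _ <- _] := hv; rewrite H ?in_itv /= ?r0 //.
exact: velocity_nonincreasing.
Qed.

Lemma norm_dv_fin : exists2 D : R, 0 <= D & (norm_dv rmax v <= D%:E)%E.
Proof.
have cN : {within `[0, rmax], continuous (fun x => `|Dv x|)}.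
  move=> x; apply: continuous_comp; [exact: cDv|exact: norm_continuous].
have [c _ Hc] := EVT_max (ltW rmax0) cN; exists `|Dv c| => //.
by apply: ge_ereal_sup => _ [x hx <-]; rewrite lee_fin; exact: Hc.
Qed.

Section Eps.
Variables (eps : R -> R) (T : R).
Hypothesis T0 : 0 < T.

Lemma norm_dv_eps_ge0 : (0 <= norm_dv_eps rmax v eps T)%E.
Proof.
apply: ereal_sup_ge; exists (sup_norm `[0, rmax] (dv_eps rmax v eps ^~ 0)).
  by exists 0 => //=; rewrite in_itv /= lexx ltW.
apply: ereal_sup_ge; exists `|dv_eps rmax v eps 0 0|%:E; last by rewrite lee_fin.
by exists 0 => //=; rewrite in_itv /= lexx ltW.
Qed.

Lemma norm_dv_eps_le : (norm_dv_eps rmax v eps T <= norm_dv rmax v)%E.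
Proof.
apply: ge_ereal_sup => _ [t _ <-]; apply: ge_ereal_sup => _ [r hr <-].
apply: ereal_sup_ge; exists `|Dv r|%:E; first by exists r.
rewrite lee_fin /dv_eps normrM -[leRHS]mulr1; apply: ler_wpM2l => //.
by rewrite indicE; case: (_ \in _); rewrite ?normr1 ?normr0.
Qed.

Definition lip_eps : R := fine (norm_dv_eps rmax v eps T).

Lemma lip_epsE : norm_dv_eps rmax v eps T = lip_eps%:E.
Proof.
have [D D0 HD] := norm_dv_fin; rewrite fineK // fin_numE.
apply/andP; split; last by rewrite lt_eqF // (le_lt_trans norm_dv_eps_le) // (le_lt_trans HD) // ltry.
by rewrite gt_eqF // (lt_le_trans _ norm_dv_eps_ge0).
Qed.

Lemma lip_eps_ge0 : 0 <= lip_eps.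
Proof. by rewrite -lee_fin -lip_epsE norm_dv_eps_ge0. Qed.

Lemma dv_eps_le r t : 0 <= r <= rmax -> 0 <= t <= T -> 0 < v r + eps t -> `|Dv r| <= lip_eps.
Proof.
move=> hr ht pos; rewrite -lee_fin -lip_epsE; apply: ereal_sup_ge.
exists (sup_norm `[0, rmax] (dv_eps rmax v eps ^~ t)); first by exists t => //=; rewrite in_itv.
apply: ereal_sup_ge; exists `|dv_eps rmax v eps r t|%:E; first by exists r => //=; rewrite in_itv.
by rewrite lee_fin /dv_eps indicE mem_set /= ?in_itv /= ?andbT // mulr1.
Qed.

(* Truncating at a level kappa > 0 avoids the points where v + eps vanishes,
   at which dv_eps is set to 0. *)
Lemma v_eps_lip_trunc a b t k : 0 <= a -> a <= b -> b <= rmax -> 0 <= t <= T -> 0 < k ->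
  Num.max k (v a + eps t) - Num.max k (v b + eps t) <= lip_eps * (b - a).
Proof.
move=> a0 ab br ht k0; have N0 := lip_eps_ge0.
have step c : a <= c -> c <= b -> k <= v c + eps t -> v a - v c <= lip_eps * (c - a).
  move=> ac cb kc; have cr := le_trans cb br.
  have [x /andP[ax xc] E] := mvt_within vD a0 ac cr.
  have hx : 0 <= x <= rmax by rewrite (le_trans a0 ax) (le_trans xc cr).
  have vx : v c <= v x by apply: velocity_nonincreasing => //; exact: le_trans ax.
  have : `|Dv x| <= lip_eps by apply: dv_eps_le ht _ => //; lra.
  rewrite -(opprB (v c)) E -mulNr => h; apply: ler_wpM2r; first by rewrite subr_ge0.
  by apply: le_trans h; rewrite ler0_norm // Dv_le0.
have [kb|bk] := leP k (v b + eps t).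
  have vab := velocity_nonincreasing a0 ab br.
  have ka : k <= v a + eps t by lra.
  rewrite (max_r ka).
  rewrite (_ : _ - _ = v a - v b); last by ring.
  exact: step.
have [ak|ka] := leP (v a + eps t) k; first by rewrite subrr mulr_ge0 // subr_ge0.
have vc := derivable_within_itv_continuous vD.
have sub : `[a, b]%classic `<=` `[0, rmax]%classic.
  by move=> x /=; rewrite !in_itv /= => /andP[u w]; rewrite (le_trans a0 u) (le_trans w br).
(* At [c] the nonincreasing function [v + eps] crosses the level [k]: up to [c] it stays at least
   [k], beyond [c] the truncated value is constant. *)
have [|c] := IVT ab (continuous_subspaceW sub vc) (v := k - eps t).
  rewrite min_r; last lra.
  by rewrite max_l; [apply/andP; split; lra|lra].
rewrite in_itv /= => /andP[ac cb] E.
apply: le_trans (_ : lip_eps * (c - a) <= _); last first.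
  by apply: ler_wpM2l => //; rewrite lerD2r.
by apply: le_trans (step c ac cb _); lra.
Qed.

Lemma v_eps_lip a b t : 0 <= a <= rmax -> 0 <= b <= rmax -> 0 <= t <= T ->
  `|v_eps v eps a t - v_eps v eps b t| <= lip_eps * `|a - b|.
Proof.
wlog ab : a b / a <= b => [H ha hb ht|/andP[a0 _] /andP[_ br] ht].
  have [ab|/ltW ba] := leP a b; first exact: H.
  by rewrite -(opprB b) -(opprB (v_eps v eps b t)) !normrN; exact: H.
have vab := velocity_nonincreasing a0 ab br.
rewrite (ler0_norm (_ : a - b <= 0)) ?subr_le0 // opprB ger0_norm; last first.
  by rewrite subr_ge0 /v_eps ge_max le_max lexx /= le_max lerD2r vab orbT.
(* Truncating at [k] instead of 0 costs at most [k] in the difference, and [k] is arbitrary. *)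
apply/ler_addgt0Pr => k k0; have := v_eps_lip_trunc a0 ab br ht k0.
rewrite /v_eps /Num.max; do !case: ifPn; rewrite -?leNgt => *; lra.
Qed.

End Eps.
End VelocityNoise.

Section NoiseSteps.
Context {R : realType}.

(** A point of the k-th step lies in the support of the j-th indicator exactly when [j = k], so both
    sums have the same terms. *)
Lemma noise_cst (Omega : Type) (delta T : R) (U : nat -> Omega -> R) omega k s t :
  0 < delta -> in_piece delta k s -> in_piece delta k t ->
  noise delta T U omega s = noise delta T U omega t.
Proof.
move=> d0 ps pt; apply: eq_bigr => j _; congr (_ * _); rewrite !indicE; congr (nat_of_bool _)%:R.
have H u : in_piece delta k u -> (u \in `[j%:R * delta, j.+1%:R * delta[%classic) = (j == k).
  move=> pu; apply/idP/eqP => [|->]; rewrite inE /= in_itv //= => pj.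
  by rewrite -(truncn_in_piece d0 pu) (truncn_in_piece d0 pj).
by rewrite !H.
Qed.

Lemma noise_bounded (Omega : Type) (delta T : R) (U : nat -> Omega -> R) omega :
  exists E, forall t, `|noise delta T U omega t| <= E.
Proof.
exists (\sum_(1 <= k < (noise_steps delta T).+1) `|U k omega|) => t.
apply: le_trans (ler_norm_sum _ _ _) _; apply: ler_sum => k _.
rewrite normrM -[leRHS]mulr1; apply: ler_wpM2l => //.
by rewrite indicE; case: (_ \in _); rewrite ?normr1 ?normr0.
Qed.

End NoiseSteps.

(** * The stability estimate *)

Section ExtendedReals.
Context {R : realType}.
Implicit Types (f : R -> R).
Local Notation mu := (@lebesgue_measure R).

Lemma L1normE f : in_L1 f -> L1norm f = (n1 f)%:E.
Proof.
move=> fi; rewrite /L1norm Lnorm1 /n1 /Rintegral fineK //.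
by apply: integrable_fin_num => //; exact: in_L1_norm fi.
Qed.

Lemma TV_ge0 f : (0 <= TV f)%E.
Proof.
apply: le_ereal_inf_tmp => _ [g _ <-]; apply: ereal_sup_ge.
exists (total_variation 0 0 g); first by exists (0, 0) => //=.
exact: total_variation_ge0.
Qed.

Lemma in_CL1_dist (T : R) (rho : R -> R -> R) : in_CL1 T rho ->
  forall p e, 0 <= p <= T -> 0 < e -> exists2 d, 0 < d &
    forall q, 0 <= q <= T -> `|p - q| < d -> n1 (fun x => rho p x - rho q x) <= e.
Proof.
move=> [rL1 rC] p e hp e0; have tp : p \in `[0, T] by rewrite in_itv.
have /= H := rC p tp [set y | (y < e%:E)%E] _.
have : \forall t \near within `[0, T]%classic (nbhs p), (L1norm (rho t \- rho p)%R < e%:E)%E.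
  apply: H; apply: open_nbhs_nbhs; split; first exact: open_ereal_lt_ereal.
  by rewrite /= lte_fin.
rewrite near_withinE => /nbhs_ballP[d /= d0 Hd]; exists d => // q hq pq.
have := Hd q pq; rewrite /= in_itv /= => /(_ hq).
have iq : in_L1 (rho q) by apply: rL1; rewrite in_itv.
rewrite L1normE; last by apply: in_L1B => //; exact: rL1.
rewrite lte_fin => /ltW; rewrite -n1N; apply: le_trans.
by rewrite le_eqVlt; apply/orP; left; apply/eqP; congr n1; apply/funext => x; rewrite opprB.
Qed.

Section StabilityConstant.
Variables (W : R -> R) (eta T : R) (rho : R -> R -> R).
Hypotheses (eta0 : 0 <= eta) (T0 : 0 <= T) (W0 : 0 <= W 0).
Local Notation supTV := (ereal_sup [set TV (rho t) | t in `[0%R, T]]).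

Let t0 : `[0, T]%classic (0 : R). Proof. by rewrite /= in_itv /= lexx. Qed.

Let supTV_ge0 : (0 <= supTV)%E.
Proof. by apply: ereal_sup_ge; exists (TV (rho 0)); [exists 0|exact: TV_ge0]. Qed.

Let supL1_ge0 : (0 <= ereal_sup [set L1norm (rho t) | t in `[0%R, T]])%E.
Proof. by apply: ereal_sup_ge; exists (L1norm (rho 0)); [exists 0|exact: Lnorm_ge0]. Qed.

Let norm_dW_ge0 : (0 <= sup_norm `[0%R, eta] (derive_within `[0%R, eta] W))%E.
Proof.
apply: ereal_sup_ge; exists `|derive_within `[0, eta] W 0|%:E; last by rewrite lee_fin.
by exists 0 => //=; rewrite in_itv /= lexx.
Qed.

Lemma stability_constant_ge0 (N : \bar R) : (0 <= N)%E -> (0 <= stability_constant W eta T N rho)%E.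
Proof.
by move=> N0; rewrite mule_ge0 // adde_ge0 // mule_ge0 // ?lee_fin // adde_ge0 // mule_ge0 // lee_fin.
Qed.

Lemma stability_constant_le (N N' : \bar R) : (N <= N')%E ->
  (stability_constant W eta T N rho <= stability_constant W eta T N' rho)%E.
Proof.
move=> NN; apply: lee_wpmul2r => //.
by rewrite adde_ge0 // mule_ge0 // ?lee_fin // adde_ge0 // mule_ge0 // lee_fin.
Qed.

Lemma stability_constant_geTV (N : \bar R) : (0 <= N)%E ->
  (N * ((W 0)%:E * supTV) <= stability_constant W eta T N rho)%E.
Proof.
move=> N0; apply: lee_wpmul2l => //; apply: le_trans (_ : (W 0)%:E * (supTV +
  2%:E * ereal_sup [set L1norm (rho t) | t in `[0%R, T]]) <= _)%E.
  by apply: lee_wpmul2l; rewrite ?lee_fin // leeDl // mule_ge0 // lee_fin.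
by rewrite leeDl // mule_ge0.
Qed.

End StabilityConstant.

(* With an infinite supremum of total variations the constant is infinite or
   the exponent N * W 0 * M vanishes; [M] is then any finite bound. *)
Lemma expeR_stability (a b : R) (W : R -> R) (eta T t N : R) (rho : R -> R -> R) :
  0 <= eta -> 0 < T -> 0 <= t <= T -> 0 <= W 0 -> 0 <= N -> 0 <= b ->
  (forall q, 0 <= q <= T -> in_L1 (rho q)) ->
  (exists M, forall q, 0 <= q <= T -> tvb (rho q) M) ->
  (forall M, (forall q, 0 <= q <= T -> tvb (rho q) M) -> a <= expR (N * W 0 * M * t) * b) ->
  (a%:E <= expeR (stability_constant W eta T N%:E rho * T%:E) * b%:E)%E.
Proof.
move=> eta0 Tp /andP[t0 tT] W0 N0 b0 rL [M0 HM0] H; have T0 := ltW Tp.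
have NE : (0 <= N%:E)%E by rewrite lee_fin.
set K := stability_constant _ _ _ _ _.
have K0 : (0 <= K)%E by exact: stability_constant_ge0.
have KT := stability_constant_geTV rho eta0 T0 W0 NE; rewrite -/K in KT.
have bE : (0 <= b%:E)%E by rewrite lee_fin.
have NW0 : 0 <= N * W 0 by rewrite mulr_ge0.
have mono (x : R) (y : \bar R) : (x%:E <= y)%E -> ((expR x)%:E <= expeR y)%E.
  by case: y => [y| |] //=; [rewrite !lee_fin ler_expR|rewrite !leey].
have supT q : 0 <= q <= T -> (TV (rho q) <= ereal_sup [set TV (rho t) | t in `[0%R, T]])%E.
  by move=> hq; apply: ereal_sup_ubound; exists q => //=; rewrite in_itv.
(* With a zero exponent the finite bound [M0] suffices, and only the nonnegativity of the stability
   constant enters. *)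
have [NWz|NWp] := eqVneq (N * W 0) 0.
  have := H M0 HM0; rewrite NWz !mul0r expR0 mul1r => ab.
  apply: (@le_trans _ _ ((expR 0)%:E * b%:E)%E); first by rewrite expR0 mul1e lee_fin.
  by apply: lee_wpmul2r => //; apply: mono; rewrite mule_ge0 // lee_fin.
have {}NWp : 0 < N * W 0 by rewrite lt_neqAle eq_sym NWp.
move: KT supT; case: (ereal_sup _) => [S| |] KT supT.
- have HS q : 0 <= q <= T -> tvb (rho q) S by move=> hq; apply: TV_tvb; [exact: rL|exact: supT].
  have S0 : 0 <= S by apply: (@tvb_ge0 _ (rho 0)); apply: HS; rewrite lexx.
  apply: (@le_trans _ _ ((expR (N * W 0 * S * t))%:E * b%:E)%E); first by rewrite lee_fin H.
  apply: lee_wpmul2r => //; apply: mono.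
  apply: (@le_trans _ _ ((N * W 0 * S)%:E * T%:E)%E).
    by rewrite lee_fin ler_wpM2l // mulr_ge0.
  by apply: lee_wpmul2r; rewrite ?lee_fin // -mulrA.
- have -> : K = +oo%E.
    apply/eqP; rewrite -leye_eq; apply: le_trans KT; rewrite muleA.
    by rewrite -EFinM gt0_muley // lte_fin.
  rewrite gt0_mulye ?lte_fin //=.
  (* Since [+oo * 0 = 0], an infinite constant gives no slack when the initial data agree; [a <= 0]
     then comes from the finite bound [M0]. *)
  have [b0'|bp] := eqVneq b 0.
    by rewrite b0' mule0 lee_fin; have := H M0 HM0; rewrite b0' mulr0.
  by rewrite gt0_mulye ?leey // lte_fin lt_neqAle eq_sym bp.
- by have := supT 0; rewrite lexx T0 => /(_ isT); have := TV_ge0 (rho 0); case: (TV _).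
Qed.

End ExtendedReals.

Section Solution.
Context {R : realType}.
Local Notation mu := (@lebesgue_measure R).
Variables (W : R -> R) (eta rmax vmax : R) (v eps : R -> R) (T delta E : R).
Hypotheses (eta0 : 0 < eta) (rmax0 : 0 < rmax) (T0 : 0 < T) (delta0 : 0 < delta).
Hypothesis WC1 : C1_on `[0, eta] W.
Hypothesis W_ge0 : forall x, x \in `[0, eta] -> 0 <= W x.
Hypothesis dW_le0 : forall x, x \in `[0, eta] -> derive_within `[0, eta] W x <= 0.
Hypothesis hv : velocity rmax vmax v.
Hypothesis eps_cst : forall k s t, in_piece delta k s -> in_piece delta k t -> eps s = eps t.
Hypothesis eps_bounded : forall t, `|eps t| <= E.

Local Notation N := (lip_eps rmax v eps T).

Let ma := kernel_mixture eta0 WC1 W_ge0 dW_le0.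

(* The flux during the k-th noise step, extended to all of R in the density
   variable and, beyond T, in the step index. *)
Definition flux (k : nat) (r : R) : R := v_eps v eps (clp rmax r) (Num.min (k%:R * delta) T).

Let clp_rmax r : 0 <= clp rmax r <= rmax.
Proof. by rewrite /clp le_max lexx /= ge_max (ltW rmax0) /= ge_min lexx orbT. Qed.

Let step_itv k : 0 <= Num.min (k%:R * delta) T <= T.
Proof. by rewrite ge_min lexx orbT andbT le_min mulr_ge0 ?(ltW delta0) ?(ltW T0). Qed.

Lemma clp_lip c (a b : R) : `|clp c a - clp c b| <= `|a - b|.
Proof.
wlog ab : a b / a <= b => [H|].
  have [ab|/ltW ba] := leP a b; first exact: H.
  by rewrite -(opprB b) -(opprB (clp c b)) !normrN; exact: H.
rewrite (ler0_norm (_ : a - b <= 0)) ?subr_le0 // ler0_norm; last first.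
  by rewrite /clp /Num.max /Num.min; do !case: ifPn; rewrite -?leNgt => *; lra.
by rewrite /clp /Num.max /Num.min; do !case: ifPn; rewrite -?leNgt => *; lra.
Qed.

Lemma flux_lip k a b : `|flux k a - flux k b| <= N * `|a - b|.
Proof.
apply: le_trans (v_eps_lip rmax0 hv eps T0 (clp_rmax a) (clp_rmax b) (step_itv k)) _.
by apply: ler_wpM2l (clp_lip _ _ _); exact: (lip_eps_ge0 rmax0 hv eps T0).
Qed.

Lemma flux_bound k a : `|flux k a| <= vmax + E.
Proof.
have /andP[v0 v1] := velocity_itv hv (clp_rmax a).
have := eps_bounded (Num.min (k%:R * delta) T); rewrite /flux /v_eps.
move: (eps _) (v _) v0 v1 => e u u0 u1; rewrite ler_norml => /andP[e0 e1].
rewrite ger0_norm ?le_max ?lexx // ge_max; apply/andP; split; lra.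
Qed.

Section OneSolution.
Variables (rho : R -> R -> R) (rho0 : R -> R).
Hypothesis hrho0 : initial_datum rmax rho0.
Hypothesis sol : weak_entropy_solution W eta rmax v eps T rho0 rho.

Lemma solution_L1 t : 0 <= t <= T -> in_L1 (rho t).
Proof. by case: sol => -[H _] _ _ _ ht; apply: H; rewrite in_itv. Qed.

Lemma solution_itv t x : 0 <= t <= T -> 0 <= rho t x <= rmax.
Proof. by case: sol => _ _ H _ ht; apply: H; rewrite in_itv. Qed.

Lemma solution_finite_tvb : finite_tvb T rho.
Proof.
move=> q hq; have : in_BV (rho q) by case: sol => _ H _ _; apply: H; rewrite in_itv.
rewrite /in_BV; have := TV_ge0 (rho q); case e: (TV (rho q)) => [M| |] // _ _.
by exists M; apply: TV_tvb; [exact: solution_L1|rewrite e].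
Qed.

(** Within a step the noise equals its value at [k delta]. There [flux] reads off the true velocity:
    [k delta <= t <= T] makes the minimum with [T] equal to [k delta], and the clamp is the identity
    on [0, rmax]. *)
Lemma solution_velocity t k x : 0 <= t <= T -> in_piece delta k t ->
  V_eps W eta v eps rho t x = conv eta (W eta) (decay W eta) (fun y => flux k (rho t y)) x.
Proof.
move=> ht pt; have mf := measurable_flux (flux_lip k) (solution_L1 ht).
rewrite -(kernel_conv eta0 WC1 x mf (fun y => flux_bound k _)).
apply: eq_Rintegral => y _; congr (_ * _); rewrite /flux clp_id ?solution_itv //.
rewrite /v_eps; congr (Num.max 0 (_ + _)); case/andP: ht => t0 tT; case/andP: (pt) => kt tk.
rewrite min_l ?(le_trans kt) //; apply: (eps_cst (k := k)) => //.
by rewrite /in_piece lexx /= ltr_pM2r // ltr_nat ltnSn.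
Qed.

Let ent : entropy_inequality W eta v eps T rho rho0.
Proof. by case: sol. Qed.

Let CL1 : in_CL1 T rho.
Proof. by case: sol. Qed.

Lemma solution_piecewise_curve : piecewise_curve eta (W eta) (decay W eta) delta T rmax flux rho.
Proof.
case: hrho0 => i0 _ r0; move=> k s t s0 tT ks tk.
apply: (weak_curve ma T0 (ltW rmax0) delta0 (lip_eps_ge0 rmax0 hv eps T0) flux_lip flux_bound
  solution_L1 solution_itv (in_CL1_dist CL1) i0 r0 solution_velocity ent) => //.
Qed.

Lemma solution_initial L1 L2 r psi dpsi : test_fun L1 L2 r psi dpsi ->
  \int[mu]_x (rho 0 x * psi x) = \int[mu]_x (rho0 x * psi x).
Proof.
case: hrho0 => i0 _ r0 tp.
exact: (weak_initial ma T0 (ltW rmax0) delta0 (lip_eps_ge0 rmax0 hv eps T0) flux_lip flux_bound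
  solution_L1 solution_itv (in_CL1_dist CL1) i0 r0 solution_velocity ent tp).
Qed.

Lemma solution_tvb_bounded : exists M, forall q, 0 <= q <= T -> tvb (rho q) M.
Proof.
exact: (tvb_bounded ma delta0 (ltW T0) (lip_eps_ge0 rmax0 hv eps T0) (ltW rmax0) flux_lip flux_bound
  solution_piecewise_curve solution_finite_tvb).
Qed.

End OneSolution.

Lemma solution_stability rho sig rho0 sig0 M t :
  initial_datum rmax rho0 -> initial_datum rmax sig0 ->
  weak_entropy_solution W eta rmax v eps T rho0 rho ->
  weak_entropy_solution W eta rmax v eps T sig0 sig ->
  (forall q, 0 <= q <= T -> tvb (rho q) M) -> 0 <= t <= T ->
  n1 (fun x => rho t x - sig t x) <=
    expR (N * W 0 * M * t) * n1 (fun x => rho0 x - sig0 x).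
Proof.
move=> hr hs sr ss HM ht; have h0 : 0 <= (0 : R) <= T by rewrite lexx ltW.
have := piecewise_stability ma delta0 (lip_eps_ge0 rmax0 hv eps T0) flux_lip flux_bound
  (solution_piecewise_curve hr sr) (solution_piecewise_curve hs ss) HM
  (solution_finite_tvb ss) ht.
rewrite (mass_kernel eta0 WC1) => /le_trans; apply.
apply: ler_wpM2l; first exact: expR_ge0.
have [M' HM'] := solution_tvb_bounded hs ss.
have i1 := solution_L1 sr h0; have i2 := solution_L1 ss h0.
case: (hr) => ir _ _; case: (hs) => is_ _ _.
apply: (n1_initial_le i1 i2 ir is_ (tvbB i1 i2 (HM 0 h0) (HM' 0 h0))).
by move=> L1 L2 r psi dpsi tp; rewrite (solution_initial hr sr tp) (solution_initial hs ss tp).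
Qed.

End Solution.

Theorem theorem5p10 (R : realType)
  (W : R -> R -> R) (hW : kernel_family W)
  (eta : R) (heta : 0 < eta)
  (rmax vmax : R) (hrmax : 0 < rmax)
  (v : R -> R) (hv : velocity rmax vmax v)
  (T : R) (hT : 0 < T)
  (d : measure_display) (Omega : measurableType d) (P : probability Omega R)
  (tau deltaR : R) (U : nat -> {RV P >-> R})
  (hU : noise_assumptions vmax tau deltaR T U)
  (rho0 sigma0 : R -> R)
  (hrho0 : initial_datum rmax rho0) (hsigma0 : initial_datum rmax sigma0)
  (rho sigma : Omega -> R -> R -> R) (omega : Omega) :
  let eps := noise deltaR T U omega in
  weak_entropy_solution (W eta) eta rmax v eps T rho0 (rho omega) ->
  weak_entropy_solution (W eta) eta rmax v eps T sigma0 (sigma omega) ->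
  let Keps := K_eps (W eta) eta rmax v eps T (rho omega) in
  let K := K_det (W eta) eta rmax v T (rho omega) in
  (forall t, t \in `[0, T] ->
    (L1norm (rho omega t \- sigma omega t)%R
     <= expeR (Keps * T%:E) * L1norm (rho0 \- sigma0)%R)%E) /\
  (0 <= Keps <= K)%E.
Proof.
move=> eps hr hs Keps K.
have [WC1 W_ge0 dW_le0 _] := hW.1 eta heta.
have delta0 : 0 < deltaR by case: hU.
have W00 : 0 <= W eta 0 by apply: W_ge0; rewrite in_itv /= lexx ltW.
have eps_cst k s t : in_piece deltaR k s -> in_piece deltaR k t -> eps s = eps t.
  exact: noise_cst.
have [E HE] := noise_bounded deltaR T U omega.
have [eta0 T0] := (ltW heta, ltW hT).
split; last first.
  rewrite stability_constant_ge0 ?norm_dv_eps_ge0 //=.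
  exact: (stability_constant_le _ eta0 T0 W00 (norm_dv_eps_le _ _ _ _)).
move=> t; rewrite in_itv /= => ht.
have N0 := lip_eps_ge0 hrmax hv eps hT.
have iw : in_L1 (fun x => rho omega t x - sigma omega t x).
  by apply: in_L1B; [exact: (solution_L1 hr)|exact: (solution_L1 hs)].
have i0 : in_L1 (fun x => rho0 x - sigma0 x).
  by apply: in_L1B; [case: hrho0|case: hsigma0].
rewrite (L1normE iw) (L1normE i0) /Keps /K_eps (lip_epsE hrmax hv eps hT).
apply: (expeR_stability _ hT ht) => //.
- exact: n1_ge0.
- by move=> q hq; exact: (solution_L1 hr).
- exact: (solution_tvb_bounded heta hrmax hT delta0 WC1 W_ge0 dW_le0 hv eps_cst HE hrho0 hr).
- move=> M HM.
  exact: (solution_stability heta hrmax hT delta0 WC1 W_ge0 dW_le0 hv eps_cst HE hrho0 hsigma0 hr hs HM ht).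
Qed.
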